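(* Let $X$ be a $G$-Banach space with the $G$-Daugavet property and suppose $\alpha_G(X)<2$. (a) Then $X$ does not have the Radon-Nikodým property. In particular, $X$ is not reflexive. (b) If $X$ has an unconditional basis, then $X$ contains a copy of $c_0$.
   Context: Banach spaces are over $\mathbb K=\mathbb R$ or $\mathbb C$; $S_X$ is the unit sphere. A $G$-Banach space is a Banach space $X$ endowed with an action of a group $G$ by surjective linear isometries (no continuity assumed). $X$ has the $G$-Daugavet property if every rank-one bounded linear operator $T:X\to X$ satisfies $\sup_{g\in G}\|\mathrm{Id}_X+g\circ T\|=1+\|T\|$, where $(g\circ T)(x)=g(Tx)$. The parameter $\alpha_G(X)$ is $\alpha_G(X)=\sup\{\|gx-x\|:g\in G,\ x\in S_X\}$. ''Contains a copy of $c_0$'' means it has a closed subspace linearly isomorphic to $c_0$. *)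

(* Defs.v *)
From HB Require Import structures.
From mathcomp Require Import all_boot all_order all_algebra.
From mathcomp Require Import complex.
From mathcomp Require Import all_classical all_reals all_analysis.

Set Implicit Arguments.
Unset Strict Implicit.
Unset Printing Implicit Defensive.

Import Order.TTheory GRing.Theory Num.Theory.
Import numFieldNormedType.Exports.

Local Open Scope classical_set_scope.
Local Open Scope ring_scope.

Variant scalar_kind := RealScalars | ComplexScalars.

Definition scalars (R : realType) (k : scalar_kind) : numFieldType :=
  match k with
  | RealScalars => R
  | ComplexScalars => complex R
  end.

Definition re_scalar (R : realType) (k : scalar_kind) : scalars R k -> R :=
  match k return scalars R k -> R with
  | RealScalars => fun x => x
  | ComplexScalars => fun z => complex.Re z
  end.

Definition of_real (R : realType) (k : scalar_kind) : R -> scalars R k :=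
  match k return R -> scalars R k with
  | RealScalars => fun x => x
  | ComplexScalars => fun x => real_complex R x
  end.

(* In a normed module over K the norm `|x| is a nonnegative element of K;
   [rnorm x] is the same number seen in R. *)
Definition rnorm (R : realType) (k : scalar_kind)
    (V : normedModType (scalars R k)) (x : V) : R :=
  re_scalar `|x|.

(* +oo when f is unbounded on the unit ball *)
Definition opnorm (R : realType) (k : scalar_kind)
    (V W : normedModType (scalars R k)) (f : V -> W) : \bar R :=
  ereal_sup [set (rnorm (f x))%:E | x in [set x : V | rnorm x <= 1]].

Section GBanach.
Variables (R : realType) (k : scalar_kind).
Variables (G : groupType) (X : normedModType (scalars R k)).

(* Surjectivity of each [act g] follows from [actM] and [act1]. *)
Record isometric_action := IsometricAction {
  act :> G -> {linear X -> X};
  act1 : forall x, act 1%g x = x;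
  actM : forall g h x, act (g * h)%g x = act g (act h x);
  act_isometry : forall g x, `|act g x| = `|x|
}.

Definition rank_one (T : X -> X) : Prop :=
  exists2 y : X, y != 0 & range T = [set c *: y | c in [set: scalars R k]].

Definition G_Daugavet (a : isometric_action) : Prop :=
  forall T : {linear X -> X}, rank_one T -> (opnorm T < +oo)%E ->
    ereal_sup [set opnorm (fun x : X => x + a g (T x)) | g in [set: G]]
    = (1 + opnorm T)%E.

Definition alpha_G (a : isometric_action) : \bar R :=
  ereal_sup [set (rnorm (a p.1 p.2 - p.2))%:E
            | p in [set p : G * X | rnorm p.2 = 1]].

End GBanach.

Section Reflexivity.
Variables (R : realType) (k : scalar_kind) (X : normedModType (scalars R k)).
Local Notation K := (scalars R k).

Definition dual_functional (f : X -> K^o) : Prop :=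
  linear f /\ (opnorm f < +oo)%E.

(* The bidual is encoded by functions on X -> K of which only the values on
   the dual of X matter. *)
Definition bidual_functional (phi : (X -> K^o) -> K^o) : Prop :=
  (forall (c : K) (f g : X -> K^o), dual_functional f -> dual_functional g ->
     phi (fun x => c *: f x + g x) = c *: phi f + phi g) /\
  (exists M : R, forall f : X -> K^o, dual_functional f ->
     ((rnorm (phi f))%:E <= M%:E * opnorm f)%E).

Definition reflexive_space : Prop :=
  forall phi : (X -> K^o) -> K^o, bidual_functional phi ->
    exists x : X, forall f : X -> K^o, dual_functional f -> phi f = f x.

End Reflexivity.

Section VectorMeasure.
Variables (R : realType) (k : scalar_kind) (X : normedModType (scalars R k)).
Variables (d : measure_display) (T : measurableType d).

Definition vector_measure (m : set T -> X) : Prop :=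
  forall F : nat -> set T, (forall n, measurable (F n)) -> trivIset setT F ->
    series (fun n => m (F n)) @ \oo --> m (\bigcup_n F n).

Definition finite_partition (n : nat) (F : 'I_n -> set T) : Prop :=
  [/\ forall i, measurable (F i), trivIset setT F & \bigcup_i F i = setT].

Definition vector_variation (m : set T -> X) : \bar R :=
  ereal_sup [set v | exists (n : nat) (F : 'I_n -> set T),
    finite_partition F /\ v = (\sum_(i < n) rnorm (m (F i)))%:E].

Variable mu : {finite_measure set T -> \bar R}.

Definition vector_abs_continuous (m : set T -> X) : Prop :=
  forall A, measurable A -> mu A = 0%E -> m A = 0.

Definition simple_function (s : T -> X) : Prop :=
  finite_set (range s) /\ forall x, measurable (s @^-1` [set x]).

Definition simple_integral (E : set T) (s : T -> X) : X :=
  \sum_(x \in range s) of_real k (fine (mu (E `&` s @^-1` [set x]))) *: x.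

Definition strongly_measurable (f : T -> X) : Prop :=
  exists2 s : nat -> T -> X, forall n, simple_function (s n) &
    {ae mu, forall t, s ^~ t @ \oo --> f t}.

(* For strongly measurable f the integrand is measurable off a null set only;
   the library integral, a supremum over simple minorants, ignores that set. *)
Definition simple_L1_approx (f : T -> X) (s : nat -> T -> X) : Prop :=
  (forall n, simple_function (s n)) /\
  ((\int[mu]_t (rnorm (f t - s n t))%:E)%E @[n --> \oo] --> 0%E).

Definition bochner_integrable (f : T -> X) : Prop :=
  strongly_measurable f /\ exists s, simple_L1_approx f s.

(* v is the Bochner integral of f over E *)
Definition is_bochner_integral (E : set T) (f : T -> X) (v : X) : Prop :=
  exists2 s, simple_L1_approx f s &
    simple_integral E (s n) @[n --> \oo] --> v.

End VectorMeasure.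

Definition radon_nikodym_property (R : realType) (k : scalar_kind)
    (X : normedModType (scalars R k)) : Prop :=
  forall (d : measure_display) (T : measurableType d)
         (mu : {finite_measure set T -> \bar R}) (m : set T -> X),
    vector_measure m -> vector_abs_continuous mu m ->
    (vector_variation m < +oo)%E ->
    exists2 f : T -> X, bochner_integrable mu f &
      forall E, measurable E -> is_bochner_integral mu E f (m E).

Section BasesAndC0.
Variables (R : realType) (k : scalar_kind) (X : normedModType (scalars R k)).
Local Notation K := (scalars R k).

Definition schauder_basis (e : nat -> X) : Prop :=
  forall x : X, exists! a : nat -> K,
    series (fun n => a n *: e n) @ \oo --> x.

Definition unconditional_basis (e : nat -> X) : Prop :=
  schauder_basis e /\
  forall (x : X) (a : nat -> K), series (fun n => a n *: e n) @ \oo --> x ->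
    forall p : nat -> nat, bijective p ->
      cvgn (series (fun n => a (p n) *: e (p n))).

Definition c0 : set (nat -> K^o) := [set a | a @ \oo --> (0 : K^o)].

Definition c0_norm (a : nat -> K^o) : R := sup (range (fun n => rnorm (a n))).

(* J restricted to c0 is a linear isomorphism onto its closed image. *)
Definition contains_c0 : Prop :=
  exists J : (nat -> K^o) -> X,
    [/\ forall (c : K) (a b : nat -> K^o), c0 a -> c0 b ->
          J (fun n => c *: a n + b n) = c *: J a + J b,
        exists2 lo : R, 0 < lo & forall a, c0 a -> lo * c0_norm a <= rnorm (J a),
        exists hi : R, forall a, c0 a -> rnorm (J a) <= hi * c0_norm a &
        closed (J @` c0)].

End BasesAndC0.

(* Main.v *)
Require Import Defs.
From HB Require Import structures.
From mathcomp Require Import all_boot all_order all_algebra.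
From mathcomp Require Import complex ring lra.
From mathcomp Require Import all_classical all_reals all_analysis.
From mathcomp Require Import measurable_realfun.

Set Implicit Arguments.
Unset Strict Implicit.
Unset Printing Implicit Defensive.

Import Order.TTheory GRing.Theory Num.Theory.
Import numFieldNormedType.Exports.

Local Open Scope classical_set_scope.
Local Open Scope ring_scope.

(** The G-Daugavet property enters only through the slices of the unit ball.
    Let u be a real functional of norm 1 and c = |c| e a point of the ball with
    |e| = 1.  Applied to the rank-one operator x |-> - u(x) e, the property gives
    a point w of the ball with u(w) close to 1 and |w - g e| close to 2 for some
    g, hence with |w - g c| at least about 1 + |c|.  As |g c - c| <= alpha |c|
    and alpha < 2, the distance |w - c| is bounded below by a constant delta > 0.
    So every slice of the ball contains, for each c in the ball, a point at
    distance at least delta from c ([large_slices], proved in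
    [Daugavet_large_slices]).  The three conclusions follow from this alone; they
    only concern the underlying real normed space ([realif]).

    Radon-Nikodym.  By separation, each c in the ball is as close as desired to
    an average of points of the ball at distance at least delta from c
    ([average_of_far_points]).  Iteration gives a bush: points v_n(i) of the ball
    indexed by the cells of nested equal partitions of the unit interval, such
    that v_n(i) is nearly the average of the v_(n+1)(j) over the children j of i,
    while each of these is at distance at least delta from v_n(i) ([ex_bush]).  The step
    functions v_n form a martingale up to summable errors, so their integrals
    over A converge for each measurable A, to a vector measure m(A) of norm at
    most the length of A.  A Bochner density of m would be close in L1 to a
    simple function s.  On a fine enough level v_n and v_(n+1) are close in mean
    to the averages of s over the cells, and s is nearly constant on most cells;
    hence v_n and v_(n+1) are close in mean, which is absurd
    ([nested_partitions_not_RNP]).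

    Reflexivity and c0.  Inside a slice take two points b, b' at distance delta,
    with u almost maximal at both.  Tilting u by a small multiple of a
    functional k that norms b - b' splits the slice into two subslices on which
    the values of k differ by a fixed amount.  Iteration gives a binary tree of
    slices with chosen points x_s, and any limits z_sigma of the branches, in
    the sense of the functionals used, are uniformly separated; there are
    uncountably many, so no countable set comes close to all of them
    ([cantor_scheme]).
    - In a reflexive space the branches have weak limits along an ultrafilter,
      and these lie in the closed convex hull of the countably many x_s, a
      contradiction ([large_slices_not_reflexive]).
    - Given an unconditional basis, use functionals that depend on finitely many
      coordinates, and coordinatewise limits along an ultrafilter.  These are
      formal series all of whose finite partial sums, over any set of indices,
      are bounded by a common constant.  If all of them converge in X, then X,
      being separable, contradicts the tree.  Otherwise a divergent one has
      blocks bounded away from 0 with bounded sums, and such blocks span c0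
      ([basis_contains_c0]).  The uniform bound on the sections of the basis
      comes from a rearrangement argument at each point
      ([unconditional_bounded_sums]) followed by Baire's theorem
      ([section_bound]). *)

(** * Sublinear functionals and the Hahn-Banach theorem *)

Section HahnBanach.
Variables (R : realType) (V : lmodType R).

Definition sublinear (q : V -> R) : Prop :=
  (forall x y, q (x + y) <= q x + q y) /\
  (forall r x, 0 < r -> q (r *: x) <= r * q x).

Definition linear_form (u : V -> R) : Prop :=
  forall r x y, u (r *: x + y) = r * u x + u y.

Lemma linear_formD u : linear_form u -> forall x y, u (x + y) = u x + u y.
Proof. by move=> lu x y; rewrite -[x]scale1r lu mul1r scale1r. Qed.

Lemma linear_form0 u : linear_form u -> u 0 = 0.
Proof. by move=> lu; have := linear_formD lu 0 0; rewrite addr0; lra. Qed.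

Lemma linear_formZ u : linear_form u -> forall r x, u (r *: x) = r * u x.
Proof.
by move=> lu r x; rewrite -[r *: x]addr0 lu linear_form0// addr0.
Qed.

Lemma linear_formN u : linear_form u -> forall x, u (- x) = - u x.
Proof. by move=> lu x; rewrite -scaleN1r linear_formZ// mulN1r. Qed.

Lemma linear_formB u : linear_form u -> forall x y, u (x - y) = u x - u y.
Proof. by move=> lu x y; rewrite linear_formD// linear_formN. Qed.

Lemma linear_form_sum u (I : Type) (s : seq I) (P : pred I) (F : I -> V) :
  linear_form u -> u (\sum_(i <- s | P i) F i) = \sum_(i <- s | P i) u (F i).
Proof.
move=> lu; apply: (big_morph u); [exact: linear_formD|exact: linear_form0].
Qed.

Lemma sublinear0 q : sublinear q -> q 0 = 0.
Proof.
move=> [_ qZ]; apply/eqP; rewrite eq_le; apply/andP; split.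
- have := qZ 2^-1 0; rewrite scaler0 => /(_ ltac:(by rewrite invr_gt0)); lra.
- have := qZ 2 0; rewrite scaler0 => /(_ ltac:(by [])); lra.
Qed.

Lemma sublinear_opp q x : sublinear q -> - q (- x) <= q x.
Proof.
by move=> sq; have [qD _] := sq; have := qD x (- x); rewrite subrr sublinear0//; lra.
Qed.

Lemma inf_range_le (I : Type) (D : set I) (f : I -> R) (m : R) i :
  (forall i, D i -> m <= f i) -> D i -> inf [set f j | j in D] <= f i.
Proof.
move=> mf Di; apply: ge_inf; last by exists i.
by exists m => _ [j Dj <-]; exact: mf.
Qed.

Lemma le_inf_range (I : Type) (D : set I) (f : I -> R) (m : R) :
  (forall i, D i -> m <= f i) -> D !=set0 -> m <= inf [set f j | j in D].
Proof.
move=> mf [i Di]; apply: lb_le_inf; first by exists (f i), i.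
by move=> _ [j Dj <-]; exact: mf.
Qed.

Lemma inf_range_lt (I : Type) (D : set I) (f : I -> R) (m : R) :
  D !=set0 -> inf [set f j | j in D] < m -> exists2 i, D i & f i < m.
Proof.
move=> [i Di] h; apply: contrapT => nh.
suff : m <= inf [set f j | j in D] by rewrite leNgt h.
apply: le_inf_range; last by exists i.
by move=> j Dj; rewrite leNgt; apply/negP => fj; apply: nh; exists j.
Qed.

Section directional.
Variables (q : V -> R) (z : V).
Hypothesis sq : sublinear q.

Let qz y := inf [set q (y + t *: z) - t * q z | t in [set t | 0 <= t]].

Let qz_bound y t : 0 <= t -> - q (- y) <= q (y + t *: z) - t * q z.
Proof.
have [qD qZ] := sq.
rewrite le_eqVlt => /orP[/eqP <-|t0].
  by rewrite scale0r addr0 mul0r subr0 sublinear_opp.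
have := qD (y + t *: z) (- y); rewrite addrAC subrr add0r.
have := qZ t^-1 (t *: z); rewrite scalerA mulVf ?gt_eqF// scale1r invr_gt0.
move=> /(_ t0) h1 h2.
have : t * q z <= t * (t^-1 * q (t *: z)) by rewrite ler_pM2l.
rewrite mulrA divff ?gt_eqF// mul1r; lra.
Qed.

(** The functional y |-> inf (q (y + t z) - t q z), over t >= 0, lies below q, and
    it equals q only if q (y + z) = q y + q z for all y: this is how minimality
    forces additivity below. *)
Lemma directional_sublinear :
  exists2 q', sublinear q' & forall y, q' y <= q y /\ q' y <= q (y + z) - q z.
Proof.
have [qD qZ] := sq.
exists qz; last first.
  move=> y; split.
    apply: le_trans (inf_range_le (@qz_bound y) (lexx 0)) _.
    by rewrite scale0r addr0 mul0r subr0.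
  apply: le_trans (inf_range_le (@qz_bound y) (@ler01 R)) _.
  by rewrite scale1r mul1r.
have ne : [set t : R | 0 <= t] !=set0 by exists 0 => /=.
split.
  move=> x y; apply/ler_addgt0Pl => e e0.
  have [t1 /= t10 h1] : exists2 t, 0 <= t & q (x + t *: z) - t * q z < qz x + e / 2.
    by apply: inf_range_lt => //; rewrite ltrDl divr_gt0.
  have [t2 /= t20 h2] : exists2 t, 0 <= t & q (y + t *: z) - t * q z < qz y + e / 2.
    by apply: inf_range_lt => //; rewrite ltrDl divr_gt0.
  apply: le_trans (inf_range_le (@qz_bound (x + y)) (addr_ge0 t10 t20)) _.
  have := qD (x + t1 *: z) (y + t2 *: z).
  rewrite addrACA -scalerDl; lra.
move=> r x r0; rewrite -ler_pdivrMl//; apply: le_inf_range => // t /= t0.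
rewrite ler_pdivrMl//.
apply: le_trans (inf_range_le (@qz_bound (r *: x)) (mulr_ge0 (ltW r0) t0)) _.
rewrite -scalerA -scalerDr mulrBr mulrA lerD2r; exact: qZ.
Qed.

End directional.

(** A sublinear functional that is minimal among those below p is linear, because
    lowering it along a direction leaves it unchanged.  Minimal elements exist by
    Zorn's lemma, the bound - p (- x) keeping infima of chains finite. *)
Theorem Hahn_Banach (p : V -> R) : sublinear p ->
  exists2 u, linear_form u & forall x, u x <= p x.
Proof.
move=> sp.
pose T := {q : V -> R | sublinear q /\ forall x, q x <= p x}.
pose le_T (q1 q2 : T) := `[< forall x, sval q2 x <= sval q1 x >].
have Tlow (q : T) x : - p (- x) <= sval q x.
  case: q => q [sq qp] /=; apply: le_trans (sublinear_opp x sq).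
  by rewrite lerN2.
have [||A totA|[q [sq qp]] qmin] := @ZL_preorder T (exist _ p (conj sp (fun x => lexx _))) le_T.
- by move=> q; apply/asboolP.
- move=> q1 q2 q3 /asboolP h1 /asboolP h2; apply/asboolP => x.
  exact: le_trans (h2 x) (h1 x).
- have [->|/set0P A0] := eqVneq A set0.
    by exists (exist _ p (conj sp (fun x => lexx _))) => s [].
  pose m x := inf [set sval q x | q in A].
  have mle q x : A q -> m x <= sval q x.
    by move=> Aq; apply: (inf_range_le (f := fun q : T => sval q x)
      (fun q _ => Tlow q x) Aq).
  have sm : sublinear m.
    split=> [x y|r x r0].
      apply/ler_addgt0Pl => e e0.
      have [q1 Aq1 h1] : exists2 q, A q & sval q x < m x + e / 2.
        by apply: inf_range_lt => //; rewrite ltrDl divr_gt0.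
      have [q2 Aq2 h2] : exists2 q, A q & sval q y < m y + e / 2.
        by apply: inf_range_lt => //; rewrite ltrDl divr_gt0.
      case: (totA _ _ Aq1 Aq2) => /asboolP h.
        apply: le_trans (mle q2 _ Aq2) _.
        case: q2 {Aq2} h2 h => q2 [[q2D _] _] /= h2 h.
        have := h x; have := q2D x y; lra.
      apply: le_trans (mle q1 _ Aq1) _.
      case: q1 {Aq1} h1 h => q1 [[q1D _] _] /= h1 h.
      have := h y; have := q1D x y; lra.
    rewrite -ler_pdivrMl//; apply: le_inf_range => // q Aq.
    rewrite ler_pdivrMl//; apply: le_trans (mle q _ Aq) _.
    by case: q {Aq} => q [[_ qZ] _] /=; exact: qZ.
  have mp x : m x <= p x.
    have [q Aq] := A0; apply: le_trans (mle q x Aq) _.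
    by case: q {Aq} => q [_ qp] /=.
  by exists (exist _ m (conj sm mp)) => q Aq; apply/asboolP => x /=; exact: mle.
have [qD qZ] := sq.
have qadd x y : q (x + y) = q x + q y.
  apply/eqP; rewrite eq_le qD/=.
  have [q' sq' q'P] := directional_sublinear y sq.
  have q'p x' : q' x' <= p x' by have [+ _] := q'P x'; have := qp x'; lra.
  have /asboolP h := qmin (exist _ q' (conj sq' q'p))
    (asboolT (fun x => (q'P x).1)).
  have := h x => /=; have [_] := q'P x; lra.
have q0 : q 0 = 0 by apply: sublinear0.
have qN x : q (- x) = - q x.
  by have := qadd x (- x); rewrite subrr q0; lra.
have qZp r x : 0 < r -> q (r *: x) = r * q x.
  move=> r0; apply/eqP; rewrite eq_le qZ//=.
  have := qZ r (- x) r0; rewrite scalerN !qN; lra.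
exists q => // r x y; rewrite qadd; congr (_ + _).
have [r0|r0|->] := ltgtP r 0; last by rewrite scale0r q0 mul0r.
  have := qZp (- r) x; rewrite oppr_gt0 => /(_ r0).
  by rewrite scaleNr qN mulNr => /oppr_inj.
exact: qZp.
Qed.

End HahnBanach.

(** * Separating a point from the averages of a set *)

Section Separation.
Variables (R : realType) (V : normedModType R).
Implicit Types (C : set V) (s : seq V).

Definition average s : V := (size s)%:R^-1 *: \sum_(c <- s) c.

Section gauge.
Variables (C : set V) (x0 : V) (e : R).
Hypothesis e0 : 0 <= e.
Hypothesis farC : forall s, s != [::] -> (forall c, c \in s -> C c) ->
  e <= `|average s - x0|.

Let W : set (seq (R * V)) :=
  [set w : seq (R * V) | forall p, p \in w -> 0 <= p.1 /\ C p.2].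
Let total (w : seq (R * V)) := \sum_(p <- w) p.1.
Let shift (w : seq (R * V)) := \sum_(p <- w) p.1 *: (p.2 - x0).

(** Integer weights are multiplicities in a list, so the hypothesis on plain
    averages applies. *)
Let shift_nat (w : seq (nat * V)) : (forall p, p \in w -> C p.2) ->
  e * (\sum_(p <- w) p.1)%:R <= `|\sum_(p <- w) p.1%:R *: (p.2 - x0)|.
Proof.
move=> Cw; pose s := flatten [seq nseq p.1 p.2 | p <- w].
have szs : size s = (\sum_(p <- w) p.1)%N.
  rewrite size_flatten /shape -map_comp sumnE big_map.
  by apply: eq_bigr => p _ /=; rewrite size_nseq.
have sums : \sum_(p <- w) p.1%:R *: (p.2 - x0) = \sum_(c <- s) (c - x0).
  rewrite big_flatten/= big_map; apply: eq_bigr => p _.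
  rewrite big_nseq.
  by rewrite iter_addr_0 scaler_nat.
have [s0|s0] := eqVneq s [::].
  by rewrite -szs s0 mulr0 normr_ge0.
have n0 : (0 : R) < (size s)%:R by rewrite ltr0n; case: (s) s0.
have Cs c : c \in s -> C c.
  by move=> /flatten_mapP[p /Cw Cp]; rewrite mem_nseq => /andP[_ /eqP ->].
have := farC s0 Cs; rewrite -(ler_pM2l n0) -szs mulrC => /le_trans; apply.
rewrite -[leLHS](ger0_norm (_ : 0 <= (size s)%:R * _)) ?mulr_ge0 ?ler0n//.
rewrite normrM normr_id -normrZ /average sums scalerBr scalerA divff ?gt_eqF//.
by rewrite scale1r sumrB big_const_seq count_predT iter_addr_0 scaler_nat.
Qed.

(** Real weights are multiplied by a large N and rounded down; the rounding error
    stays below D whatever N is. *)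
Let shift_bound w : W w -> e * total w <= `|shift w|.
Proof.
move=> Ww; rewrite leNgt; apply/negP => h.
pose D := \sum_(p <- w) (`|p.2 - x0| + e).
have D0 : 0 <= D by apply: sumr_ge0 => p _; rewrite addr_ge0.
pose g := e * total w - `|shift w|.
have g0 : 0 < g by rewrite subr_gt0.
pose N := (Num.truncn (D / g)).+1.
have N0 : 0 < N%:R :> R by rewrite ltr0n.
have : D < N%:R * g by rewrite -ltr_pdivrMr// truncnS_gt.
apply/negP; rewrite -leNgt.
pose w' := [seq (Num.truncn (N%:R * p.1), p.2) | p <- w].
have /shift_nat : forall p, p \in w' -> C p.2.
  by move=> _ /mapP[p /Ww[_ Cp] ->].
rewrite !big_map /= natr_sum => h1.
have tr p : p \in w -> (Num.truncn (N%:R * p.1))%:R <= N%:R * p.1 <=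
    (Num.truncn (N%:R * p.1))%:R + 1.
  move=> /Ww[p0 _]; have /truncn_itv : 0 <= N%:R * p.1 by rewrite mulr_ge0.
  by move=> /andP[-> /ltW]; rewrite -natr1.
have h2 : e * (N%:R * total w) <= e * \sum_(p <- w)
    (Num.truncn (N%:R * p.1))%:R + \sum_(p <- w) e.
  rewrite -[X in _ + X]mulr1 in h1 *.
  rewrite /total mulr_sumr !mulr_sumr mulr1 -big_split/= !big_seq.
  apply: ler_sum => p pw; rewrite -[X in _ + X]mulr1 -mulrDr ler_wpM2l//.
  by have /andP[] := tr _ pw.
have h3 : `|\sum_(p <- w) (Num.truncn (N%:R * p.1))%:R *: (p.2 - x0)|
    <= N%:R * `|shift w| + \sum_(p <- w) `|p.2 - x0|.
  rewrite -[X in X * `|shift w|](ger0_norm (ltW N0)) -normrZ /shift scaler_sumr.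
  rewrite -lerBlDl; apply: le_trans (lerB_dist _ _) _.
  rewrite -sumrB; apply: le_trans (ler_norm_sum _ _ _) _.
  rewrite !big_seq; apply: ler_sum => p pw.
  rewrite scalerA -scalerBl normrZ ler_piMl// ler_norml.
  by have /andP[] := tr _ pw; lra.
rewrite mulrBr /D big_split/=; lra.
Qed.

(** The functional y |-> inf_w |y + sum_i t_i (c_i - x0)| - e sum_i t_i, over
    weighted lists w = (t_i, c_i), is sublinear, and [shift_bound] keeps it
    finite.  It is at most |y|, as the empty list shows, and at most - e at
    x0 - c, as the list [:: (1, c)] shows; so a linear form below it separates. *)
Theorem separation : exists2 u : V -> R, linear_form u /\ (forall x, u x <= `|x|) &
  forall c, C c -> u x0 + e <= u c.
Proof.
pose gap y w := `|y + shift w| - e * total w.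
pose p y := inf [set gap y w | w in W].
have gap_ge y w : W w -> - `|y| <= gap y w.
  move=> Ww; rewrite /gap; have := shift_bound Ww.
  have := ler_normB (y + shift w) y; rewrite addrAC subrr add0r; lra.
have W0 : W [::] by [].
have neW : W !=set0 by exists [::].
have catE w1 w2 : (shift (w1 ++ w2) = shift w1 + shift w2) *
    (total (w1 ++ w2) = total w1 + total w2).
  by rewrite /shift /total !big_cat.
have sp : sublinear p.
  split=> [x y|r x r0].
    apply/ler_addgt0Pl => d d0.
    have [w1 Ww1 h1] : exists2 w, W w & gap x w < p x + d / 2.
      by apply: inf_range_lt => //; rewrite ltrDl divr_gt0.
    have [w2 Ww2 h2] : exists2 w, W w & gap y w < p y + d / 2.
      by apply: inf_range_lt => //; rewrite ltrDl divr_gt0.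
    have Ww : W (w1 ++ w2).
      by move=> q; rewrite mem_cat => /orP[/Ww1|/Ww2].
    apply: le_trans (inf_range_le (@gap_ge (x + y)) Ww) _.
    move: h1 h2; rewrite /gap !catE addrACA.
    have := ler_normD (x + shift w1) (y + shift w2); lra.
  rewrite -ler_pdivrMl//; apply: le_inf_range => // w Ww.
  rewrite ler_pdivrMl//.
  pose w' := [seq (r * q.1, q.2) | q <- w].
  have Ww' : W w'.
    move=> _ /mapP[q /Ww[q0 Cq] ->] /=; split=> //.
    by rewrite mulr_ge0// ltW.
  apply: le_trans (inf_range_le (@gap_ge (r *: x)) Ww') _.
  rewrite /gap; have -> : shift w' = r *: shift w.
    by rewrite /shift big_map scaler_sumr; apply: eq_bigr => q _; rewrite scalerA.
  have -> : total w' = r * total w by rewrite /total big_map mulr_sumr.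
  by rewrite -scalerDr normrZ (gtr0_norm r0) mulrBr mulrCA.
have [u lu up] := Hahn_Banach sp.
exists u.
  split=> // x; apply: le_trans (up x) _.
  apply: le_trans (inf_range_le (@gap_ge x) W0) _.
  by rewrite /gap /shift /total !big_nil addr0 mulr0 subr0.
move=> c Cc.
have Wc : W [:: (1, c)] by move=> q; rewrite inE => /eqP -> /=.
have := le_trans (up (x0 - c)) (inf_range_le (@gap_ge (x0 - c)) Wc).
rewrite /gap /shift /total !big_seq1/= scale1r mulr1 linear_formB//.
by rewrite -[c - x0]opprB subrr normr0; lra.
Qed.

End gauge.

(** All averages of copies of x are equal to x, so 0 is at distance |x| from
    them. *)
Lemma norming_form (x : V) :
  exists2 u : V -> R, linear_form u /\ (forall y, u y <= `|y|) & `|x| <= u x.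
Proof.
have [||u lu uP] := @separation [set x] 0 `|x|.
- exact: normr_ge0.
- move=> s s0 sx; rewrite subr0 /average (_ : \sum_(c <- s) c = x *+ size s).
    have n0 : (size s)%:R != 0 :> R by rewrite pnatr_eq0; case: (s) s0.
    by rewrite -[x *+ _]scaler_nat scalerA mulVf ?scale1r.
  rewrite big_seq (eq_bigr (fun _ => x)); last by move=> c /sx.
  by rewrite -big_seq big_const_seq count_predT iter_addr_0.
exists u => //.
by have := uP x erefl; rewrite linear_form0 ?add0r//; case: lu.
Qed.

End Separation.

(** * Binary trees of slices *)

Section CantorScheme.
Variables (R : realType) (V : normedModType R).

Definition bounded_form (u : V -> R) : Prop :=
  linear_form u /\ exists C, forall x, u x <= C * `|x|.

Lemma bounded_form_comb u l r : bounded_form u -> bounded_form l ->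
  bounded_form (fun x => u x + r * l x).
Proof.
move=> [lu [C uC]] [ll [D lD]]; split; first by move=> s y z; rewrite lu ll; ring.
exists (C + `|r| * D) => y; rewrite mulrDl lerD// -mulrA.
have [r0|r0] := lerP 0 r; first by rewrite ger0_norm// ler_wpM2l.
have := lD (- y); rewrite (linear_formN ll) normrN ltr0_norm// => h; nra.
Qed.

Definition slice (u : V -> R) (a : R) : set V :=
  [set w | `|w| <= 1 /\ a < u w].

(** No nonempty slice lies in the open ball of radius delta around a point of
    the unit ball; this is the form in which the G-Daugavet property is used. *)
Definition large_slices (delta : R) : Prop :=
  forall u a, bounded_form u -> slice u a !=set0 ->
  forall c, `|c| <= 1 -> exists2 w, slice u a w & delta <= `|w - c|.

(** The latest choice comes first, so that refining a branch is a cons. *)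
Fixpoint branch (sigma : nat -> bool) (n : nat) : seq bool :=
  if n is m.+1 then sigma m :: branch sigma m else [::].

Lemma eq_branch (sigma tau : nat -> bool) n :
  (forall m, (m < n)%N -> sigma m = tau m) -> branch sigma n = branch tau n.
Proof.
elim: n => //= n ih h; rewrite h// ih// => m mn.
by apply: h; rewrite ltnS ltnW.
Qed.

Lemma no_injection_cantor (I : countType) (F : (nat -> bool) -> I) : ~ injective F.
Proof.
move=> Finj.
have /choice[g gP] : forall n, exists sigma : nat -> bool,
    forall tau, pickle (F tau) = n -> sigma = tau.
  move=> n; have [[tau <-]|h] := pselect (exists tau, pickle (F tau) = n).
    by exists tau => tau' /(pcan_inj pickleK)/Finj.
  by exists xpredT => tau e; exfalso; apply: h; exists tau.
pose d n := ~~ g n n.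
have dE n : d n = ~~ g n n by [].
have := dE (pickle (F d)); rewrite (gP _ d erefl).
by case: (d _).
Qed.

Variables (delta kappa : R) (H : set (V -> R)).
Hypotheses (delta0 : 0 < delta) (kappa0 : 0 < kappa).
Hypothesis Vslices : large_slices delta.
Hypothesis H_bounded : H `<=` bounded_form.
Hypothesis H_comb : forall u k r, H u -> H k -> H (fun x => u x + r * k x).
Hypothesis H_norming : forall x, exists k,
  [/\ H k, forall y, k y <= `|y| & kappa * `|x| <= k x].

Let gap := kappa * delta / 2.
Let gap0 : 0 < gap.
Proof. by rewrite /gap divr_gt0// mulr_gt0. Qed.

Let node := {p : (V -> R) * R | H p.1 /\ slice p.1 p.2 !=set0}.
Let slice_of (p : node) : set V := slice (sval p).1 (sval p).2.

(** Let phi be the supremum of u on the ball, b a point where u is almost phi, and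
    b' a point of the same thin slice far from b.  A functional k norming b - b'
    is larger at b than at b' by 2 gap.  For small r, consider the points of the ball
    where u + r k exceeds its value at b up to a small error.  They satisfy u > a,
    since the tilt changes u by at most r, and k is almost at least k b on them,
    since u is at most phi.  The functional u - r k and b' give the other half. *)
Let split_slice (p : node) : exists q : node * node,
  [/\ slice_of q.1 `<=` slice_of p, slice_of q.2 `<=` slice_of p &
    exists k r, [/\ H k, forall y, k y <= `|y|,
      forall w, slice_of q.1 w -> r + gap <= k w &
      forall w, slice_of q.2 w -> k w <= r]].
Proof.
case: p => -[u a] [/= Hu [w0 [w01 aw0]]]; rewrite /slice_of/=.
have [lu [C uC]] := H_bounded Hu.
pose ball := [set u w | w in [set w | `|w| <= 1]].
pose phi := sup ball.
have ubball : has_ubound ball.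
  exists `|C| => _ [w /= w1 <-]; apply: le_trans (uC w) _.
  apply: le_trans (ler_norm _) _; rewrite normrM normr_id.
  by rewrite ler_piMr.
have hs : has_sup ball by split=> //; exists (u w0), w0.
have uphi w : `|w| <= 1 -> u w <= phi by move=> w1; apply: ub_le_sup => //; exists w.
have aphi : a < phi by apply: lt_le_trans aw0 (uphi _ w01).
(* 3 r < phi - a keeps the halves inside the slice: r for the error e and 2 r
   for the tilt; e <= r gap / 2 is what costs k at most gap / 2 on each half. *)
pose r := (phi - a) / 4.
have r0 : 0 < r by rewrite divr_gt0// subr_gt0.
have ra : 4 * r = phi - a by rewrite /r; lra.
pose e := Num.min r (r * gap / 2).
have e0 : 0 < e by rewrite lt_min r0/= divr_gt0// mulr_gt0.
have er : e <= r by rewrite ge_min lexx.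
have erg : e <= r * gap / 2 by rewrite ge_min lexx orbT.
have [_ [b b1 <-] ub] := sup_adherent e0 hs.
have [b' [b'1 ub'] bb'] := Vslices (H_bounded Hu) (ex_intro _ b (conj b1 ub)) b1.
have [k [Hk k1 kbb]] := H_norming (b - b').
have [lk _] := H_bounded Hk.
have kN y : - `|y| <= k y.
  by have := k1 (- y); rewrite linear_formN// normrN; lra.
have kb : k b' + 2 * gap <= k b.
  have : kappa * delta <= kappa * `|b - b'| by rewrite ler_pM2l// distrC.
  by move: kbb; rewrite (linear_formB lk) /gap; lra.
pose u0 x := u x + r * k x.
pose u1 x := u x + (- r) * k x.
pose a0 := phi - e + r * k b.
pose a1 := phi - e - r * k b'.
have kw w : `|w| <= 1 -> - r <= r * k w <= r.
  move=> w1; have h1 : k w <= 1 by have := k1 w; lra.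
  have h2 : - 1 <= k w by have := kN w; lra.
  by apply/andP; split; nra.
have n0 : H u0 /\ slice u0 a0 !=set0.
  split; first exact: H_comb.
  by exists b; split=> //; rewrite /a0 /u0 ltrD2r.
have n1 : H u1 /\ slice u1 a1 !=set0.
  split; first exact: H_comb.
  by exists b'; split=> //; rewrite /a1 /u1 mulNr ltrD2r.
exists (exist _ (u0, a0) n0, exist _ (u1, a1) n1); split=> /=.
- move=> w [w1]; rewrite /u0 /a0 => h; split=> //.
  by have := kw _ w1; have := kw _ b1; lra.
- move=> w [w1]; rewrite /u1 /a1 => h; split=> //.
  by have := kw _ w1; have := kw _ b'1; lra.
exists k, (k b' + gap / 2); split=> //.
- move=> w [w1]; rewrite /u0 /a0 => h.
  rewrite -(ler_pM2l r0).
  have : r * (k b' + 2 * gap) <= r * k b by rewrite ler_pM2l.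
  have := uphi _ w1; rewrite !mulrDr; lra.
- move=> w [w1]; rewrite /u1 /a1 => h.
  rewrite -(ler_pM2l r0).
  have := uphi _ w1; rewrite !mulrDr; lra.
Qed.

(** Two branches that first differ at level n lie in the two halves of a split
    slice, on which some k in H of norm at most 1 differs by gap; lower bounds of
    k and of k - 2 k = - k pass to z, so the points z sigma are gap-separated.
    The hypothesis on z makes z sigma behave like a limit of the branch sigma as
    far as H is concerned; in the applications it is a limit along an ultrafilter,
    and H decides in which topology. *)
Theorem cantor_scheme : exists (x : seq bool -> V) (c : R),
  [/\ 0 < c, forall s, `|x s| <= 1 &
   forall z : (nat -> bool) -> V,
    (forall sigma k r, H k ->
      (exists N, forall n, (N <= n)%N -> r <= k (x (branch sigma n))) ->
      r <= k (z sigma)) ->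
    forall (I : countType) (D : I -> V),
      ~ (forall sigma, exists i, `|z sigma - D i| < c)].
Proof.
have /choice[child childP] := split_slice.
have [root _] : exists p : node, True.
  have [k [Hk _ _]] := H_norming 0.
  have ne : H k /\ slice k (- 1) !=set0.
    split=> //; exists 0; split; first by rewrite normr0.
    by have [lk _] := H_bounded Hk; rewrite (linear_form0 lk) ltrN10.
  by exists (exist _ (k, -1) ne).
pose node_at := foldr (fun (b : bool) p => if b then (child p).1 else (child p).2) root.
have /choice[x xP] : forall s, exists w, slice_of (node_at s) w.
  by move=> s; have [_] := svalP (node_at s).
have nested (sigma : nat -> bool) n m : (n <= m)%N ->
    slice_of (node_at (branch sigma m)) `<=` slice_of (node_at (branch sigma n)).
  move=> /subnK <-; elim: (m - n)%N => // d ih; rewrite addSn /=.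
  apply: subset_trans ih.
  have [c1 c2 _] := childP (node_at (branch sigma (d + n))).
  by case: (sigma _).
exists x, (gap / 2); split.
- by rewrite divr_gt0.
- by move=> s; have [] := xP s.
move=> z zP I D near_D.
have sep (sigma tau : nat -> bool) n :
    (forall m, (m < n)%N -> sigma m = tau m) -> sigma n -> ~~ tau n ->
    gap <= `|z sigma - z tau|.
  move=> eqn sn tn.
  have [_ _ [k [r [Hk k1 kt kf]]]] := childP (node_at (branch sigma n)).
  have [lk _] := H_bounded Hk.
  have h1 : r + gap <= k (z sigma).
    apply: zP => //; exists n.+1 => m nm; apply: kt.
    by have := nested sigma _ _ nm _ (xP (branch sigma m)); rewrite /= sn.
  have h2 : - r <= k (z tau) + (- 2) * k (z tau).
    apply: (zP tau (fun y => k y + (- 2) * k y)); first exact: H_comb.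
    exists n.+1 => m nm; suff : k (x (branch tau m)) <= r by lra.
    apply: kf; have := nested tau _ _ nm _ (xP (branch tau m)).
    by rewrite /= (negbTE tn) (eq_branch eqn).
  by have := k1 (z sigma - z tau); rewrite (linear_formB lk); lra.
have [F FP] := choice near_D.
apply: (@no_injection_cantor I F) => sigma tau Fst.
apply: contrapT => nst.
have dst : exists n, sigma n != tau n.
  apply: contrapT => h; apply: nst; apply/funext => n; apply/eqP.
  by apply: contrapT => /negP ?; apply: h; exists n.
have close : `|z sigma - z tau| < gap.
  rewrite -(subrKA (D (F sigma))); apply: le_lt_trans (ler_normD _ _) _.
  by have := FP sigma; have := FP tau; rewrite -Fst [X in X < _ -> _]distrC; lra.
case: (ex_minnP dst) => n neq nmin.
have eqn m : (m < n)%N -> sigma m = tau m.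
  by move=> mn; apply/eqP; apply: contraTT mn => /nmin; rewrite -leqNgt.
have := neq; case sn : (sigma n); case tn : (tau n) => // _.
  by have := sep _ _ _ eqn sn (negbT tn); rewrite leNgt close.
have := sep tau sigma n (fun m mn => esym (eqn m mn)) tn (negbT sn).
by rewrite distrC leNgt close.
Qed.

End CantorScheme.

(** * Real and complex scalars, and the underlying real normed space *)

Section Scalars.
Variables (R : realType) (k : scalar_kind).
Local Notation K := (scalars R k).
Local Notation re := (@re_scalar R k).
Implicit Types r s : R.

Lemma reD (z w : K) : re (z + w) = re z + re w.
Proof. by case: k z w => // -[a b] [c d]. Qed.

Lemma re0 : re 0 = 0.
Proof. by case: k. Qed.

Lemma reN (z : K) : re (- z) = - re z.
Proof. by case: k z => // -[a b]. Qed.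

Lemma reB (z w : K) : re (z - w) = re z - re w.
Proof. by rewrite reD reN. Qed.

Lemma re_of_real r : re (of_real k r) = r.
Proof. by case: k. Qed.

Lemma of_realD r s : of_real k (r + s) = of_real k r + of_real k s.
Proof. by case: k => //=; rewrite rmorphD. Qed.

Lemma of_realM r s : of_real k (r * s) = of_real k r * of_real k s.
Proof. by case: k => //=; rewrite rmorphM. Qed.

Lemma of_real1 : of_real k (1 : R) = 1.
Proof. by case: k. Qed.

Lemma of_real0 : of_real k (0 : R) = 0.
Proof. by case: k. Qed.

Lemma of_realN r : of_real k (- r) = - of_real k r.
Proof. by case: k => //=; rewrite rmorphN. Qed.

Lemma re_of_realM r (z : K) : re (of_real k r * z) = r * re z.
Proof.
by case: k z => //= -[a b] /=; rewrite mul0r subr0.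
Qed.

Lemma norm_of_real r : `|of_real k r| = of_real k `|r|.
Proof. by case: k => //=; rewrite normc_def/= expr0n addr0 sqrtr_sqr. Qed.

Lemma of_real_le r s : (of_real k r <= of_real k s) = (r <= s).
Proof. by case: k => //=; rewrite lecR. Qed.

Lemma of_real_lt r s : (of_real k r < of_real k s) = (r < s).
Proof. by case: k => //=; rewrite ltcR. Qed.

Lemma re_le (z w : K) : z <= w -> re z <= re w.
Proof. by case: k z w => //= z w; rewrite lecE => /andP[]. Qed.

Lemma re_real (z : K) : 0 <= z -> of_real k (re z) = z.
Proof.
by case: k z => //= z z0; rewrite RRe_real// realE z0.
Qed.

Lemma re_norm_le (z : K) : `|re z| <= re `|z|.
Proof.
by case: k z => //= z; have := normc_ge_Re z; rewrite lecE /= => /andP[].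
Qed.

(** With the value 0 in the real case, the decomposition z = re z + i im z and the
    formulas derived from it hold for both kinds of scalars. *)
Definition imunit : K :=
  match k return scalars R k with
  | RealScalars => 0
  | ComplexScalars => Complex 0 1
  end.

Definition im_scalar (z : K) : R := re (- imunit * z).

Lemma re_imE (z : K) : z = of_real k (re z) + imunit * of_real k (im_scalar z).
Proof.
rewrite /im_scalar /imunit; case: k z => [z|[a b]] /=; first by rewrite mul0r addr0.
by apply/eqP; rewrite eq_complex /=; apply/andP; split; apply/eqP; ring.
Qed.

Lemma re_imunit r : re (imunit * of_real k r) = 0.
Proof. by rewrite /imunit; case: k => /=; rewrite ?mul0r// mulr0 subrr. Qed.

Lemma imunit_mul_norm (z : K) : `|imunit * z| <= `|z|.
Proof.
rewrite normrM -[leRHS]mul1r ler_wpM2r// /imunit; case: k => /=.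
  by rewrite normr0.
by rewrite normc_def/= expr0n expr1n add0r sqrtr1.
Qed.

Lemma imunit_sqr : imunit = 0 \/ imunit * imunit = -1.
Proof.
rewrite /imunit; case: k => /=; [by left|right].
by apply/eqP; rewrite eq_complex /=; apply/andP; split; apply/eqP; ring.
Qed.

Definition of_parts (p q : R) : K := of_real k p + imunit * of_real k q.

Lemma of_partsM (c : K) p q : c * of_parts p q =
  of_parts (re_scalar c * p - im_scalar c * q) (re_scalar c * q + im_scalar c * p).
Proof.
rewrite /of_parts /im_scalar /imunit; case: k c => [c|[a b]] /=; first by ring.
by apply/eqP; rewrite eq_complex /=; apply/andP; split; apply/eqP; ring.
Qed.

Lemma of_partsD p q p' q' : of_parts p q + of_parts p' q' = of_parts (p + p') (q + q').
Proof. by rewrite /of_parts !of_realD mulrDr addrACA. Qed.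

Lemma im_scalarD (z w : K) : im_scalar (z + w) = im_scalar z + im_scalar w.
Proof. by rewrite /im_scalar mulrDr reD. Qed.

Lemma re_scalarM (z w : K) :
  re_scalar (z * w) = re_scalar z * re_scalar w - im_scalar z * im_scalar w.
Proof.
by rewrite {1}(re_imE w) of_partsM /of_parts reD re_imunit addr0 re_of_real.
Qed.

Lemma im_scalarM (z w : K) :
  im_scalar (z * w) = re_scalar z * im_scalar w + im_scalar z * re_scalar w.
Proof.
rewrite /im_scalar /imunit; case: k z w => [z w|[a b] [c d]] /=; by ring.
Qed.

Lemma im_norm_le (z : K) : `|im_scalar z| <= re_scalar `|z|.
Proof.
apply: le_trans (re_norm_le _) _; apply: re_le.
by rewrite mulNr normrN; exact: imunit_mul_norm.
Qed.

Lemma re_norm_of_parts p q : re_scalar `|of_parts p q| <= `|p| + `|q|.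
Proof.
apply: le_trans (re_le (ler_normD _ _)) _; rewrite reD norm_of_real re_of_real.
rewrite lerD2l; apply: le_trans (re_le (imunit_mul_norm _)) _.
by rewrite norm_of_real re_of_real.
Qed.

Lemma phaseP (z : K) : exists2 c : K, `|c| = 1 & c * z = `|z|.
Proof.
have [->|z0] := eqVneq z 0; first by exists 1; rewrite ?normr1// mulr0 normr0.
exists (`|z| / z); last by rewrite mulfVK.
by rewrite normf_div normr_id divff// normr_eq0.
Qed.

End Scalars.

Section Realification.
Variables (R : realType) (k : scalar_kind).

(** The real normed space underlying X.  A separate type is needed because the
    norm of X takes its values in the scalar field. *)
Definition realif (X : normedModType (scalars R k)) : Type := X.

Variable X : normedModType (scalars R k).

HB.instance Definition _ := GRing.Zmodule.copy (realif X) X.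

Definition real_scale (r : R) (x : realif X) : realif X := of_real k r *: (x : X).

Lemma real_scaleA r s x : real_scale r (real_scale s x) = real_scale (r * s) x.
Proof. by rewrite /real_scale scalerA of_realM. Qed.

Lemma real_scale1 : left_id 1 real_scale.
Proof. by move=> x; rewrite /real_scale of_real1 scale1r. Qed.

Lemma real_scaleDr : right_distributive real_scale +%R.
Proof. by move=> r x y; rewrite /real_scale scalerDr. Qed.

Lemma real_scaleDl x : {morph real_scale^~ x : r s / r + s}.
Proof. by move=> r s; rewrite /real_scale of_realD scalerDl. Qed.

HB.instance Definition _ := GRing.Zmodule_isLmodule.Build R (realif X)
  real_scaleA real_scale1 real_scaleDr real_scaleDl.

Lemma of_rnorm (x : X) : of_real k (rnorm x) = `|x|.
Proof. by rewrite /rnorm re_real. Qed.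

Lemma rnorm_triangle (x y : X) : rnorm (x + y) <= rnorm x + rnorm y.
Proof. by rewrite /rnorm -reD; apply/re_le/ler_normD. Qed.

Lemma rnorm_real_scale r (x : realif X) : rnorm (r *: x : X) = `|r| * rnorm (x : X).
Proof.
by rewrite /rnorm [X in `|X|]/(real_scale _ _) normrZ norm_of_real re_of_realM.
Qed.

Lemma rnorm_eq0 (x : X) : rnorm x = 0 -> x = 0.
Proof.
by move=> x0; apply/normr0_eq0; rewrite -of_rnorm x0 of_real0.
Qed.

HB.instance Definition _ := Lmodule_isNormed.Build R (realif X)
  rnorm_triangle rnorm_real_scale rnorm_eq0.

Lemma realif_normE (x : X) : `|x : realif X| = rnorm x.
Proof. by []. Qed.

Lemma realif_scaleE r (x : X) : r *: (x : realif X) = of_real k r *: x.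
Proof. by []. Qed.

Lemma realif_normZ (c : scalars R k) (x : X) :
  `|(c *: x : X) : realif X| = re_scalar `|c| * `|x : realif X|.
Proof. by rewrite !realif_normE /rnorm normrZ -{1}of_rnorm mulrC re_of_realM mulrC. Qed.

End Realification.

Section RealificationTopology.
Variables (R : realType) (k : scalar_kind).

Lemma cvg_realif (X : normedModType (scalars R k)) (T : Type)
    (F : set_system T) (f : T -> X) (x : X) : Filter F ->
  f @ F --> x <-> (f : T -> realif X) @ F --> (x : realif X).
Proof.
move=> FF; split.
- move=> /cvgrPdist_lt h; apply/cvgrPdist_lt => e e0.
  have : 0 < of_real k e by rewrite -of_real0 of_real_lt.
  move=> /h; apply: filterS => t.
  by rewrite -of_rnorm of_real_lt.
- move=> /cvgrPdist_lt h; apply/cvgrPdist_lt => e e0.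
  have ee : of_real k (re_scalar e) = e by rewrite re_real// ltW.
  have : 0 < re_scalar e by rewrite -(of_real_lt k) of_real0 ee.
  move=> /h; apply: filterS => t.
  by move=> xt; rewrite -ee -of_rnorm of_real_lt.
Qed.

Lemma realif_complete (X : completeNormedModType (scalars R k))
  (F : set_system (realif X)) : ProperFilter F -> cauchy F -> cvg F.
Proof.
move=> FF cF.
have /cauchy_cvg cX : cauchy (F : set_system X).
  apply/cauchy_ballP => e e0.
  have ee : of_real k (re_scalar e) = e by rewrite re_real// ltW.
  have e0' : 0 < re_scalar e by rewrite -(of_real_lt k) of_real0 ee.
  move/cauchy_ballP : cF => /(_ _ e0'); apply: filterS => -[x y] /=.
  rewrite -!ball_normE /ball_ /= => xy.
  by rewrite -ee -of_rnorm of_real_lt.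
have /cvg_ex[x Fx] := cX.
apply/cvg_ex; exists x.
exact: (@cvg_realif X (realif X) F idfun x _).1.
Qed.

HB.instance Definition _ (X : completeNormedModType (scalars R k)) :=
  Uniform_isComplete.Build (realif X) (@realif_complete X).

End RealificationTopology.

(** * Slices of the ball under the G-Daugavet property *)

Section ScalarForm.
Variables (R : realType) (k : scalar_kind) (X : normedModType (scalars R k)).
Local Notation K := (scalars R k).
Local Notation V := (realif X).

(** The K-linear form with real part u, that is u(x) - i u(i x) over the complex
    numbers. *)
Definition scalar_form (u : V -> R) (x : X) : K^o :=
  of_real k (u x) + imunit R k * of_real k (u (- imunit R k *: x)).

Variable u : V -> R.
Hypothesis lu : linear_form u.

Lemma re_scalar_form x : re_scalar (scalar_form u x) = u x.
Proof. by rewrite /scalar_form reD re_imunit addr0 re_of_real. Qed.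

Let formD x y : scalar_form u (x + y) = scalar_form u x + scalar_form u y.
Proof.
rewrite /scalar_form scalerDr !(linear_formD lu) !of_realD mulrDr.
by rewrite addrACA.
Qed.

Let formZ r (x : X) : scalar_form u (of_real k r *: x) = of_real k r * scalar_form u x.
Proof.
rewrite /scalar_form scalerA [- imunit R k * _]mulrC -scalerA.
rewrite -!realif_scaleE !(linear_formZ lu) !of_realM mulrDr.
by congr (_ + _); rewrite mulrCA.
Qed.

Let formI (x : X) : scalar_form u (imunit R k *: x) = imunit R k * scalar_form u x.
Proof.
rewrite /scalar_form scalerA mulNr; case: (@imunit_sqr R k) => [->|ii].
  by rewrite !mul0r scale0r addr0 (linear_form0 lu) of_real0.
rewrite ii opprK scale1r mulrDr mulrA ii mulN1r addrC.
by rewrite scaleNr (linear_formN lu) of_realN opprK.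
Qed.

Lemma scalar_form_linear : linear (scalar_form u : X -> K^o).
Proof.
move=> c x y; rewrite formD; congr (_ + _).
rewrite {1}(re_imE c) scalerDl formD formZ -scalerA.
rewrite formI formZ mulrA -mulrDl -re_imE //.
Qed.

(** After a rotation of x the value of the form is real, hence a value of u. *)
Lemma norm_scalar_form (C : R) (x : X) : (forall y, u y <= C * `|y|) ->
  re_scalar `|scalar_form u x| <= C * rnorm x.
Proof.
move=> uC; have [c c1 cf] := phaseP (scalar_form u x).
have := uC (c *: x); rewrite -re_scalar_form.
have -> : scalar_form u (c *: x) = c * scalar_form u x.
  by have := scalar_form_linear c x 0; rewrite !addr0 => ->;
    rewrite /scalar_form !(scaler0, linear_form0)// of_real0 mulr0 !addr0.
by rewrite cf realif_normE /rnorm normrZ c1 mul1r.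
Qed.

End ScalarForm.

Section Slices.
Variables (R : realType) (k : scalar_kind) (G : groupType).
Variables (X : normedModType (scalars R k)) (a : isometric_action G X).
Local Notation K := (scalars R k).
Local Notation V := (realif X).
Hypothesis X_nontrivial : exists x : X, x != 0.
Hypothesis a_Daugavet : G_Daugavet a.
Hypothesis a_alpha : (alpha_G a < 2%:E)%E.

Lemma unit_vector (c : V) : exists2 e : V, `|e| = 1 & c = `|c| *: e.
Proof.
have [->|c0] := eqVneq c 0.
  have [x x0] := X_nontrivial; exists (`|x : V|^-1 *: (x : V)).
    by rewrite normrZ normfV normr_id mulVf// normr_eq0.
  by rewrite normr0 scale0r.
exists (`|c|^-1 *: c); last by rewrite scalerA divff ?scale1r// normr_eq0.
by rewrite normrZ normfV normr_id mulVf// normr_eq0.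
Qed.

Let act_norm g (x : V) : `|a g x : V| = `|x|.
Proof. by rewrite !realif_normE /rnorm act_isometry. Qed.

Let act_scale g r (x : V) : a g (r *: x : V) = r *: (a g x : V).
Proof. by rewrite !realif_scaleE linearZ. Qed.

Lemma displacement_bound : exists2 al : R, al < 2 &
  forall g (x : V), `|(a g x : V) - x| <= al * `|x|.
Proof.
have le_alpha g (e : V) : `|e| = 1 -> (`|(a g e : V) - e|%:E <= alpha_G a)%E.
  by move=> e1; apply: ereal_sup_ubound; exists (g, e).
have [e e1 _] := unit_vector 0.
have fin : (alpha_G a \is a fin_num)%E.
  rewrite fin_numElt (lt_trans a_alpha) ?ltry// andbT.
  by apply: lt_le_trans (le_alpha 1%g e e1); rewrite ltNyr.
exists (fine (alpha_G a)); first by rewrite -lte_fin fineK.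
move=> g x; have [f f1 xf] := unit_vector x.
have -> : (a g x : V) - x = `|x| *: ((a g f : V) - f).
  by rewrite scalerBr -act_scale -xf.
rewrite normrZ normr_id mulrC ler_wpM2r// -lee_fin fineK//; exact: le_alpha.
Qed.

(** The operator is x |-> - f(x) e, where f is the scalar form of v; it has norm 1,
    so some w almost attains |w - f(w) g e| = 2.  Multiplying w by a phase makes
    f(w) real and nonnegative, and replaces f(w) by v(w). *)
Let Daugavet_witness (v : V -> R) (e : V) (eta : R) :
  linear_form v -> (forall x, v x <= `|x|) ->
  (forall d, 0 < d -> exists2 w, `|w| <= 1 & 1 - d < v w) ->
  `|e| = 1 -> 0 < eta ->
  exists g, exists w : V,
    [/\ `|w| <= 1, 0 <= v w & 2 - eta < `|w - v w *: (a g e : V)|].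
Proof.
move=> lv v1 vsup e1 eta0.
pose f := scalar_form v; have lf : linear (f : X -> K^o) := scalar_form_linear lv.
have lT : linear (fun x : X => f x *: (- e : X)).
  by move=> c x y; rewrite lf scalerDl -scalerA.
pose T : {linear X -> X} := HB.pack (fun x : X => f x *: (- e : X))
  (GRing.isLinear.Build _ _ _ _ _ lT).
have TE x : T x = f x *: (- e : X) by [].
have e0 : (- e : X) != 0.
  by rewrite oppr_eq0; apply/eqP => e0; move: e1; rewrite e0 normr0; lra.
have rnormT x : rnorm (T x) = re_scalar `|f x|.
  have eX : `|e : X| = 1 by rewrite -of_rnorm -realif_normE e1 of_real1.
  by rewrite /rnorm TE normrZ normrN eX mulr1.
have [w0 w01 vw0] := vsup _ eta0.
have [w2 w21 vw2] := vsup 1 ltr01; rewrite subrr in vw2.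
have fw2 : f w2 != 0.
  apply/eqP => f0; have := re_scalar_form v w2.
  by rewrite -/f f0 re0 => h; rewrite -h ltxx in vw2.
have rk1 : rank_one T.
  exists (- e : X) => //; apply/seteqP; split=> [_ [x _ <-]|_ [c _ <-]].
    by exists (f x).
  exists ((c / f w2) *: (w2 : X)) => //; rewrite TE; congr (_ *: _).
  have := lf (c / f w2) w2 0; rewrite !addr0 => ->.
  rewrite (_ : f 0 = 0) ?addr0; first by rewrite /GRing.scale/= divfK.
  by rewrite /f /scalar_form scaler0 (linear_form0 lv) of_real0 mulr0 addr0.
have opT1 : (opnorm T <= 1%:E)%E.
  apply: ge_ereal_sup => _ [x /= x1 <-]; rewrite lee_fin rnormT.
  have v1' y : v y <= 1 * `|y| by rewrite mul1r.
  by apply: le_trans (norm_scalar_form lv _ v1') _; rewrite mul1r.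
have opTlt : ((1 - eta)%:E < opnorm T)%E.
  apply: (@lt_le_trans _ _ (rnorm (T w0))%:E); last first.
    by apply: ereal_sup_ubound; exists w0.
  rewrite lte_fin rnormT; apply: lt_le_trans vw0 _.
  rewrite -(re_scalar_form v w0); apply: le_trans (ler_norm _) _.
  exact: re_norm_le.
have := a_Daugavet rk1 (le_lt_trans opT1 (ltry _)) => supE.
have : ((2 - eta)%:E < ereal_sup [set opnorm (fun x : X => (x + a g (T x))%R) | g in [set: G]])%E.
  rewrite supE (_ : (2 - eta)%:E = (1%:E + (1 - eta)%:E)%E); last first.
    by rewrite -EFinD; congr (_%:E); lra.
  by rewrite lteD2lE.
move=> /ereal_sup_gt[_ [g _ <-]] /ereal_sup_gt[_ [w w1 <-]]; rewrite lte_fin => hw.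
exists g.
have [c c1 cf] := phaseP (f w).
have fcw : f (c *: w) = `|f w|.
  have := lf c w 0; rewrite !addr0 => ->.
  rewrite (_ : f 0 = 0) ?addr0//.
  by rewrite /f /scalar_form scaler0 (linear_form0 lv) of_real0 mulr0 addr0.
exists (c *: (w : X)); split.
- by rewrite realif_normE /rnorm normrZ c1 mul1r.
- by rewrite -(re_scalar_form v) -/f fcw; exact: le_trans (normr_ge0 _) (re_norm_le _).
have -> : (c *: (w : X) : V) - v (c *: (w : X)) *: (a g e : V) = c *: (w + a g (T w)).
  rewrite scalerDr; congr (_ + _).
  have agT : a g (T w) = - (f w *: a g e) by rewrite TE scalerN linearN linearZ.
  rewrite agT scalerN scalerA cf realif_scaleE.
  by rewrite -(re_scalar_form v) -/f fcw re_real.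
by rewrite realif_normE /rnorm normrZ c1 mul1r.
Qed.

(** With c = |c| e, the witness w is at distance about 2 from g e, hence at least
    about 1 + |c| from g c, and at least 1 + |c| - al |c| from c.  As |c| <= 1 this
    is at least min(1, 2 - al) = 2 delta, and half of it absorbs the errors.  A
    slice given by a form u is treated after dividing u by its norm phi; when u is
    0 the slice is the whole ball and any form of norm 1 serves. *)
Theorem Daugavet_large_slices : exists2 delta : R, 0 < delta & large_slices V delta.
Proof.
have [al al2 alP] := displacement_bound.
pose delta := Num.min 1 (2 - al) / 2.
have m0 : 0 < Num.min 1 (2 - al) by rewrite lt_min ltr01 subr_gt0.
have delta0 : 0 < delta by rewrite divr_gt0.
have far (v : V -> R) (c : V) eps : linear_form v -> (forall x, v x <= `|x|) ->
    (forall d, 0 < d -> exists2 w, `|w| <= 1 & 1 - d < v w) ->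
    `|c| <= 1 -> 0 < eps -> exists w : V, [/\ `|w| <= 1, 1 - eps < v w & delta <= `|w - c|].
  move=> lv v1 vsup c1 eps0.
  pose eta := Num.min eps (delta / 2).
  have eta0 : 0 < eta by rewrite lt_min eps0/= divr_gt0.
  have eta1 : eta <= eps by rewrite ge_min lexx.
  have eta2 : eta <= delta / 2 by rewrite ge_min lexx orbT.
  have [e e1 ce] := unit_vector c.
  have [g [w [w1 vw0 hw]]] := Daugavet_witness lv v1 vsup e1 eta0.
  have vw1 : 1 - eta < v w.
    have := ler_normB w (v w *: (a g e : V)).
    by rewrite normrZ act_norm e1 mulr1 ger0_norm//; lra.
  have vw2 : v w <= 1 by have := v1 w; lra.
  exists w; split=> //; first by lra.
  have nE s : `|(a g e : V) - s *: (a g e : V)| = `|1 - s|.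
    have <- : (1 - s) *: (a g e : V) = (a g e : V) - s *: (a g e : V).
      by rewrite scalerBl scale1r.
    by rewrite normrZ act_norm e1 mulr1.
  have h1 : 2 - 2 * eta < `|w - (a g e : V)|.
    have := ler_distD (a g e : V) w (v w *: (a g e : V)).
    by rewrite nE ger0_norm ?subr_ge0//; lra.
  have h2 : 1 + `|c| - 2 * eta < `|w - (a g c : V)|.
    have gce : (a g c : V) = `|c| *: (a g e : V) by rewrite -act_scale -ce.
    have dce : `|(a g c : V) - (a g e : V)| = 1 - `|c|.
      by rewrite distrC gce nE ger0_norm ?subr_ge0.
    by have := ler_distD (a g c : V) w (a g e : V); rewrite dce; lra.
  have h3 : `|w - (a g c : V)| <= `|w - c| + al * `|c|.
    have := ler_normB (w - c) ((a g c : V) - c).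
    by rewrite opprB addrA subrK; have := alP g c; lra.
  have h4 : 2 * delta <= 1 + `|c| - al * `|c|.
    have d1 : 2 * delta <= 1.
      by rewrite /delta mulrC divfK// ge_min lexx.
    have d2 : 2 * delta <= 2 - al.
      by rewrite /delta mulrC divfK// ge_min lexx orbT.
    have := normr_ge0 c; nra.
  lra.
exists delta => // u b [lu [C uC]] [w0 [w01 bw0]] c c1.
have [z uz] : exists z, u z != 0 \/ forall x, u x = 0.
  have [[z uz]|h] := pselect (exists z, u z != 0); first by exists z; left.
  by exists 0; right => x; apply/eqP; apply: contrapT => /negP ux; apply: h; exists x.
case: uz => [uz|u0]; last first.
  have b0 : b < 0 by rewrite -(u0 w0).
  have [e e1 _] := unit_vector 0.
  have [v [lv v1] ve] := norming_form e.
  have [|w [w1 _ wc]] := far v c 1 lv v1 _ c1 ltr01.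
    move=> d d0; exists e; first by rewrite e1.
    by move: ve; rewrite e1; lra.
  by exists w => //; split=> //; rewrite u0.
pose ball := [set u w | w in [set w : V | `|w| <= 1]].
pose phi := sup ball.
have hs : has_sup ball.
  split; first by exists (u w0), w0.
  exists `|C| => _ [w /= w1 <-]; apply: le_trans (uC w) _.
  by apply: le_trans (ler_norm _) _; rewrite normrM normr_id ler_piMr.
have uphi w : `|w| <= 1 -> u w <= phi by move=> w1; apply: ub_le_sup; [case: hs|exists w].
have bphi : b < phi by apply: lt_le_trans bw0 (uphi _ w01).
have uphiN w : u w <= phi * `|w|.
  have [e e1 we] := unit_vector w.
  by rewrite {1}we (linear_formZ lu) mulrC ler_wpM2r// uphi// e1.
have phi0 : 0 < phi.
  have := uphiN z; have := uphiN (- z); rewrite normrN (linear_formN lu).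
  have := normr_ge0 z => z0 h1 h2; rewrite ltNge; apply/negP => phi0.
  by move/eqP: uz; apply; nra.
have [||||w [w1 vw wc]] := far (fun x => u x / phi) c ((phi - b) / phi) _ _ _ c1.
- by move=> r x y; rewrite lu mulrDl mulrA.
- by move=> x; rewrite ler_pdivrMr// mulrC.
- move=> d d0; have /sup_adherent/(_ hs)[_ [w w1 <-] uw] : 0 < d * phi by rewrite mulr_gt0.
  exists w => //; rewrite ltr_pdivlMr//; move: uw; rewrite -/phi; lra.
- by rewrite divr_gt0// subr_gt0.
exists w => //; split=> //; move: vw.
by rewrite ltr_pdivlMr// mulrBl divfK ?gt_eqF//; lra.
Qed.

End Slices.

(** * Weak limits along an ultrafilter and non-reflexivity *)

Section GeneralizedLimit.
Variable R : realType.

Definition bounded_seq (s : nat -> R) : Prop := exists M, forall n, `|s n| <= M.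

(** An abstract form of the limit along a nonprincipal ultrafilter. *)
Definition generalized_limit (L : (nat -> R) -> R) : Prop :=
  (forall s t r, bounded_seq s -> bounded_seq t ->
     L (fun n => r * s n + t n) = r * L s + L t) /\
  (forall s p N, bounded_seq s -> (forall n, (N <= n)%N -> p <= s n) -> p <= L s).

Lemma bounded_seq_cst (p : R) : bounded_seq (fun _ => p).
Proof. by exists `|p| => n. Qed.

Lemma bounded_seq_comb (s t : nat -> R) r : bounded_seq s -> bounded_seq t ->
  bounded_seq (fun n => r * s n + t n).
Proof.
move=> [M sM] [M' tM']; exists (`|r| * M + M') => n.
apply: le_trans (ler_normD _ _) _; rewrite normrM.
by apply: lerD => //; rewrite ler_wpM2l.
Qed.

Lemma generalized_limit0 L : generalized_limit L -> L (fun _ => 0) = 0.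
Proof.
move=> [Llin _]; have b0 := bounded_seq_cst 0.
have := Llin _ _ 1 b0 b0.
have -> : (fun _ : nat => 1 * 0 + 0) = (fun _ => 0) :> (nat -> R).
  by apply/funext => n; rewrite mulr0 addr0.
lra.
Qed.

Lemma generalized_limit_le L s p : generalized_limit L -> bounded_seq s ->
  (forall n, s n <= p) -> L s <= p.
Proof.
move=> gL bs sp; have [Llin Lge] := gL; have b0 := bounded_seq_cst 0.
have LN : L (fun n => (-1) * s n + 0) = - L s.
  by rewrite Llin// generalized_limit0//; lra.
rewrite -lerN2 -LN; apply: (Lge _ _ 0%N); first exact: bounded_seq_comb.
by move=> n _; have := sp n; lra.
Qed.

Lemma ex_generalized_limit : exists L, generalized_limit L.
Proof.
have [U [UU ooU]] := @ultraFilterLemma nat \oo _.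
have Uimage (s : nat -> R) : UltraFilter (s @ U).
  split; first exact: fmap_proper_filter.
  move=> G FG UG; apply/seteqP; split=> // A GA.
  have [//|nA] := in_ultra_setVsetC (s @^-1` A) UU.
  have /UG GnA : (s @ U) (~` A) by [].
  have : G (A `&` ~` A) by apply: filterI.
  by rewrite setICr => /filter_not_empty.
have Ucvg (s : nat -> R) : bounded_seq s -> s @ U --> lim (s @ U).
  move=> [M sM].
  have : compact `[- M, M]%classic := @segment_compact R (- M) M.
  rewrite compact_ultra => /(_ (s @ U) (Uimage s))[|p [_ sp]].
    by apply: (@filterE _ U) => n /=; rewrite in_itv/= -ler_norml; exact: sM.
  exact: (cvgP p).
exists (fun s => lim (s @ U)); split.
- move=> s t r /Ucvg hs /Ucvg ht; apply/cvg_lim => //.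
  by apply: cvgD => //; apply: cvgM => //; apply: cvg_cst.
- move=> s p N /Ucvg hs h; apply: (limr_ge (cvgP _ hs)).
  by apply: ooU; exists N.
Qed.

End GeneralizedLimit.

Section Reflexive.
Variables (R : realType) (k : scalar_kind) (X : normedModType (scalars R k)).
Local Notation K := (scalars R k).
Local Notation V := (realif X).

Lemma dual_functional_bound (f : X -> K^o) x : dual_functional f -> rnorm x <= 1 ->
  re_scalar `|f x| <= fine (opnorm f) /\ (opnorm f \is a fin_num)%E.
Proof.
move=> [_ fb] x1.
have h : ((rnorm (f x))%:E <= opnorm f)%E by apply: ereal_sup_ubound; exists x.
have fin : (opnorm f \is a fin_num)%E.
  by rewrite fin_numElt fb andbT; apply: lt_le_trans h; rewrite ltNyr.
by split=> //; rewrite -lee_fin fineK.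
Qed.

(** The map f |-> L (f (x n)) is bounded and linear on the dual, so it is the
    evaluation at a point. *)
Lemma reflexive_generalized_limit (L : (nat -> R) -> R) (x : nat -> X) :
  generalized_limit L -> reflexive_space X -> (forall n, rnorm (x n) <= 1) ->
  exists z : V, forall u, bounded_form u -> u z = L (fun n => u (x n)).
Proof.
move=> gL refl x1; have [Llin Lge] := gL.
have Lbound s M : (forall n, `|s n| <= M) -> `|L s| <= M.
  move=> sM; have bs : bounded_seq s by exists M.
  have sM' n : - M <= s n <= M by rewrite -ler_norml.
  rewrite ler_norml (generalized_limit_le gL)// ?andbT.
    by apply: (Lge s _ 0%N) => // n _; have /andP[] := sM' n.
  by move=> n; have /andP[] := sM' n.
have bre f : dual_functional f ->
    forall n, `|re_scalar (f (x n) : K)| <= fine (opnorm f).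
  move=> df n; apply: le_trans (re_norm_le _) _.
  by have [] := dual_functional_bound df (x1 n).
have bim f : dual_functional f ->
    forall n, `|im_scalar (f (x n) : K)| <= fine (opnorm f).
  move=> df n; apply: le_trans (im_norm_le _) _.
  by have [] := dual_functional_bound df (x1 n).
pose phi (f : X -> K^o) : K^o := of_parts k (L (fun n => re_scalar (f (x n) : K)))
  (L (fun n => im_scalar (f (x n) : K))).
have [|z zP] := refl phi.
  split.
    move=> c f g df dg.
    have [bf bg] := (bre f df, bre g dg); have [bf' bg'] := (bim f df, bim g dg).
    have bsf : bounded_seq (fun n => re_scalar (f (x n) : K)) by eexists; exact: bf.
    have bsg : bounded_seq (fun n => re_scalar (g (x n) : K)) by eexists; exact: bg.
    have bsf' : bounded_seq (fun n => im_scalar (f (x n) : K)) by eexists; exact: bf'.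
    have bsg' : bounded_seq (fun n => im_scalar (g (x n) : K)) by eexists; exact: bg'.
    rewrite /phi [c *: of_parts _ _ _]of_partsM of_partsD; congr of_parts.
      rewrite (_ : (fun n => _) = fun n => re_scalar c * re_scalar (f (x n) : K) +
        (- im_scalar c * im_scalar (f (x n) : K) + re_scalar (g (x n) : K))); last first.
        by apply/funext => n; rewrite reD re_scalarM; ring.
      by rewrite !Llin//; [ring|exact: bounded_seq_comb].
    rewrite (_ : (fun n => _) = fun n => re_scalar c * im_scalar (f (x n) : K) +
      (im_scalar c * re_scalar (f (x n) : K) + im_scalar (g (x n) : K))); last first.
      by apply/funext => n; rewrite im_scalarD im_scalarM; ring.
    by rewrite !Llin//; [ring|exact: bounded_seq_comb].
  exists 2 => f df.
  have [_ fin] := dual_functional_bound df (x1 0%N).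
  rewrite -(fineK fin) -EFinM lee_fin.
  apply: le_trans (re_norm_of_parts _ _ _) _.
  by have := Lbound _ _ (bre f df); have := Lbound _ _ (bim f df); lra.
exists z => u [lu [C uC]].
have df : dual_functional (scalar_form u : X -> K^o).
  split; first exact: scalar_form_linear.
  apply: (@le_lt_trans _ _ `|C|%:E); last exact: ltry.
  apply: ge_ereal_sup => _ [y /= y1 <-]; rewrite lee_fin.
  apply: le_trans (norm_scalar_form lu y uC) _.
  apply: le_trans (ler_norm _) _; rewrite normrM ler_piMr//.
  by rewrite ger0_norm// -realif_normE.
rewrite -(re_scalar_form u z) -(zP _ df) /phi /of_parts reD re_imunit addr0 re_of_real.
by congr L; apply/funext => n; rewrite re_scalar_form.
Qed.

(** The weak limits of the branches lie in the closure of the averages of tree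
    points: otherwise a form would be larger by c on all tree points than at the
    limit of a branch, hence larger by c than itself at that limit.  These
    averages are countably many, against [cantor_scheme]. *)
Theorem large_slices_not_reflexive (delta : R) :
  0 < delta -> large_slices V delta -> ~ reflexive_space X.
Proof.
move=> d0 ls refl.
have [|||x [c [c0 x1 near]]] := @cantor_scheme R V delta 1 (@bounded_form R V) d0 ltr01 ls.
- by [].
- by move=> u l r; exact: bounded_form_comb.
- move=> y; have [u [lu u1] uy] := norming_form y.
  exists u; split=> //; last by rewrite mul1r.
  by split=> //; exists 1 => z; rewrite mul1r.
have [L gL] := ex_generalized_limit R; have [_ Lge] := gL.
have /choice[z zP] : forall sigma : nat -> bool, exists z : V, forall u, bounded_form u ->
    u z = L (fun n => u (x (branch sigma n))).
  move=> sigma; apply: (reflexive_generalized_limit gL refl) => n.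
  exact: x1.
have bu u (sigma : nat -> bool) : bounded_form u -> bounded_seq (fun n => u (x (branch sigma n))).
  move=> [lu [C uC]]; exists `|C| => n.
  have h y : `|y| <= 1 -> u y <= `|C|.
    move=> y1; apply: le_trans (uC y) _; apply: le_trans (ler_norm _) _.
    by rewrite normrM normr_id ler_piMr.
  rewrite ler_norml h// andbT lerNl -(linear_formN lu) h// normrN//.
pose D (l : seq (seq bool)) := average [seq x s | s <- l].
apply: (near z _ _ D).
  move=> sigma u r Hu [N h]; rewrite zP//; apply: (Lge _ _ N) => //; exact: bu.
move=> sigma; apply: contrapT => far.
have [||u [lu u1] uP] := @separation R V (range x) (z sigma) c.
- exact: ltW.
- move=> s _ sx.
  have [l ->] : exists l, s = [seq x t | t <- l].
    elim: s sx => [_|y s ih sx]; first by exists [::].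
    have [|l ->] := ih; first by move=> t ts; apply: sx; rewrite inE ts orbT.
    by have [t _ <-] := sx y (mem_head _ _); exists (t :: l).
  by rewrite leNgt distrC; apply/negP => h; apply: far; exists l.
have bfu : bounded_form u by split=> //; exists 1 => y; rewrite mul1r.
have : u (z sigma) + c <= u (z sigma).
  rewrite {2}(zP sigma u bfu); apply: (Lge _ _ 0%N); first exact: bu.
  by move=> n _; apply: uP.
by rewrite gerDl leNgt c0.
Qed.

End Reflexive.

(** * Bounded sums of unconditionally convergent series *)

Section UnconditionalSums.
Variables (R : realType) (V : normedModType R).

Section rearrangement.
Variables (next : nat -> nat) (P : nat -> pred nat).
Hypothesis next_gt : forall n, (n < next n)%N.

Let start j := iter j next 0%N.
Let block j := [seq i <- index_iota (start j) (start j.+1) | P (start j) i] ++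
  [seq i <- index_iota (start j) (start j.+1) | ~~ P (start j) i].
Let L := fix L j := if j is i.+1 then L i ++ block i else [::].
(* L j lists the first j blocks, each with its selected indices first; it is a
   prefix of L j' for j <= j', so p does not depend on the length read off. *)
Let p n := nth 0%N (L n.+1) n.

Let start_ge j : (j <= start j)%N.
Proof. by elim: j => // j ih; exact: leq_ltn_trans ih (next_gt _). Qed.

Let L_perm j : perm_eq (L j) (iota 0 (start j)).
Proof.
elim: j => // j ih /=.
have -> : iota 0 (start j.+1) = iota 0 (start j) ++ index_iota (start j) (start j.+1).
  by rewrite /index_iota -iotaD subnKC// ltnW// /start/= next_gt.
by apply: perm_cat => //; rewrite perm_filterC.
Qed.

Let L_size j : size (L j) = start j.
Proof. by rewrite (perm_size (L_perm j)) size_iota. Qed.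

Let L_uniq j : uniq (L j).
Proof. by rewrite (perm_uniq (L_perm j)) iota_uniq. Qed.

Let L_cat j J : (j <= J)%N -> exists s, L J = L j ++ s.
Proof.
move=> /subnK <-; elim: (J - j)%N => [|d [s e]]; first by exists [::]; rewrite cats0.
by exists (s ++ block (d + j)); rewrite addSn /= e catA.
Qed.

Let nth_L j n : (n < start j)%N -> nth 0%N (L j) n = p n.
Proof.
move=> nj; rewrite /p; have [h|h] := leqP j n.+1.
  by have [s ->] := L_cat h; rewrite nth_cat L_size nj.
by have [s ->] := L_cat (ltnW h); rewrite nth_cat L_size start_ge.
Qed.

Lemma block_rearrangement_bij : bijective p.
Proof.
have memL m : m \in L m.+1 by rewrite (perm_mem (L_perm _)) mem_iota /= start_ge.
exists (fun m => index m (L m.+1)).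
- move=> n; set m := p n.
  have nL : (n < size (L n.+1))%N by rewrite L_size start_ge.
  have pn : index m (L n.+1) = n by rewrite /m /p index_uniq.
  have [h|h] := leqP m.+1 n.+1.
    by have [s e] := L_cat h; move: pn; rewrite e index_cat memL.
  have [s ->] := L_cat (ltnW h).
  by rewrite index_cat -index_mem pn nL.
- move=> m; have : (index m (L m.+1) < start m.+1)%N by rewrite -L_size index_mem.
  by move=> /nth_L <-; rewrite nth_index.
Qed.

Lemma block_rearrangement_sum (f : nat -> V) j : exists2 s,
  (start j <= s)%N & series (f \o p) s - series (f \o p) (start j) =
    \sum_(start j <= i < start j.+1 | P (start j) i) f i.
Proof.
pose F := [seq i <- index_iota (start j) (start j.+1) | P (start j) i].
have le_s : (start j + size F <= start j.+1)%N.
  rewrite size_filter -[leqRHS](subnKC (ltnW (next_gt (start j)))) leq_add2l.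
  by apply: leq_trans (count_size _ _) _; rewrite size_iota.
exists (start j + size F)%N; first exact: leq_addr.
rewrite sub_series_geq ?leq_addr// -[RHS]big_filter -/F.
rewrite [RHS](big_nth 0%N).
have -> : \sum_(start j <= n < start j + size F) (f \o p) n =
    \sum_(0 <= n < size F) (f \o p) (n + start j)%N.
  by rewrite -{1}[start j]add0n big_addn addKn.
apply: eq_big_nat => i /andP[_ iF] /=; congr f.
rewrite -(@nth_L j.+1); last first.
  by apply: leq_trans le_s; rewrite addnC ltn_add2l.
by rewrite /= nth_cat L_size ltnNge leq_addl/= addnK nth_cat iF.
Qed.

End rearrangement.

(** If the selected sums were unbounded, then beyond each n some selected sum over
    a block starting at n would have norm at least 1.  The rearrangement that puts
    the selected indices of each block first has these sums as differences of its
    partial sums, so it does not converge. *)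
Lemma unconditional_bounded_sums (f : nat -> V) :
  (forall p : nat -> nat, bijective p -> cvgn (series (f \o p))) ->
  exists M : R, forall (P : pred nat) N, `|\sum_(0 <= i < N | P i) f i| <= M.
Proof.
move=> fcvg; apply: contrapT => unb.
have step n : exists q : nat * pred nat,
    (n < q.1)%N /\ 1 <= `|\sum_(n <= i < q.1 | q.2 i) f i|.
  apply: contrapT => h; apply: unb.
  exists (\sum_(0 <= i < n) `|f i| + 1) => P N.
  have [Nn|nN] := leqP N n.
    apply: le_trans (ler_norm_sum _ _ _) _.
    rewrite (big_cat_nat _ (n := N) (p := n))//= -addrA big_mkcond/=.
    apply: ler_wpDr; first by rewrite addr_ge0// sumr_ge0.
    by apply: ler_sum => i _; case: (P i).
  rewrite (big_cat_nat _ (n := n) (p := N))//= ?(ltnW nN)//.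
  apply: le_trans (ler_normD _ _) _; apply: lerD.
    apply: le_trans (ler_norm_sum _ _ _) _; rewrite big_mkcond/=.
    by apply: ler_sum => i _; case: (P i).
  by rewrite leNgt; apply/negP => h1; apply: h; exists (N, P); split=> //; exact: ltW.
have /choice[q qP] := step.
pose next n := (q n).1; pose P n := (q n).2.
have next_gt n : (n < next n)%N by have [] := qP n.
have /fcvg/cvg_ex[l /cvgrPdist_lt/(_ 2^-1)] := block_rearrangement_bij P next_gt.
rewrite invr_gt0 => /(_ ltac:(by [])) [N _ h].
have [s js e] := block_rearrangement_sum P next_gt f N.
have startN : (N <= iter N next 0)%N.
  by elim: (N) => // j ih; exact: leq_ltn_trans ih (next_gt _).
have [_] := qP (iter N next 0%N); apply/negP; rewrite -ltNge.
rewrite [X in `|X|](_ : _ = \sum_(iter N next 0%N <= i < iter N.+1 next 0%N |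
  P (iter N next 0%N) i) f i)// -e.
have h1 := h _ startN; have h2 := h s (leq_trans startN js).
rewrite -(subrKA l); apply: le_lt_trans (ler_normD _ _) _.
by rewrite distrC; move: h1 h2; rewrite /=; lra.
Qed.

End UnconditionalSums.

(** * Boundedness of the sections of a basis *)

Lemma sum_nat_cond_recr (V : nmodType) (P : pred nat) N (F : nat -> V) :
  \sum_(0 <= i < N.+1 | P i) F i =
    \sum_(0 <= i < N | P i) F i + (if P N then F N else 0).
Proof. by rewrite !(big_mkcond P) big_nat_recr. Qed.

Lemma halving_small (R : realType) (B eps : R) : 0 < eps ->
  exists N, forall n, (N <= n)%N -> B * 2^-1 ^+ n <= eps.
Proof.
move=> eps0; exists (Num.truncn (`|B| / eps)).+1 => n nN.
rewrite exprVn ler_pdivrMr ?exprn_gt0//.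
have h1 : `|B| / eps < n%:R.
  by apply: lt_le_trans (truncnS_gt _) _; rewrite ler_nat.
rewrite ltr_pdivrMr// in h1.
have h2 : n%:R <= 2 ^+ n :> R by rewrite -natrX ler_nat ltnW// ltn_expl.
have h3 : n%:R * eps <= 2 ^+ n * eps by rewrite ler_wpM2r// ltW.
have := ler_norm B; lra.
Qed.

Section Completeness.
Variable R : realType.

Lemma cauchy_seq_cvg (V : completeNormedModType R) (s : nat -> V) :
  (forall eps, 0 < eps -> exists N, forall n, (N <= n)%N -> `|s n - s N| <= eps) ->
  exists l : V, s @ \oo --> l.
Proof.
move=> h; apply/cvg_ex; apply: cauchy_cvg; apply: cauchy_exP => eps eps0.
have [|N hN] := h (eps / 2); first by rewrite divr_gt0.
exists (s N), N => // n /= Nn; rewrite -ball_normE /ball_/= distrC.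
by apply: le_lt_trans (hN _ Nn) _; lra.
Qed.

Lemma scalars_complete (k : scalar_kind) (c : nat -> scalars R k) :
  (forall eps, 0 < eps -> exists N, forall n, (N <= n)%N ->
     re_scalar `|c n - c N| <= eps) ->
  exists l, forall eps, 0 < eps -> exists N, forall n, (N <= n)%N ->
     re_scalar `|c n - l| <= eps.
Proof.
move=> h.
have [p pP] : exists p : R, (fun n => re_scalar (c n)) @ \oo --> p.
  apply: (@cauchy_seq_cvg R^o) => eps /h[N hN]; exists N => n /hN.
  by apply: le_trans; rewrite -reB re_norm_le.
have [q qP] : exists q : R, (fun n => im_scalar (c n)) @ \oo --> q.
  apply: (@cauchy_seq_cvg R^o) => eps /h[N hN]; exists N => n /hN.
  apply: le_trans; apply: le_trans (im_norm_le _).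
  by rewrite /im_scalar mulrBr reB.
exists (of_parts k p q) => eps eps0.
have e2 : 0 < eps / 2 by rewrite divr_gt0.
have /cvgrPdist_le/(_ _ e2)[N1 _ h1] := pP.
have /cvgrPdist_le/(_ _ e2)[N2 _ h2] := qP.
exists (maxn N1 N2) => n; rewrite geq_max => /andP[n1 n2].
have := h1 _ n1; have := h2 _ n2 => /=.
rewrite {3}(re_imE (c n)) -/(of_parts k _ _).
have -> : of_parts k (re_scalar (c n)) (im_scalar (c n)) - of_parts k p q =
    of_parts k (re_scalar (c n) - p) (im_scalar (c n) - q).
  by rewrite /of_parts !of_realD !of_realN mulrDr mulrN opprD addrACA.
move=> h3 h4; apply: le_trans (re_norm_of_parts _ _ _) _.
by rewrite distrC [X in _ + X]distrC; lra.
Qed.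

End Completeness.

Section Basis.
Variables (R : realType) (k : scalar_kind) (X : completeNormedModType (scalars R k)).
Local Notation K := (scalars R k).
Local Notation V := (realif X).
Implicit Types (x y z : V) (P : pred nat) (N : nat).

Variables (e : nat -> X) (coef : X -> nat -> K).
Hypothesis coef_cvg : forall x : X, series (fun n => coef x n *: e n) @ \oo --> x.
Hypothesis coef_unique : forall (x : X) (a : nat -> K),
  series (fun n => a n *: e n) @ \oo --> x -> a = coef x.

Lemma expansionP (x : V) (a : nat -> K) : series (fun n => a n *: e n) @ \oo --> (x : X) <->
  forall eps, 0 < eps -> exists N, forall n, (N <= n)%N ->
    `|x - \sum_(0 <= i < n) (a i *: e i : X)| <= eps.
Proof.
split=> [/cvg_realif/cvgrPdist_le h eps /h[N _ hN]|h].
  by exists N => n /hN.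
apply/cvg_realif/cvgrPdist_le => eps /h[N hN].
by exists N => // n /= /hN.
Qed.

Lemma basis_coefD (x y : X) n : coef (x + y) n = coef x n + coef y n.
Proof.
rewrite -(coef_unique (a := fun n => coef x n + coef y n))//.
have -> : series (fun n => (coef x n + coef y n) *: e n) =
    (fun m => series (fun n => coef x n *: e n) m + series (fun n => coef y n *: e n) m).
  by apply/funext => m; rewrite /series/= -big_split; apply: eq_bigr => i _; rewrite scalerDl.
exact: cvgD.
Qed.

Lemma basis_coefZ (c : K) (x : X) n : coef (c *: x) n = c * coef x n.
Proof.
rewrite -(coef_unique (a := fun n => c * coef x n))//.
have -> : series (fun n => (c * coef x n) *: e n) =
    (fun m => c *: series (fun n => coef x n *: e n) m).
  by apply/funext => m; rewrite /series/= scaler_sumr; apply: eq_bigr => i _; rewrite scalerA.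
exact: cvgZr.
Qed.

Lemma basis_coef0 n : coef 0 n = 0.
Proof. by rewrite -(scale0r (0 : X)) basis_coefZ mul0r. Qed.

Lemma basis_coefN (x : X) n : coef (- x) n = - coef x n.
Proof. by rewrite -scaleN1r basis_coefZ mulN1r. Qed.

Lemma basis_coefB (x y : X) n : coef (x - y) n = coef x n - coef y n.
Proof. by rewrite basis_coefD basis_coefN. Qed.

Lemma coef_partial_sum (a : nat -> K) P N n :
  coef (\sum_(0 <= i < N | P i) a i *: e i) n = if (n < N)%N && P n then a n else 0.
Proof.
rewrite -(coef_unique (a := fun n => if (n < N)%N && P n then a n else 0))//.
apply: cvg_near_cst; exists N => // m /= Nm.
rewrite /series/= (big_cat_nat _ (n := N))//= [X in _ + X]big1_seq ?addr0.
  rewrite [RHS]big_mkcond/=; apply: eq_big_nat => i /andP[_ iN].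
  by rewrite iN /=; case: (P i); rewrite ?scale0r.
by move=> i /andP[_]; rewrite mem_index_iota => /andP[Ni _]; rewrite ltnNge Ni scale0r.
Qed.

Lemma coef_basis n i : coef (e n) i = (i == n)%:R.
Proof.
have := coef_partial_sum (fun _ => 1) (pred1 n) n.+1 i.
rewrite -big_filter (_ : [seq j <- index_iota 0 n.+1 | pred1 n j] = [:: n]).
  rewrite big_seq1 scale1r => ->; rewrite /= -[in RHS](andb_idl (_ : i == n -> i < n.+1))%N.
    by case: (_ && _).
  by move=> /eqP ->.
rewrite /index_iota subn0 -[n.+1]addn1 iotaD filter_cat/= add0n eqxx.
rewrite (eq_in_filter (a2 := pred0)) ?filter_pred0// => j.
by rewrite mem_iota /= => /ltn_eqF.
Qed.

Lemma basis_norm_gt0 n : 0 < `|e n : V|.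
Proof.
rewrite normr_gt0; apply/eqP => en; have := coef_basis n n.
by rewrite eqxx [e n]en basis_coef0 => /eqP; rewrite eq_sym oner_eq0.
Qed.

Definition basis_section P N (x : X) : X := \sum_(0 <= i < N | P i) coef x i *: e i.

Lemma sectionD P N (x y : X) :
  basis_section P N (x + y) = basis_section P N x + basis_section P N y.
Proof.
by rewrite /basis_section -big_split; apply: eq_bigr => i _; rewrite basis_coefD scalerDl.
Qed.

Lemma sectionZ P N (c : K) (x : X) :
  basis_section P N (c *: x) = c *: basis_section P N x.
Proof.
by rewrite /basis_section scaler_sumr; apply: eq_bigr => i _; rewrite basis_coefZ scalerA.
Qed.

Lemma sectionN P N (x : X) : basis_section P N (- x) = - basis_section P N x.
Proof. by rewrite -scaleN1r sectionZ scaleN1r. Qed.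

Lemma sectionB P N (x y : X) :
  basis_section P N (x - y) = basis_section P N x - basis_section P N y.
Proof. by rewrite sectionD sectionN. Qed.

Lemma section1 n (x : X) : basis_section (pred1 n) n.+1 x = coef x n *: e n.
Proof.
rewrite /basis_section -big_filter (_ : [seq j <- index_iota 0 n.+1 | pred1 n j] = [:: n]).
  by rewrite big_seq1.
rewrite /index_iota subn0 -[n.+1]addn1 iotaD filter_cat/= add0n eqxx.
rewrite (eq_in_filter (a2 := pred0)) ?filter_pred0// => j.
by rewrite mem_iota /= => /ltn_eqF.
Qed.

Lemma coef_section P N (x : X) n :
  coef (basis_section P N x) n = if (n < N)%N && P n then coef x n else 0.
Proof. exact: coef_partial_sum. Qed.

Hypothesis pointwise_bounded_sections : forall x,
  exists M, forall P N, `|basis_section P N x : V| <= M.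

(** By Baire's theorem the closure of F m contains a ball for some m.  Subtracting
    two approximations, every small vector is approximated by elements of bounded
    sections, and scaling gives all vectors.  The sections are not known to be
    continuous, so F m need not be closed and the uniform boundedness principle
    does not apply directly. *)
Let almost_open : exists C, forall y, exists g : V,
  (forall P N, `|basis_section P N g : V| <= C * `|y|) /\ `|y - g| <= `|y| / 2.
Proof.
pose F m := [set x : V | forall P N, `|basis_section P N x : V| <= m%:R].
have [m [x0 [r [r0 mP]]]] : exists m (x0 : V) r, 0 < r /\ ball x0 r `<=` closure (F m).
  apply: contrapT => h.
  have dns : dense (\bigcap_m (~` closure (F m))).
    apply: Baire => m; split; first by apply: closed_openC; exact: closed_closure.
    move=> O [x0 Ox0] oO; apply: contrapT => ne; apply: h.
    have /nbhs_ballP[r /= r0 rO] : nbhs x0 O by apply: open_nbhs_nbhs.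
    exists m, x0, r; split=> // y /rO Oy; apply: contrapT => ny.
    by apply: ne; exists y.
  have [||x [_ xP]] := dns setT; [by exists 0|exact: openT|].
  have [M MP] := pointwise_bounded_sections x.
  apply: (xP (Num.truncn M).+1 I); apply: subset_closure => P N.
  by apply: le_trans (MP P N) _; apply/ltW/truncnS_gt.
have near y eps : `|y| < r -> 0 < eps -> exists g : V,
    (forall P N, `|basis_section P N g : V| <= 2 * m%:R) /\ `|y - g| < eps.
  move=> yr eps0; have e2 : 0 < eps / 2 by rewrite divr_gt0.
  have app z : `|z - x0| < r -> exists2 f : V, F m f & `|z - f| < eps / 2.
    move=> zr; have /mP : ball x0 r z by rewrite -ball_normE /ball_/= distrC.
    move=> /(_ (ball z (eps / 2)) (nbhsx_ballx _ _ e2))[f [Ff]].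
    by rewrite -ball_normE /ball_/= => zf; exists f.
  have [|f Ff zf] := app (x0 + y); first by rewrite addrAC subrr add0r.
  have [|f' Ff' zf'] := app x0; first by rewrite subrr normr0.
  exists (f - f'); split.
    move=> P N; rewrite sectionB; apply: le_trans (ler_normB _ _) _.
    by have := Ff P N; have := Ff' P N; rewrite mulr_natl mulr2n; lra.
  have -> : y - (f - f') = (x0 + y - f) - (x0 - f').
    by rewrite !opprB [RHS]addrC -[x0 + y - f]addrA [RHS]addrA subrK addrCA.
  by apply: le_lt_trans (ler_normB _ _) _; lra.
exists (4 * m%:R / r) => y; have [->|y0] := eqVneq y 0.
  exists 0; split; last by rewrite subr0 normr0 mul0r.
  by move=> P N; rewrite /basis_section big1 ?normr0 ?mulr0// => i _; rewrite basis_coef0 scale0r.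
have y0' : 0 < `|y| by rewrite normr_gt0.
pose t := r / 2 / `|y|; have t0 : 0 < t by rewrite !divr_gt0.
have [||g [gP yg]] := near (t *: y) (r / 4).
- by rewrite normrZ gtr0_norm// divfK ?gt_eqF//; lra.
- by rewrite divr_gt0.
exists (t^-1 *: g); split.
  move=> P N; rewrite realif_scaleE sectionZ -realif_scaleE normrZ gtr0_norm ?invr_gt0//.
  have -> : 4 * m%:R / r * `|y| = t^-1 * (2 * m%:R).
    by rewrite /t !invfM !invrK; field; rewrite gt_eqF.
  by rewrite ler_pM2l ?invr_gt0.
have -> : y - t^-1 *: g = t^-1 *: (t *: y - g).
  by rewrite scalerBr scalerA mulVf ?gt_eqF// scale1r.
rewrite normrZ gtr0_norm ?invr_gt0// ler_pdivrMl//.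
have -> : t * (`|y| / 2) = r / 4 by rewrite /t; field; rewrite gt_eqF.
exact: ltW.
Qed.

(** Iterating [almost_open] writes y as a sum of terms g (r n) whose sections are
    bounded by C 2^-n |y|.  The coefficients of the partial sums s n converge, and
    the series with the limit coefficients c is a uniform limit of the expansions
    of s n, so it converges to y.  By uniqueness c = coef y, and the sections of y
    inherit the bound.  This is the open mapping argument for the norm given by
    the supremum of the sections. *)
Lemma section_bound : exists2 C, 1 <= C & forall P N x, `|basis_section P N x : V| <= C * `|x|.
Proof.
have [C CP] := almost_open.
have /choice[g gP] := CP.
have C0 y : 0 <= C * `|y| by apply: le_trans (normr_ge0 _) ((gP y).1 xpredT 0%N).
exists (Num.max 1 (2 * C)); first by rewrite le_max lexx.
move=> P0 N0 y; suff : `|basis_section P0 N0 y : V| <= 2 * C * `|y|.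
  move=> /le_trans; apply; rewrite ler_wpM2r//.
  by rewrite le_max lexx orbT.
pose r := fix r n := if n is m.+1 then r m - g (r m) else y.
pose s n := y - r n.
have rS n : r n.+1 = r n - g (r n) by [].
have r_le n : `|r n| <= 2^-1 ^+ n * `|y|.
  elim: n => [|n ih]; first by rewrite expr0 mul1r.
  have [_] := gP (r n); rewrite -rS exprS; lra.
have sS n : s n.+1 = s n + g (r n).
  by rewrite /s rS opprB addrA addrAC.
pose d n := 2 * (C * `|y|) * 2^-1 ^+ n.
have dge n : 0 <= d n by rewrite /d mulr_ge0// mulr_ge0// C0.
have step P N n : `|basis_section P N (s n.+1) - basis_section P N (s n) : V| <= d n - d n.+1.
  rewrite sS sectionD addrAC subrr add0r.
  have [/(_ P N) h _] := gP (r n); apply: le_trans h _.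
  have Cr : C * `|r n| <= C * (2^-1 ^+ n * `|y|).
    have [yz|y0] := eqVneq `|y| 0.
      have -> : `|r n| = 0.
        by apply/eqP; rewrite eq_le normr_ge0 andbT -(mulr0 (2^-1 ^+ n)) -yz r_le.
      by rewrite yz !mulr0.
    have C0' : 0 <= C.
      by rewrite -(pmulr_lge0 _ (_ : 0 < `|y|)) ?C0// lt_def y0 normr_ge0.
    by rewrite ler_wpM2l// r_le.
  apply: le_trans Cr _; rewrite /d exprS; lra.
have sec_cauchy P N n m : (n <= m)%N ->
    `|basis_section P N (s m) - basis_section P N (s n) : V| <= d n - d m.
  move=> /subnK <-; elim: (m - n)%N => [|j ih]; first by rewrite subrr normr0 subrr.
  rewrite addSn -(subrKA (basis_section P N (s (j + n)%N) : V)).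
  apply: le_trans (ler_normD _ _) _; have := step P N (j + n)%N; lra.
have d_small eps : 0 < eps -> exists n, d n <= eps /\ 2^-1 ^+ n * `|y| <= eps.
  move=> eps0; have [N1 h1] := halving_small (2 * (C * `|y|)) eps0.
  have [N2 h2] := halving_small `|y| eps0.
  exists (maxn N1 N2); rewrite [X in _ /\ X <= _]mulrC; split.
    by apply: h1; exact: leq_maxl.
  by apply: h2; exact: leq_maxr.
have coef_lim i : exists l, forall eps, 0 < eps -> exists N, forall n, (N <= n)%N ->
    re_scalar `|coef (s n) i - l| <= eps.
  apply: scalars_complete => eps eps0; have ei := basis_norm_gt0 i.
  have [|n [dn _]] := d_small (eps * `|e i : V|); first by rewrite mulr_gt0.
  exists n => m nm; rewrite -(ler_pM2r ei) -realif_normZ scalerBl -!section1.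
  by apply: le_trans (sec_cauchy _ _ _ _ nm) _; have := dge m; lra.
have /choice[c cP] := coef_lim.
have sum_lim N eps : 0 < eps -> exists M, forall n, (M <= n)%N -> forall P,
    `|(\sum_(0 <= i < N | P i) c i *: e i : X) - basis_section P N (s n) : V| <= eps.
  elim: N eps => [|N ih] eps eps0.
    by exists 0%N => n _ P; rewrite /basis_section !big_geq// subrr normr0 ltW.
  have e2 : 0 < eps / 2 by rewrite divr_gt0.
  have [M hM] := ih _ e2.
  have [|M' hM'] := cP N (eps / 2 / `|e N : V|); first by rewrite divr_gt0 ?basis_norm_gt0.
  exists (maxn M M') => n; rewrite geq_max => /andP[Mn M'n] P.
  have h2 : `|(c N *: e N - coef (s n) N *: e N : X) : V| <= eps / 2.
    rewrite -scalerBl realif_normZ distrC -ler_pdivlMr ?basis_norm_gt0//.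
    exact: hM'.
  rewrite /basis_section !sum_nat_cond_recr opprD addrACA; apply: le_trans (ler_normD _ _) _.
  have := hM n Mn P; case: (P N) => h1; first by rewrite /basis_section in h1; lra.
  by rewrite subr0 normr0 /basis_section in h1 *; lra.
have lim_bound P N n :
    `|(\sum_(0 <= i < N | P i) c i *: e i : X) - basis_section P N (s n) : V| <= d n.
  apply/ler_addgt0Pl => eps eps0; have [M hM] := sum_lim N eps eps0.
  have := hM _ (leq_maxl M n) P; have := sec_cauchy P N _ _ (leq_maxr M n).
  move=> h1 h2; rewrite -(subrKA (basis_section P N (s (maxn M n)) : V)).
  by apply: le_trans (ler_normD _ _) _; have := dge (maxn M n); lra.
have cE : c = coef y.
  apply: coef_unique; apply/expansionP => eps eps0.
  have e4 : 0 < eps / 4 by rewrite divr_gt0.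
  have [n [dn rn]] := d_small _ e4.
  have [M hM] := (expansionP (s n) _).1 (@coef_cvg (s n)) _ e4.
  exists M => N /hM h1; have h2 := lim_bound xpredT N n.
  have h3 : `|y - s n| <= eps / 4.
    by rewrite /s opprB addrC subrK; apply: le_trans (r_le n) rn.
  pose T : V := \sum_(0 <= i < N) c i *: e i; pose S : V := basis_section xpredT N (s n).
  have -> : y - (\sum_(0 <= i < N) c i *: e i : X) = (y - s n) + ((s n - S) - (T - S)).
    by rewrite [- (T - S)]opprB !subrKA.
  apply: le_trans (ler_normD _ _) _; apply: le_trans (lerD h3 (ler_normB _ _)) _.
  by rewrite /basis_section in h1 h2 *; lra.
have := lim_bound P0 N0 0%N; rewrite cE /d expr0 mulr1.
rewrite (_ : s 0%N = 0); last by rewrite /s /= subrr.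
rewrite [basis_section P0 N0 0](_ : _ = 0) ?subr0 ?mulrA//.
by rewrite /basis_section big1// => i _; rewrite basis_coef0 scale0r.
Qed.

End Basis.

(** * Blocks that span a copy of c0 *)

Section Multipliers.
Variables (R : realType) (k : scalar_kind) (X : normedModType (scalars R k)).
Local Notation K := (scalars R k).
Local Notation V := (realif X).

Lemma linear_form_scalar (u : V -> R) (c : K) (x : X) : linear_form u ->
  u (c *: x) = re_scalar c * u x + im_scalar c * u (imunit R k *: x).
Proof.
move=> lu; rewrite {1}(re_imE c) scalerDl (linear_formD lu).
by rewrite mulrC -scalerA -!realif_scaleE !(linear_formZ lu).
Qed.

(** Group the terms by the sign of v (y i): each group sums to at most M. *)
Lemma bounded_sums_form (v : V -> R) (y : nat -> X) (M : R) :
  linear_form v -> (forall x, v x <= `|x|) ->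
  (forall P N, `|(\sum_(0 <= i < N | P i) y i : X) : V| <= M) ->
  forall (P : pred nat) N, \sum_(0 <= i < N | P i) `|v (y i)| <= 2 * M.
Proof.
move=> lv v1 yM P N; rewrite (bigID (fun i => 0 <= v (y i)))/=.
have h1 : \sum_(0 <= i < N | P i && (0 <= v (y i))) `|v (y i)| <= M.
  rewrite (eq_bigr (fun i => v (y i))); last by move=> i /andP[_ /ger0_norm].
  rewrite -(linear_form_sum _ _ (fun i => y i : V) lv).
  exact: le_trans (v1 _) (yM _ _).
have h2 : \sum_(0 <= i < N | P i && ~~ (0 <= v (y i))) `|v (y i)| <= M.
  rewrite (eq_bigr (fun i => - v (y i))); last first.
    by move=> i /andP[_]; rewrite -ltNge => /ltr0_norm.
  rewrite sumrN -(linear_form_sum _ _ (fun i => y i : V) lv) -(linear_formN lv).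
  by apply: le_trans (v1 _) _; rewrite normrN; exact: yM.
lra.
Qed.

(** A norming form sees a sum of a i *: y i through the values of u and u (i _) on
    the y i, whose absolute values have sum at most 2 M each. *)
Lemma bounded_multipliers (y : nat -> X) (M : R) :
  (forall P N, `|(\sum_(0 <= i < N | P i) y i : X) : V| <= M) ->
  forall (a : nat -> K) (A : R) (P : pred nat) N, 0 <= A ->
  (forall i, P i -> re_scalar `|a i| <= A) ->
  `|(\sum_(0 <= i < N | P i) a i *: y i : X) : V| <= 4 * M * A.
Proof.
move=> yM a A P N A0 aA.
have [u [lu u1] ux] := norming_form ((\sum_(0 <= i < N | P i) a i *: y i : X) : V).
apply: le_trans ux _; rewrite (linear_form_sum _ _ (fun i => a i *: y i : V) lu).
pose v (x : V) := u (imunit R k *: (x : X)).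
have lv : linear_form v.
  move=> r x z; rewrite /v scalerDr (linear_formD lu); congr (_ + _).
  by rewrite realif_scaleE scalerA mulrC -scalerA -realif_scaleE (linear_formZ lu).
have v1 x : v x <= `|x|.
  apply: le_trans (u1 _) _; rewrite !realif_normE /rnorm; apply: re_le.
  rewrite normrZ -[leRHS]mul1r ler_wpM2r//.
  by have := imunit_mul_norm (1 : K); rewrite mulr1 normr1.
have hu := bounded_sums_form lu u1 yM P N.
have hv := bounded_sums_form lv v1 yM P N.
apply: (@le_trans _ _ (A * (\sum_(0 <= i < N | P i) `|u (y i)| +
    \sum_(0 <= i < N | P i) `|v (y i)|))); last first.
  by have := ler_wpM2l A0 (lerD hu hv); lra.
rewrite -big_split mulr_sumr; apply: ler_sum => i Pi /=.
rewrite linear_form_scalar// mulrDr; apply: lerD.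
  apply: le_trans (ler_norm _) _; rewrite normrM ler_wpM2r//.
  exact: le_trans (re_norm_le _) (aA _ Pi).
apply: le_trans (ler_norm _) _; rewrite normrM ler_wpM2r//.
exact: le_trans (im_norm_le _) (aA _ Pi).
Qed.

End Multipliers.

Section CopiesOfC0.
Variables (R : realType) (k : scalar_kind).
Local Notation K := (scalars R k).

Lemma c0P (a : nat -> K) : c0 (a : nat -> K^o) <->
  forall eps, 0 < eps -> exists N, forall n, (N <= n)%N -> re_scalar `|a n| <= eps.
Proof.
split=> [/cvgrPdist_le h eps eps0|h].
  have : 0 < of_real k eps by rewrite -of_real0 of_real_lt.
  move=> /h[N _ hN]; exists N => n /hN /=.
  by rewrite sub0r normrN => /re_le; rewrite re_of_real.
apply/cvgrPdist_le => eps eps0.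
have ee : of_real k (re_scalar eps) = eps by rewrite re_real// ltW.
have /h[N hN] : 0 < re_scalar eps by rewrite -(of_real_lt k) of_real0 ee.
exists N => // n /hN /=; rewrite sub0r normrN => h1.
by rewrite -ee -[`|a n|]re_real// of_real_le.
Qed.

Lemma c0_bounded (a : nat -> K) : c0 (a : nat -> K^o) ->
  exists B, forall n, re_scalar `|a n| <= B.
Proof.
move=> /c0P /(_ 1 ltr01)[N hN].
exists (1 + \sum_(0 <= i < N) re_scalar `|a i|) => n.
have re0 i : 0 <= re_scalar `|a i| by apply: le_trans (normr_ge0 _) (re_norm_le _).
have [nN|nN] := leqP N n; first by apply: ler_wpDr (hN _ nN); exact: sumr_ge0.
apply: ler_wpDl => //; rewrite (big_cat_nat _ (n := n) (p := N))//= ?(ltnW nN)//.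
rewrite [X in _ <= _ + X]big_ltn//.
by apply: ler_wpDl; [exact: sumr_ge0|apply: ler_wpDr => //; exact: sumr_ge0].
Qed.

Lemma c0_norm_ge (a : nat -> K) n : c0 (a : nat -> K^o) ->
  re_scalar `|a n| <= c0_norm a.
Proof.
move=> /c0_bounded[B aB]; apply: ub_le_sup; last by exists n.
by exists B => _ [m _ <-]; exact: aB.
Qed.

Lemma c0_norm_le (a : nat -> K) B : (forall n, re_scalar `|a n| <= B) -> c0_norm a <= B.
Proof.
move=> aB; apply: ge_sup; first by exists (re_scalar `|a 0%N|), 0%N.
by move=> _ [m _ <-]; exact: aB.
Qed.

Variable X : completeNormedModType (scalars R k).
Local Notation V := (realif X).

(** The embedding is a |-> sum_i a i *: b i.  It converges, and is bounded, because
    multipliers from c0 act on bounded sums; it is bounded below by hypothesis.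
    For the image to be closed, a sequence of preimages of a convergent sequence
    is Cauchy in the sup norm, and its coordinatewise limit is in c0. *)
Lemma blocks_contain_c0 (b : nat -> X) (M lo : R) : 0 < lo ->
  (forall P N, `|(\sum_(0 <= i < N | P i) b i : X) : V| <= M) ->
  (forall (a : nat -> K) N j, (j < N)%N ->
     lo * re_scalar `|a j| <= `|(\sum_(0 <= i < N) a i *: b i : X) : V|) ->
  contains_c0 X.
Proof.
move=> lo0 bM blo.
pose ps (a : nat -> K) n : V := \sum_(0 <= i < n) a i *: b i.
have M0 : 0 <= M by apply: le_trans (normr_ge0 _) (bM xpredT 0%N).
have ps_cvg a : c0 (a : nat -> K^o) -> exists l : V, ps a @ \oo --> l.
  move=> /c0P ac; apply: cauchy_seq_cvg => eps eps0.
  have [|N hN] := ac (eps / (4 * M + 1)); first by rewrite divr_gt0// ltr_wpDl// mulr_ge0.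
  exists N => n Nn.
  have -> : ps a n - ps a N = \sum_(0 <= i < n | (N <= i)%N) a i *: b i.
    rewrite /ps (big_cat_nat _ (n := N) (p := n))//= [X in X - _]addrC addrK.
    rewrite [RHS](big_cat_nat _ (n := N) (p := n))//= [X in _ = X + _]big1_seq ?add0r; last first.
      by move=> i /andP[Ni]; rewrite mem_index_iota ltnNge Ni.
    by apply: congr_big_nat => // i /andP[-> _].
  apply: le_trans (bounded_multipliers bM n _ hN) _.
    by rewrite divr_ge0 ?addr_ge0 ?mulr_ge0// ltW.
  have : 0 < 4 * M + 1 by rewrite ltr_wpDl// mulr_ge0.
  move=> h; rewrite mulrA ler_pdivrMr//; nra.
pose J (a : nat -> K^o) : X := lim (ps a @ \oo).
have JP a : c0 a -> ps a @ \oo --> (J a : V).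
  by move=> /ps_cvg[l al]; rewrite /J (cvg_lim _ al).
have Jlow a n : c0 a -> lo * re_scalar `|a n : K| <= `|J a : V|.
  move=> ac; apply/ler_addgt0Pl => eps eps0.
  have /cvgrPdist_le/(_ _ eps0)[N _ hN] := JP _ ac.
  have h1 := hN _ (leq_maxl N n.+1); have h2 := blo a _ _ (leq_maxr N n.+1).
  apply: le_trans h2 _; rewrite addrC -lerBlDl.
  by apply: le_trans (lerB_dist _ _) _; rewrite distrC.
have Jup a B : c0 a -> (forall n, re_scalar `|a n : K| <= B) -> `|J a : V| <= 4 * M * B.
  move=> ac aB; apply/ler_addgt0Pl => eps eps0.
  have /cvgrPdist_le/(_ _ eps0)[N _ hN] := JP _ ac.
  have h1 := hN _ (leqnn N).
  have B0 : 0 <= B.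
    by apply: le_trans (aB 0%N); apply: le_trans (normr_ge0 _) (re_norm_le _).
  have h2 := bounded_multipliers bM N B0 (fun i (_ : xpredT i) => aB i).
  by rewrite -(subrK (ps a N) (J a : V)); apply: le_trans (ler_normD _ _) _; apply: lerD.
have c0_comb (c : K) (a a' : nat -> K^o) : c0 a -> c0 a' -> c0 (fun n => c *: a n + a' n).
  move=> ca ca'; rewrite /c0 /=.
  have -> : (0 : K^o) = c *: (0 : K^o) + 0 by rewrite scaler0 addr0.
  by apply: cvgD => //; apply: cvgZr.
have Jlin (c : K) (a a' : nat -> K^o) : c0 a -> c0 a' ->
    J (fun n => c *: a n + a' n) = c *: J a + J a'.
  move=> ca ca'; have := JP _ (c0_comb c _ _ ca ca').
  rewrite (_ : ps _ = fun n => (c *: (ps a n : X) + (ps a' n : X))); last first.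
    apply/funext => n; rewrite /ps scaler_sumr -big_split.
    by apply: eq_bigr => i _; rewrite scalerDl scalerA.
  move=> /cvg_realif h; apply: (cvg_unique _ h).
    exact: norm_hausdorff.
  by apply: cvgD; [apply: cvgZr|]; apply/cvg_realif; exact: JP.
exists J; split=> //.
- exists lo => // a ac; rewrite -ler_pdivlMl//; apply: c0_norm_le => n.
  by rewrite ler_pdivlMl//; exact: Jlow.
- by exists (4 * M) => a ac; apply: Jup => // n; exact: c0_norm_ge.
- move=> y yJ.
  have app eps : 0 < eps -> exists2 a, c0 a & `|(J a - y : X) : V| < eps.
    move=> eps0; have eps0' : 0 < of_real k eps by rewrite -of_real0 of_real_lt.
    have [_ [[a ac <-]]] := yJ _ (nbhsx_ballx y _ eps0').
    rewrite -ball_normE /ball_/= distrC => h; exists a => //.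
    by rewrite realif_normE -(of_real_lt k) of_rnorm.
  have /choice[a aP] : forall n : nat, exists a, c0 a /\ `|(J a - y : X) : V| < lo * 2^-1 ^+ n.
    by move=> n; have [|a ac ay] := app (lo * 2^-1 ^+ n); [rewrite mulr_gt0// exprn_gt0|exists a].
  have Jdist a1 a2 n : c0 a1 -> c0 a2 ->
      lo * re_scalar `|(a1 n : K) - a2 n| <= `|(J a1 - J a2 : X) : V|.
    move=> c1 c2; have := Jlow _ n (c0_comb (-1) _ _ c2 c1).
    rewrite Jlin// !scaleN1r [- a2 n + _]addrC [- J a2 + _]addrC.
    by [].
  have acauchy n m j : (n <= m)%N -> re_scalar `|(a m j : K) - a n j| <= 2 * 2^-1 ^+ n.
    move=> nm; have [c1 h1] := aP m; have [c2 h2] := aP n.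
    rewrite -(ler_pM2l lo0); apply: le_trans (Jdist _ _ j c1 c2) _.
    rewrite -(subrKA y); apply: le_trans (ler_normD _ _) _.
    have h3 : lo * 2^-1 ^+ m <= lo * 2^-1 ^+ n.
      by rewrite ler_pM2l// ler_wiXn2l// ?invr_ge0// invf_le1// ler1n.
    by rewrite [X in _ + X]distrC; lra.
  have /choice[al alP] : forall j, exists l : K, forall eps, 0 < eps -> exists N, forall n,
      (N <= n)%N -> re_scalar `|(a n j : K) - l| <= eps.
    move=> j; apply: scalars_complete => eps eps0.
    have [N hN] := halving_small 2 eps0.
    by exists N => n Nn; apply: le_trans (acauchy _ _ _ Nn) (hN _ (leqnn N)).
  have unif n j : re_scalar `|(a n j : K) - al j| <= 2 * 2^-1 ^+ n.
    apply/ler_addgt0Pl => eps eps0; have [N hN] := alP j eps eps0.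
    have h1 := hN _ (leq_maxl N n); have h2 := acauchy _ _ j (leq_maxr N n).
    rewrite -(subrKA (a (maxn N n) j)).
    apply: le_trans (re_le (ler_normD _ _)) _; rewrite reD addrC lerD//.
    by rewrite distrC.
  have alc : c0 (al : nat -> K^o).
    apply/c0P => eps eps0; have e2 : 0 < eps / 2 by rewrite divr_gt0.
    have [N hN] := halving_small 2 e2.
    have [/c0P/(_ _ e2)[N' hN'] _] := aP N.
    exists N' => n /hN' h1; have h2 := unif N n; have h3 := hN _ (leqnn N).
    have /re_le := ler_normB (a N n : K) ((a N n : K) - al n).
    by rewrite opprB addrCA subrr addr0 reD; lra.
  exists al => //; apply/eqP; rewrite -subr_eq0 -(normr_eq0 (J al - y : V)).
  rewrite eq_le normr_ge0 andbT; apply/ler_addgt0Pl => eps eps0; rewrite addr0.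
  have e2 : 0 < eps / 2 by rewrite divr_gt0.
  have [N1 hN1] := halving_small (4 * M * 2) e2; have [N2 hN2] := halving_small lo e2.
  pose N := maxn N1 N2; have [aNc aNy] := aP N.
  have h1 : `|(J al - J (a N) : X) : V| <= 4 * M * (2 * 2^-1 ^+ N).
    have := Jup _ (2 * 2^-1 ^+ N) (c0_comb (-1) _ _ aNc alc).
    rewrite Jlin// scaleN1r [- J _ + _]addrC; apply=> n.
    by rewrite scaleN1r addrC distrC unif.
  rewrite -(subrKA (J (a N))); apply: le_trans (ler_normD _ _) _.
  have := hN1 _ (leq_maxl N1 N2); have := hN2 _ (leq_maxr N1 N2); rewrite -/N.
  by move: h1 aNy; rewrite !mulrA; lra.
Qed.

End CopiesOfC0.

(** * Bases in spaces with large slices *)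

Section BasisDichotomy.
Variables (R : realType) (k : scalar_kind) (X : completeNormedModType (scalars R k)).
Local Notation K := (scalars R k).
Local Notation V := (realif X).
Variables (e : nat -> X) (coef : X -> nat -> K).
Hypothesis coef_cvg : forall x : X, series (fun n => coef x n *: e n) @ \oo --> x.
Hypothesis coef_unique : forall (x : X) (a : nat -> K),
  series (fun n => a n *: e n) @ \oo --> x -> a = coef x.
Local Notation section := (basis_section e coef).
Variable C : R.
Hypotheses (C1 : 1 <= C)
  (section_le : forall P N (x : X), `|section P N x : V| <= C * `|x : V|).

Let C0 : 0 < C. Proof. exact: lt_le_trans ltr01 C1. Qed.

Lemma section0 P N : section P N 0 = 0.
Proof.
have /(congr1 (fun x : X => x - section P N 0)) := sectionD coef_cvg coef_unique P N 0 0.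
by rewrite addr0 subrr addrK => <-.
Qed.

Lemma section_sum P N (a : nat -> K) (b : nat -> X) n :
  section P N (\sum_(0 <= i < n) a i *: b i) = \sum_(0 <= i < n) a i *: section P N (b i).
Proof.
elim: n => [|n ih]; first by rewrite !big_geq// section0.
by rewrite !big_nat_recr//= (sectionD coef_cvg coef_unique) ih
  (sectionZ coef_cvg coef_unique).
Qed.

(** If the partial sums are not Cauchy, some subsequence of them has differences b j
    of norm larger than eps.  Selected sums of the b j are selected sums of the
    series, bounded by M, and the section over the j-th block recovers a j *: b j
    from a combination of the blocks. *)
Lemma bounded_expansion_dichotomy (z : nat -> K) (M : R) :
  (forall P N, `|(\sum_(0 <= i < N | P i) z i *: e i : X) : V| <= M) ->
  (exists x : X, series (fun n => z n *: e n) @ \oo --> x) \/ contains_c0 X.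
Proof.
move=> zM.
pose s n : V := \sum_(0 <= i < n) z i *: e i.
have [h|h] := pselect (forall eps, 0 < eps ->
    exists N, forall n, (N <= n)%N -> `|s n - s N| <= eps).
  left; have [l sl] := cauchy_seq_cvg h.
  by exists l; apply/cvg_realif.
right.
have {h}[eps eps0 h] : exists2 eps, 0 < eps & forall N, exists2 n, (N < n)%N & eps < `|s n - s N|.
  apply: contrapT => h1; apply: h => eps eps0; apply: contrapT => h2.
  apply: h1; exists eps => // N; apply: contrapT => h3; apply: h2; exists N => n.
  rewrite leq_eqVlt => /orP[/eqP ->|Nn]; first by rewrite subrr normr0 ltW.
  by rewrite leNgt; apply/negP => h4; apply: h3; exists n.
have /choice[next nextP] : forall N, exists n, (N < n)%N /\ eps < `|s n - s N|.
  by move=> N; have [n] := h N; exists n.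
pose start j := iter j next 0%N.
have start_lt j : (start j < start j.+1)%N by have [] := nextP (start j).
have start_le i j : (i <= j)%N -> (start i <= start j)%N.
  move=> /subnK <-; elim: (j - i)%N => // d ih; rewrite addSn.
  exact: leq_trans ih (ltnW (start_lt _)).
pose b j : X := \sum_(0 <= i < start j.+1 | (start j <= i)%N) z i *: e i.
have bE j : b j = \sum_(start j <= i < start j.+1) z i *: e i.
  rewrite /b (big_cat_nat _ (n := start j) (p := start j.+1))//= ?(ltnW (start_lt j))//.
  rewrite [X in X + _]big1_seq ?add0r; last first.
    by move=> i /andP[ji]; rewrite mem_index_iota ltnNge ji.
  by apply: congr_big_nat => // i /andP[-> _].
have b_large j : eps < `|b j : V|.
  have [_] := nextP (start j); rewrite -/(start j.+1).
  rewrite /s (big_cat_nat _ (n := start j) (p := start j.+1))//= ?(ltnW (start_lt j))//.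
  by rewrite [X in X - _]addrC addrK -bE.
have b_coef j m : coef (b j) m = if (m < start j.+1)%N && (start j <= m)%N then z m else 0.
  exact: coef_partial_sum.
have b_section i j : section (fun m => start j <= m)%N (start j.+1) (b i) =
    if i == j then b j else 0.
  rewrite /basis_section; case: eqVneq => [->|ij].
    rewrite /b big_mkcond [RHS]big_mkcond; apply: eq_big_nat => m /andP[_ mj].
    by rewrite b_coef mj /=; case: (start j <= m)%N.
  rewrite big_mkcond big1_seq// => m /andP[_]; rewrite mem_index_iota => /andP[_ mj].
  case: ifP => // jm; rewrite b_coef; case: ifP => [/andP[mi im]|_]; last by rewrite scale0r.
  move: ij; rewrite neq_ltn => /orP[/start_le h1|/start_le h1].
    by have := leq_trans mi (leq_trans h1 jm); rewrite ltnn.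
  by have := leq_trans mj (leq_trans h1 im); rewrite ltnn.
apply: (@blocks_contain_c0 R k X b M (eps / C)).
- by rewrite divr_gt0.
- move=> P N.
  have [Q ->] : exists Q, \sum_(0 <= j < N | P j) b j = \sum_(0 <= i < start N | Q i) z i *: e i.
    elim: N => [|N [Q ih]]; first by exists xpredT; rewrite !big_geq.
    exists (fun i => if (i < start N)%N then Q i else P N).
    rewrite sum_nat_cond_recr ih.
    rewrite [RHS](big_cat_nat _ (n := start N) (p := start N.+1))//= ?(ltnW (start_lt N))//.
    congr (_ + _).
      by rewrite big_mkcond [RHS]big_mkcond; apply: eq_big_nat => i /andP[_ ->].
    rewrite bE big_mkcond [RHS]big_mkcond/=; case: (P N).
      by apply: eq_big_nat => i /andP[Ni _]; rewrite ltnNge Ni.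
    rewrite big1_seq// => i /andP[_]; rewrite mem_index_iota => /andP[Ni _].
    by rewrite ltnNge Ni.
  exact: zM.
- move=> a N j jN.
  have := section_le (fun m => start j <= m)%N (start j.+1) (\sum_(0 <= i < N) a i *: b i).
  rewrite section_sum (bigD1_seq j) ?mem_index_iota ?iota_uniq//= b_section eqxx.
  rewrite big1 ?addr0 => [|i /negbTE ij]; last by rewrite b_section ij scaler0.
  rewrite realif_normZ => h1; rewrite mulrAC ler_pdivrMr// [leRHS]mulrC.
  apply: le_trans h1; rewrite mulrC; apply: ler_wpM2l; last exact: ltW.
  by apply: le_trans (normr_ge0 _) (re_norm_le _).
Qed.

Variable delta : R.
Hypotheses (delta0 : 0 < delta) (slices : large_slices V delta).

(** Functionals in H pass to coordinatewise limits, which need not be weak limits. *)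
Let H : set (V -> R) := [set u : V -> R | bounded_form u /\
  exists N, forall x : X, (forall i, (i < N)%N -> coef x i = 0) -> u x = 0].

(** Compose a norming form of x with a long section, whose norm is at most C. *)
Let norming (x : V) : exists u, [/\ H u, forall y, u y <= `|y| & (2 * C)^-1 * `|x| <= u x].
Proof.
have [u [lu u1] ux] := norming_form x.
have h0 : 0 <= `|x| / 2 by rewrite divr_ge0.
have [N] : exists N, `|x - (section xpredT N x : V)| <= `|x| / 2.
  have [x0|x0] := eqVneq x 0.
    by exists 0%N; rewrite x0 section0 subrr normr0 mul0r.
  have x20 : 0 < `|x| / 2 by rewrite divr_gt0// normr_gt0.
  have [N hN] := (expansionP _ _ _).1 (@coef_cvg x) _ x20.
  by exists N; exact: hN.
move=> xN; exists (fun y : V => C^-1 * u (section xpredT N y)).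
have le1 (y : V) : C^-1 * u (section xpredT N y) <= `|y|.
  by rewrite ler_pdivrMl//; apply: le_trans (u1 _) (section_le _ _ _).
split=> //.
- split; first split.
  + move=> r y y'; rewrite (sectionD coef_cvg coef_unique) (linear_formD lu).
    rewrite realif_scaleE (sectionZ coef_cvg coef_unique) -realif_scaleE (linear_formZ lu).
    by ring.
  + by exists 1 => y; rewrite mul1r.
  exists N => y yN; rewrite (_ : section _ _ _ = 0) ?(linear_form0 lu) ?mulr0//.
  rewrite /basis_section big1_seq// => i /andP[_]; rewrite mem_index_iota => /andP[_ iN].
  by rewrite yN// scale0r.
rewrite invfM mulrAC mulrC ler_pM2l ?invr_gt0//.
have := u1 (x - (section xpredT N x : V)); rewrite (linear_formB lu); lra.
Qed.

Let H_comb u l r : H u -> H l -> H (fun x => u x + r * l x).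
Proof.
move=> [bu [N uN]] [bl [N' lN]]; split; first exact: bounded_form_comb.
exists (maxn N N') => x x0; rewrite uN ?lN ?mulr0 ?addr0// => i iN; apply: x0.
  by apply: leq_trans iN (leq_maxr _ _).
by apply: leq_trans iN (leq_maxl _ _).
Qed.

Lemma form_of_parts (u : V -> R) p q (x : X) : linear_form u ->
  u (of_parts k p q *: x) = p * u x + q * u (imunit R k *: x).
Proof.
move=> lu; rewrite /of_parts scalerDl (linear_formD lu) mulrC -scalerA.
by rewrite -!realif_scaleE !(linear_formZ lu).
Qed.

Let form_bound (u : V -> R) (x : V) : linear_form u -> (forall y, u y <= `|y|) -> `|u x| <= `|x|.
Proof.
move=> lu u1; rewrite ler_norml u1 andbT lerNl -(linear_formN lu).
by apply: le_trans (u1 _) _; rewrite normrN.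
Qed.

(** A form separating x from the averages of integer multiples of the e i and i e i
    is bounded below on all these multiples, so it vanishes on the closed span of
    the basis, which contains x; but it also separates x from the multiple 0. *)
Lemma separable_of_basis (eps : R) : 0 < eps ->
  exists (I : countType) (D : I -> V), forall x, exists i, `|x - D i| < eps.
Proof.
move=> eps0.
pose dir (t : bool) i : V := if t then e i else imunit R k *: e i.
pose vec (c : nat * nat * bool * bool) : V :=
  let: (m, i, s, t) := c in ((-1) ^+ s * m%:R) *: dir t i.
exists (seq (nat * nat * bool * bool))%type, (fun l => average [seq vec c | c <- l]).
move=> x; apply: contrapT => far.
have [||u [lu u1] uP] := @separation R V (range vec) x eps.
- exact: ltW.
- move=> s _ sx.
  have [l ->] : exists l, s = [seq vec c | c <- l].
    elim: s sx => [_|y s ih sx]; first by exists [::].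
    have [|l ->] := ih; first by move=> t ts; apply: sx; rewrite inE ts orbT.
    by have [t _ <-] := sx y (mem_head _ _); exists (t :: l).
  by rewrite leNgt distrC; apply/negP => h; apply: far; exists l.
have vanish (w : V) : (forall m s, u x + eps <= u (((-1) ^+ (s : bool) * m%:R : R) *: w)) -> u w = 0.
  move=> h; apply/eqP; apply: contrapT => /negP; rewrite -normr_gt0 => uw.
  pose m := (Num.truncn (`|u x| / `|u w|)).+1.
  have mu : `|u x| < m%:R * `|u w| by rewrite -ltr_pdivrMr// truncnS_gt.
  have h1 := h m true; have h2 := h m false.
  rewrite !(linear_formZ lu) expr1 expr0 mulN1r mul1r mulNr in h1 h2.
  have := ler_norm (u x); have := ler_norm (- u x); rewrite normrN.
  by case: (lerP 0 (u w)) => uw0; [rewrite (ger0_norm uw0) in mu|rewrite (ltr0_norm uw0) in mu]; lra.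
have ue i : u (e i) = 0.
  apply: vanish => m s.
  by have h := uP _ (ex_intro2 _ _ (m, i, s, true) I erefl); exact: h.
have uie i : u (imunit R k *: e i) = 0.
  apply: vanish => m s.
  by have h := uP _ (ex_intro2 _ _ (m, i, s, false) I erefl); exact: h.
have ux : u x = 0.
  apply/eqP; rewrite -normr_eq0 eq_le normr_ge0 andbT; apply/ler_addgt0Pl => d d0.
  have [N /(_ _ (leqnn N)) hN] := (expansionP _ _ _).1 (@coef_cvg x) _ d0.
  rewrite addr0; apply: le_trans hN; apply: le_trans (form_bound _ lu u1).
  rewrite (linear_formB lu) (linear_form_sum _ _ (fun i => coef x i *: e i : V) lu).
  by rewrite big1 ?subr0// => i _; rewrite linear_form_scalar// ue uie !mulr0 addr0.
have := uP (vec (0, 0, false, false)%N) (ex_intro2 _ _ _ I erefl).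
by rewrite /vec mulr0 scale0r (linear_form0 lu) ux add0r leNgt eps0.
Qed.

(** Along each branch, the coordinates have limits z i, and every partial sum of
    the z i *: e i is a weak limit of sections of points of the ball, hence
    bounded by C.  If c0 is not contained in X, then these series converge, and
    their sums are the limits that [cantor_scheme] excludes in a separable
    space. *)
Theorem basis_contains_c0 : contains_c0 X.
Proof.
apply: contrapT => no_c0.
have kappa0 : 0 < (2 * C)^-1 by rewrite invr_gt0 mulr_gt0.
have Hb : H `<=` @bounded_form R V by move=> u [].
have [x [c [c0 x1 near]]] := cantor_scheme delta0 kappa0 slices Hb H_comb norming.
have [L gL] := ex_generalized_limit R; have [Llin Lge] := gL.
have /choice[z zP] : forall sigma : nat -> bool, exists z : V, forall u, H u ->
    u z = L (fun n => u (x (branch sigma n))).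
  move=> sigma; pose xs n := x (branch sigma n).
  pose zs i := of_parts k (L (fun n => re_scalar (coef (xs n) i)))
    (L (fun n => im_scalar (coef (xs n) i))).
  have coef_bound i n : re_scalar `|coef (xs n) i| <= C / `|e i : V|.
    have ei := basis_norm_gt0 coef_cvg coef_unique i.
    rewrite ler_pdivlMr// -realif_normZ -(section1 e coef).
    by apply: le_trans (section_le _ _ _) _; apply: ler_piMr; [exact: ltW|exact: x1].
  have bre i : bounded_seq (fun n => re_scalar (coef (xs n) i)).
    by exists (C / `|e i : V|) => n; apply: le_trans (re_norm_le _) (coef_bound i n).
  have bim i : bounded_seq (fun n => im_scalar (coef (xs n) i)).
    by exists (C / `|e i : V|) => n; apply: le_trans (im_norm_le _) (coef_bound i n).
  have sumE (u : V -> R) P N : linear_form u -> bounded_seq (fun n => u (section P N (xs n))) /\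
      u (\sum_(0 <= i < N | P i) zs i *: e i) = L (fun n => u (section P N (xs n))).
    move=> lu; elim: N => [|N [ihb ih]].
      rewrite (_ : (fun n => _) = fun _ => 0); last first.
        by apply/funext => n; rewrite /basis_section big_geq// (linear_form0 lu).
      rewrite big_geq// (linear_form0 lu) generalized_limit0//.
      by split=> //; exact: bounded_seq_cst.
    rewrite (_ : (fun n => _) = fun n => if P N then u (e N) * re_scalar (coef (xs n) N) +
        (u (imunit R k *: e N) * im_scalar (coef (xs n) N) + u (section P N (xs n)))
        else u (section P N (xs n))); last first.
      apply/funext => n; rewrite /basis_section sum_nat_cond_recr (linear_formD lu).
      case: (P N); last by rewrite (linear_form0 lu) addr0.
      by rewrite (linear_form_scalar _ _ lu); ring.
    rewrite sum_nat_cond_recr (linear_formD lu) ih.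
    case: (P N); last by rewrite (linear_form0 lu) addr0.
    split; first by do 2 apply: bounded_seq_comb => //.
    rewrite !Llin//; last exact: bounded_seq_comb.
    by rewrite (form_of_parts _ _ _ lu); ring.
  have zM P N : `|(\sum_(0 <= i < N | P i) zs i *: e i : X) : V| <= C.
    have [u [lu u1] ux] := norming_form ((\sum_(0 <= i < N | P i) zs i *: e i : X) : V).
    apply: le_trans ux _; have [bs ->] := sumE u P N lu.
    apply: (generalized_limit_le gL) => // n; apply: le_trans (u1 _) _.
    by apply: le_trans (section_le _ _ _) _; apply: ler_piMr; [exact: ltW|exact: x1].
  have [[w zw]|//] := bounded_expansion_dichotomy zM.
  exists w => u [[lu _] [N uN]].
  have uE (y : X) : u y = u (section xpredT N y).
    apply/eqP; rewrite -subr_eq0 -(linear_formB lu) uN// => i iN.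
    rewrite (basis_coefB coef_cvg coef_unique) (coef_section coef_unique).
    by rewrite iN subrr.
  rewrite uE /basis_section -(coef_unique zw) (sumE u xpredT N lu).2.
  by congr L; apply/funext => n; rewrite -uE.
have [I [D DP]] := separable_of_basis c0.
apply: (near z _ I D); last by move=> sigma; exact: DP.
move=> sigma u r Hu [N h]; rewrite zP//; apply: (Lge _ _ N) => //.
have [[lu [B uB]] _] := Hu; exists `|B| => n.
have hB y : `|y| <= 1 -> u y <= `|B|.
  move=> y1; apply: le_trans (uB y) _; apply: le_trans (ler_norm _) _.
  by rewrite normrM normr_id ler_piMr.
by rewrite ler_norml hB// andbT lerNl -(linear_formN lu) hB// normrN.
Qed.

End BasisDichotomy.

(** * Approximating a Bochner density by simple functions *)

Section FiniteMeasure.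
Variables (R : realType) (d : measure_display) (T : measurableType d).
Variable mu : {finite_measure set T -> \bar R}.
Local Notation lam A := (fine (mu A)).
Implicit Types A B : set T.

Lemma fin_mu A : measurable A -> (mu A \is a fin_num)%E.
Proof. by move=> mA; exact: fin_num_measure. Qed.

Lemma lam0 : lam set0 = 0.
Proof. by rewrite measure0. Qed.

Lemma lam_ge0 A : 0 <= lam A.
Proof. by rewrite fine_ge0. Qed.

Lemma lamU A B : measurable A -> measurable B -> A `&` B = set0 ->
  lam (A `|` B) = lam A + lam B.
Proof. by move=> mA mB AB; rewrite measureU// fineD// fin_mu. Qed.

Lemma lam_le A B : measurable A -> measurable B -> A `<=` B -> lam A <= lam B.
Proof.
by move=> mA mB AB; rewrite fine_le ?fin_mu// le_measure// inE.
Qed.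

Lemma lam_split A B : measurable A -> measurable B ->
  lam A = lam (A `&` B) + lam (A `\` B).
Proof.
move=> mA mB; rewrite -lamU; [by rewrite setUIDK|exact: measurableI|exact: measurableD|].
by rewrite setDE setIACA setICr setI0.
Qed.

Lemma lam_subadditive A B C : measurable A -> measurable B -> measurable C ->
  A `<=` B `|` C -> lam A <= lam B + lam C.
Proof.
move=> mA mB mC ABC; rewrite (lam_split mA mB); apply: lerD.
  by apply: lam_le => //; exact: measurableI.
by apply: lam_le => //; [exact: measurableD|move=> t [/ABC[]]].
Qed.

Lemma lam_bigsetU (I : choiceType) (s : seq I) (F : I -> set T) : uniq s ->
  (forall i, measurable (F i)) -> trivIset [set` s] F ->
  lam (\big[setU/set0]_(i <- s) F i) = \sum_(i <- s) lam (F i).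
Proof.
move=> + mF; elim: s => [_ _|i s ih /= /andP[si us] tF].
  by rewrite !big_nil lam0.
rewrite !big_cons lamU//; last 2 first.
- exact: bigsetU_measurable.
- rewrite -bigcup_seq setI_bigcupr bigcup0// => j js.
  have [ij|ij] := eqVneq i j; first by rewrite ij js in si.
  move/trivIsetP : tF; apply=> //=; first by rewrite mem_head.
  by rewrite inE js orbT.
rewrite ih//; apply: sub_trivIset tF => j /= js.
by rewrite inE js orbT.
Qed.

Lemma lam_sum_le (I : choiceType) (s : seq I) (F : I -> set T) A : uniq s ->
  (forall i, measurable (F i)) -> trivIset [set` s] F -> measurable A ->
  \sum_(i <- s) lam (A `&` F i) <= lam A.
Proof.
move=> us mF tF mA; rewrite -lam_bigsetU//.
- apply: lam_le => //; first by apply: bigsetU_measurable => i _; exact: measurableI.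
  by rewrite -bigcup_seq => t [i _ []].
- by move=> i; exact: measurableI.
- exact: trivIset_setIl.
Qed.

End FiniteMeasure.

Section BochnerDensity.
Variables (R : realType) (k : scalar_kind) (X : normedModType (scalars R k)).
Local Notation V := (realif X).
Variables (d : measure_display) (T : measurableType d).
Variable mu : {finite_measure set T -> \bar R}.
Local Notation lam A := (fine (mu A)).

Definition values (s : T -> X) : seq X := finmap.enum_fset (fset_set (range s)).

Lemma mem_values s t : simple_function s -> s t \in values s.
Proof. by move=> [fs _]; rewrite /values in_fset_set// inE; exists t. Qed.

Let joint (s t : T -> X) (p : X * X) := s @^-1` [set p.1] `&` t @^-1` [set p.2].
Let joint_values (s t : T -> X) := [seq (x, y) | x <- values s, y <- values t].

Let joint_measurable s t p : simple_function s -> simple_function t ->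
  measurable (joint s t p).
Proof. by move=> [_ ms] [_ mt]; exact: measurableI. Qed.

Let joint_trivIset s t (D : set (X * X)) A : trivIset D (fun p => A `&` joint s t p).
Proof. by move=> [x y] [x' y'] _ _ [w [[_ [/= <- <-]] [_ [/= <- <-]]]]. Qed.

Let joint_uniq s t : uniq (joint_values s t).
Proof. by apply: allpairs_uniq; rewrite ?finmap.fset_uniq// => -[? ?] [? ?]. Qed.

Let joint_cover s t A : simple_function s -> simple_function t ->
  \big[setU/set0]_(p <- joint_values s t) (A `&` joint s t p) = A.
Proof.
move=> ss st; rewrite -bigcup_seq; apply/seteqP; split=> [w [p _ []//]|w Aw].
exists (s w, t w); last by split.
by apply: allpairs_f; exact: mem_values.
Qed.

Lemma simple_integralE E s : simple_function s ->
  (simple_integral mu E s : V) =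
  \sum_(x <- values s) lam (E `&` s @^-1` [set x]) *: (x : V).
Proof. by move=> [fs _]; rewrite /simple_integral fsbig_finite. Qed.

Let simple_integral_joint E s t : simple_function s -> simple_function t ->
  measurable E -> (simple_integral mu E s : V) =
  \sum_(p <- joint_values s t) lam (E `&` joint s t p) *: (p.1 : V).
Proof.
move=> ss st mE; rewrite simple_integralE// big_allpairs_dep/=.
apply: eq_bigr => x _; rewrite -scaler_suml; congr (_ *: _).
rewrite -lam_bigsetU ?finmap.fset_uniq//.
- congr (fine (mu _)); rewrite -bigcup_seq; apply/seteqP; split=> [w [Ew sw]|w [y _ [Ew [sw _]]]] //.
  by exists (t w); [exact: mem_values|].
- by move=> y; apply: measurableI => //; exact: joint_measurable.
- by move=> y y' _ _ [w [[_ [_ /= <-]] [_ [_ /= <-]]]].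
Qed.

Let simple_integral_jointC E s t : simple_function s -> simple_function t ->
  measurable E -> (simple_integral mu E t : V) =
  \sum_(p <- joint_values s t) lam (E `&` joint s t p) *: (p.2 : V).
Proof.
move=> ss st mE; rewrite (simple_integral_joint st ss mE) !big_allpairs_dep/= exchange_big/=.
by apply: eq_bigr => x _; apply: eq_bigr => y _; rewrite /joint/= [X in E `&` X]setIC.
Qed.

(** In the application G1 and G2 are the distances of s and t to the density, which
    are measurable only after truncation on the null set N.  Integrate over the
    joint level sets of s and t, on which s - t is constant. *)
Lemma simple_integral_dist (E : set T) (s t : T -> X) (N : set T) (G1 G2 : T -> \bar R) :
  simple_function s -> simple_function t -> measurable E ->
  measurable N -> mu N = 0%E ->
  measurable_fun [set: T] G1 -> measurable_fun [set: T] G2 ->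
  (forall w, 0 <= G1 w)%E -> (forall w, 0 <= G2 w)%E ->
  (forall w, ~ N w -> (`|(s w - t w : X) : V|%:E <= G1 w + G2 w)%E) ->
  (`|(simple_integral mu E s - simple_integral mu E t : X) : V|%:E <=
    \int[mu]_(w in E) G1 w + \int[mu]_(w in E) G2 w)%E.
Proof.
move=> ss st mE mN N0 mG1 mG2 G10 G20 G12.
have mG : measurable_fun [set: T] (fun w => G1 w + G2 w)%E by exact: emeasurable_funD.
rewrite -ge0_integralD//; last 2 first.
- exact: measurable_funS mG1.
- exact: measurable_funS mG2.
have mEj p : measurable (E `&` joint s t p) by apply: measurableI => //; exact: joint_measurable.
rewrite -[in leRHS](joint_cover E ss st) ge0_integral_bigsetU//; last 2 first.
- exact: measurable_funS mG.
- by move=> w _; exact: adde_ge0.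
apply: (@le_trans _ _ (\sum_(p <- joint_values s t) lam (E `&` joint s t p) * `|(p.1 - p.2 : X) : V|)%:E).
  rewrite lee_fin [X in `|X|](_ : _ = (simple_integral mu E s : V) - simple_integral mu E t)//.
  rewrite (simple_integral_joint ss st mE) (simple_integral_jointC ss st mE) -sumrB.
  apply: le_trans (ler_norm_sum _ _ _) _; apply: ler_sum => p _.
  by rewrite -scalerBr normrZ ger0_norm// lam_ge0.
rewrite -sumEFin; apply: lee_sum => p _.
set A := E `&` joint s t p.
have mA : measurable A := mEj p.
have mAN : measurable (A `\` N) by exact: measurableD.
have muAN : mu A = mu (A `\` N).
  have N0' : mu (A `&` N) = 0%E.
    apply: (subset_measure0 _ mN _ N0); [exact: measurableI|exact: subIsetr].
  by rewrite (measureDI mu mA mN) [X in (_ + X)%E]N0' adde0.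
apply: (@le_trans _ _ (\int[mu]_(w in A `\` N) (G1 w + G2 w))%E); last first.
  apply: ge0_subset_integral => //; first exact: measurable_funS mG.
    by move=> w _; exact: adde_ge0.
rewrite EFinM fineK ?fin_mu// muAN muleC -integral_cst//.
apply: ge0_le_integral => //.
- by move=> w _; rewrite /cst lee_fin.
- exact: measurable_funS mG.
- by move=> w [[Ew [/= sw tw]] /G12]; rewrite sw tw.
Qed.

Lemma simple_dist_measurable (s t : T -> X) : simple_function s -> simple_function t ->
  measurable_fun [set: T] (fun w => `|(s w - t w : X) : V|).
Proof.
move=> ss st _ Y mY; rewrite setTI.
rewrite (_ : _ @^-1` Y = \big[setU/set0]_(p <- joint_values s t |
    `[< Y `|(p.1 - p.2 : X) : V| >]) joint s t p).
  by apply: bigsetU_measurable => p _; exact: joint_measurable.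
rewrite -bigcup_seq_cond; apply/seteqP; split=> [w /= Yw|w [p /= /andP[_ /asboolP Yp] [/= sp tp]]].
  exists (s w, t w) => //=; apply/andP; split; last exact/asboolP.
  by apply: allpairs_f; exact: mem_values.
by rewrite /preimage/= sp tp.
Qed.

(** The integral is a supremum over simple minorants, hence monotone on all
    nonnegative functions. *)
Lemma integral_le_nonmeasurable (f g : T -> \bar R) :
  (forall w, 0 <= f w)%E -> (forall w, f w <= g w)%E ->
  (\int[mu]_w f w <= \int[mu]_w g w)%E.
Proof.
move=> f0 fg; have g0 w : (0 <= g w)%E by apply: le_trans (fg w).
rewrite !ge0_integralTE//; apply: ge_ereal_sup => _ [h hf <-].
apply: ereal_sup_ubound; exists h => // w; exact: le_trans (hf w) (fg w).
Qed.

Variables (f : T -> X) (m : set T -> X).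
Hypothesis f_int : bochner_integrable mu f.
Hypothesis f_density : forall E, measurable E -> is_bochner_integral mu E f (m E).

(** The term of A i is at most the integral over A i of |f - s0|, so any s0 close to
    f in L1 serves.  Each value m E may come from its own approximating sequence
    s2, compared with s0 by [simple_integral_dist].  The function |f - s0| is an
    almost everywhere limit of measurable functions, and is made measurable by
    cutting it off on a null set N. *)
Theorem bochner_simple_approximation (eta : R) : 0 < eta ->
  exists2 s0 : T -> X, simple_function s0 &
  forall (I : choiceType) (l : seq I) (A : I -> set T), uniq l ->
    (forall i, measurable (A i)) -> trivIset [set` l] A ->
    \sum_(i <- l) `|(m (A i) - simple_integral mu (A i) s0 : X) : V| <= eta.
Proof.
move=> eta0; have [[sj sjP [N [mN N0 subN]]] [s1 [s1P s1cvg]]] := f_int.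
pose gap (t : T -> X) w : R := `|(f w - t w : X) : V| * \1_(~` N) w.
have gap0 t w : 0 <= gap t w by rewrite mulr_ge0.
have mgap t : simple_function t -> measurable_fun [set: T] (gap t).
  move=> st.
  apply: (@measurable_fun_cvg _ _ _ _ (fun j w => `|(sj j w - t w : X) : V| * \1_(~` N) w)).
    move=> j; apply: measurable_funM; first exact: simple_dist_measurable.
    exact/measurable_indic/measurableC.
  move=> w _; rewrite /gap indicE; case: (boolP (w \in ~` N)) => [|_]; last first.
    by rewrite mulr0; under eq_fun do rewrite mulr0; exact: cvg_cst.
  rewrite inE => nNw; rewrite mulr1; under eq_fun do rewrite mulr1.
  have fw : sj ^~ w @ \oo --> f w.
    by apply: contrapT => h; apply: nNw; apply: subN.
  have /cvg_realif h : (fun j => sj j w - t w) @ \oo --> f w - t w.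
    by apply: cvgB => //; exact: cvg_cst.
  exact: cvg_norm h.
have gap_le t : (\int[mu]_w (gap t w)%:E <= \int[mu]_w (rnorm (f w - t w))%:E)%E.
  apply: integral_le_nonmeasurable => w; rewrite lee_fin//.
  by rewrite /gap indicE; case: (_ \in _); rewrite ?mulr1// mulr0 -realif_normE.
have small (s : nat -> T -> X) eps : 0 < eps ->
    (\int[mu]_w (rnorm (f w - s j w))%:E)%E @[j --> \oo] --> 0%E ->
    \forall j \near \oo, (\int[mu]_w (rnorm (f w - s j w))%:E <= eps%:E)%E.
  move=> eps0 /(_ [set x | x < eps%:E]%E) h; have /h : nbhs 0%E [set x | x < eps%:E]%E.
    by apply: open_nbhs_nbhs; split; [exact: open_ereal_lt_ereal|rewrite /= lte_fin].
  by move=> [J _ hJ]; exists J => // j /hJ /= /ltW.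
have [n _ /(_ _ (leqnn n)) hn] := small s1 _ eta0 s1cvg.
exists (s1 n); first exact: s1P.
have mEgap t : simple_function t -> measurable_fun [set: T] (fun w => (gap t w)%:E).
  by move=> /mgap h; exact/measurable_EFinP.
have key E : measurable E -> (`|(m E - simple_integral mu E (s1 n) : X) : V|%:E <=
    \int[mu]_(w in E) (gap (s1 n) w)%:E)%E.
  move=> mE; have [s2 [s2P s2cvg] /cvg_realif/cvgrPdist_le s2E] := f_density mE.
  apply/lee_addgt0Pr => eps eps0.
  have e2 : 0 < eps / 2 by rewrite divr_gt0.
  have [j [h1 h2]] : exists j, (\int[mu]_w (rnorm (f w - s2 j w))%:E <= (eps / 2)%:E)%E /\
      `|(m E : V) - simple_integral mu E (s2 j)| <= eps / 2.
    have [j _ /(_ _ (leqnn j)) []] := filterI (small s2 _ e2 s2cvg) (s2E _ e2).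
    by exists j.
  have h3 : (`|(simple_integral mu E (s2 j) - simple_integral mu E (s1 n) : X) : V|%:E <=
      \int[mu]_(w in E) (gap (s2 j) w)%:E + \int[mu]_(w in E) (gap (s1 n) w)%:E)%E.
    apply: (simple_integral_dist (s2P j) (s1P n) mE mN N0) => //.
    - exact: mEgap.
    - exact: mEgap.
    - by move=> w; rewrite lee_fin.
    - by move=> w; rewrite lee_fin.
    - move=> w nNw; rewrite -EFinD lee_fin /gap indicE mem_set// !mulr1.
      have -> : (s2 j w - s1 n w : X) = (f w - s1 n w) - (f w - s2 j w).
        by rewrite opprB [RHS]addrC subrKA.
      rewrite [leRHS]addrC; exact: (ler_normB (f w - s1 n w : V) (f w - s2 j w : V)).
  have h4 : (\int[mu]_(w in E) (gap (s2 j) w)%:E <= (eps / 2)%:E)%E.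
    apply: le_trans h1; apply: le_trans (gap_le _); apply: ge0_subset_integral => //.
      exact: mEgap.
    by move=> w _; rewrite lee_fin.
  have -> : (m E - simple_integral mu E (s1 n) : X) = (m E - simple_integral mu E (s2 j)) +
      (simple_integral mu E (s2 j) - simple_integral mu E (s1 n)) by rewrite subrKA.
  apply: (@le_trans _ _ ((eps / 2)%:E + ((eps / 2)%:E + \int[mu]_(w in E) (gap (s1 n) w)%:E))%E).
    apply: le_trans (_ : ((`|(m E - simple_integral mu E (s2 j) : X) : V|)%:E +
      (`|(simple_integral mu E (s2 j) - simple_integral mu E (s1 n) : X) : V|)%:E <= _)%E).
      by rewrite -EFinD lee_fin; exact: ler_normD.
    apply: leeD; first by rewrite lee_fin.
    by apply: le_trans h3 _; rewrite leeD2r.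
  by rewrite addeA -EFinD addeC -splitr.
move=> I l A ul mA tA.
rewrite -lee_fin -sumEFin; apply: le_trans hn; apply: le_trans (gap_le _).
apply: (@le_trans _ _ (\sum_(i <- l) (\int[mu]_(w in A i) (gap (s1 n) w)%:E))%E).
  by apply: lee_sum => i _; exact: key.
rewrite -ge0_integral_bigsetU//; last 2 first.
- exact: measurable_funS (mEgap _ (s1P n)).
- by move=> w _; rewrite lee_fin.
apply: ge0_subset_integral => //; first by apply: bigsetU_measurable => i _.
  exact: mEgap.
by move=> w _; rewrite lee_fin.
Qed.

End BochnerDensity.

(** * A vector measure without density on nested partitions *)

Lemma sum_nat_mul (V : nmodType) m n (F : nat -> V) :
  \sum_(0 <= j < m * n) F j = \sum_(0 <= i < m) \sum_(0 <= r < n) F (i * n + r)%N.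
Proof.
elim: m => [|m ih]; first by rewrite mul0n !big_geq.
rewrite big_nat_recr//= -ih mulSn addnC (big_cat_nat _ (n := (m * n)%N))//= ?leq_addr//.
congr (_ + _); rewrite -{1}[(m * n)%N]add0n big_addn addKn.
by apply: eq_bigr => r _; rewrite addnC.
Qed.

Section NestedPartitions.
Variables (R : realType) (k : scalar_kind) (X : completeNormedModType (scalars R k)).
Local Notation V := (realif X).
Variables (d : measure_display) (T : measurableType d).
Variable mu : {finite_measure set T -> \bar R}.
Local Notation lam A := (fine (mu A)).
Variables (M N : nat -> nat) (I : nat -> nat -> set T).

Definition atomic n (A : set T) : Prop := forall i, (i < M n)%N ->
  A `&` I n i = I n i \/ A `&` I n i = set0.

Hypothesis M_gt0 : forall n, (0 < M n)%N.
Hypothesis M_S : forall n, M n.+1 = (M n * N n)%N.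
Hypothesis mI : forall n i, measurable (I n i).
Hypothesis lamI : forall n i, (i < M n)%N -> lam (I n i) = (M n)%:R^-1.
Hypothesis I_split : forall n i r, (i < M n)%N -> (r < N n)%N ->
  I n.+1 (i * N n + r)%N `<=` I n i.
Hypothesis I_triv : forall n, trivIset setT (I n).
Hypothesis approx : forall A eps, measurable A -> 0 < eps -> exists n U,
  [/\ measurable U, atomic n U & lam (A `\` U) + lam (U `\` A) <= eps].

Variables (v : nat -> nat -> V) (tau delta : R).
Hypothesis tau0 : 0 < tau.
Hypothesis delta_tau : 16 * tau <= delta.
Hypothesis v1 : forall n i, `|v n i| <= 1.
Hypothesis v_avg : forall n i, (i < M n)%N ->
  `|(N n)%:R^-1 *: \sum_(0 <= r < N n) v n.+1 (i * N n + r)%N - v n i| <= tau * 2^-1 ^+ n.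
Hypothesis v_far : forall n i r, (i < M n)%N -> (r < N n)%N ->
  delta <= `|v n.+1 (i * N n + r)%N - v n i|.

Let N_gt0 n : (0 < N n)%N.
Proof. by have := M_gt0 n.+1; rewrite M_S muln_gt0 => /andP[]. Qed.

Let child_lt n i r : (i < M n)%N -> (r < N n)%N -> (i * N n + r < M n.+1)%N.
Proof.
move=> iM rN; rewrite M_S; apply: (@leq_trans (i.+1 * N n)%N); last by rewrite leq_mul2r iM orbT.
by rewrite mulSn addnC ltn_add2r.
Qed.

Let lamIS n i r : (i < M n)%N -> (r < N n)%N ->
  lam (I n.+1 (i * N n + r)%N) = lam (I n i) / (N n)%:R.
Proof. by move=> iM rN; rewrite !lamI ?child_lt// M_S natrM invfM. Qed.

Lemma atomic_cell n i : atomic n (I n i).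
Proof.
move=> j _; have [->|ij] := eqVneq i j; first by left; rewrite setIid.
by right; move/trivIsetP : (@I_triv n); apply.
Qed.

Lemma atomicS n A : atomic n A -> atomic n.+1 A.
Proof.
move=> An j; rewrite M_S => jM.
have jE : j = (j %/ N n * N n + j %% N n)%N by exact: divn_eq.
have iM : (j %/ N n < M n)%N by rewrite ltn_divLR.
have /I_split/(_ (ltn_pmod j (N_gt0 n))) := iM; rewrite -jE => sub.
have [h|h] := An _ iM; [left|right].
  by apply/setIidr/(subset_trans sub); rewrite -h; exact: subIsetl.
by apply/seteqP; split=> // t [At /sub It]; rewrite -h.
Qed.

Lemma atomic_le n n' A : (n <= n')%N -> atomic n A -> atomic n' A.
Proof. by move=> /subnK <- An; elim: (n' - n)%N => // j; exact: atomicS. Qed.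

(** This makes level measures of atomic sets change from one level to the next only
    through the averages of v over the children of a cell. *)
Lemma lam_atomicS n A i r : atomic n A -> (i < M n)%N -> (r < N n)%N ->
  lam (A `&` I n.+1 (i * N n + r)%N) = lam (A `&` I n i) / (N n)%:R.
Proof.
move=> An iM rN; have sub := I_split iM rN.
have [h|h] := An _ iM; rewrite h.
  rewrite -(lamIS iM rN); congr (fine (mu _)); apply/setIidr/(subset_trans sub).
  by rewrite -h; exact: subIsetl.
rewrite (_ : _ `&` _ = set0) ?lam0 ?mul0r//.
by apply/seteqP; split=> // t [At /sub It]; rewrite -h.
Qed.

Let lam_cells_le n A : measurable A -> \sum_(0 <= i < M n) lam (A `&` I n i) <= lam A.
Proof.
move=> mA; apply: lam_sum_le => //; first exact: iota_uniq.
exact: sub_trivIset (@I_triv n).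
Qed.

(** The integral over A of the step function with value v n i on I n i. *)
Definition level_measure n A : V := \sum_(0 <= i < M n) lam (A `&` I n i) *: v n i.

Let level_bound n A : measurable A -> `|level_measure n A| <= lam A.
Proof.
move=> mA; apply: le_trans (ler_norm_sum _ _ _) _; apply: le_trans (lam_cells_le n mA).
apply: ler_sum => i _; rewrite normrZ ger0_norm ?lam_ge0//.
by rewrite ler_piMr// lam_ge0.
Qed.

Let levelU n A B : measurable A -> measurable B -> A `&` B = set0 ->
  level_measure n (A `|` B) = level_measure n A + level_measure n B.
Proof.
move=> mA mB AB; rewrite /level_measure -big_split; apply: eq_bigr => i _ /=.
rewrite setIUl lamU ?scalerDl//; try exact: measurableI.
by rewrite setIACA AB set0I.
Qed.

Let levelS n A : measurable A -> atomic n A ->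
  `|level_measure n.+1 A - level_measure n A| <= tau * 2^-1 ^+ n * lam A.
Proof.
move=> mA An; rewrite /level_measure M_S sum_nat_mul -sumrB.
apply: le_trans (ler_norm_sum _ _ _) _.
have t0 : 0 <= tau * 2^-1 ^+ n by rewrite mulr_ge0 ?exprn_ge0// ltW.
apply: le_trans (ler_wpM2l t0 (lam_cells_le n mA)); rewrite mulr_sumr.
rewrite !big_nat; apply: ler_sum => i /andP[_ iM].
rewrite (_ : \sum_(0 <= r < N n) _ =
    lam (A `&` I n i) *: ((N n)%:R^-1 *: \sum_(0 <= r < N n) v n.+1 (i * N n + r)%N)); last first.
  rewrite scalerA scaler_sumr; apply: eq_big_nat => r /andP[_ rN].
  by rewrite lam_atomicS.
rewrite -scalerBr normrZ ger0_norm ?lam_ge0// mulrC ler_wpM2r ?lam_ge0//.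
exact: v_avg.
Qed.

Let level_tail n n' A : measurable A -> atomic n A -> (n <= n')%N ->
  `|level_measure n' A - level_measure n A| <= 2 * tau * (2^-1 ^+ n - 2^-1 ^+ n') * lam A.
Proof.
move=> mA An /subnK <-; elim: (n' - n)%N => [|j ih].
  by rewrite add0n !subrr normr0 mulr0 mul0r.
rewrite addSn -(subrKA (level_measure (j + n) A)).
apply: le_trans (ler_normD _ _) _.
have := levelS mA (atomic_le (leq_addl j n) An); rewrite exprS; lra.
Qed.

Let pow_small eps : 0 < eps -> exists n, forall n', (n <= n')%N ->
  2 * tau * 2^-1 ^+ n' * lam setT <= eps.
Proof.
move=> eps0; have [n hn] := halving_small (2 * tau * lam setT) eps0.
by exists n => n' /hn; rewrite mulrAC.
Qed.

Let level_tail' n n' A : measurable A -> atomic n A -> (n <= n')%N ->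
  `|level_measure n' A - level_measure n A| <= 2 * tau * 2^-1 ^+ n * lam A.
Proof.
move=> mA An nn'; apply: le_trans (level_tail mA An nn') _.
have t0 : 0 <= 2 * tau by rewrite mulr_ge0// ltW.
rewrite ler_wpM2r ?lam_ge0// ler_wpM2l//.
by rewrite gerBl exprn_ge0.
Qed.

Let level_dist n A B : measurable A -> measurable B ->
  `|level_measure n A - level_measure n B| <= lam (A `\` B) + lam (B `\` A).
Proof.
move=> mA mB.
have split_ A' B' : measurable A' -> measurable B' ->
    level_measure n A' = level_measure n (A' `&` B') + level_measure n (A' `\` B').
  move=> mA' mB'; rewrite -levelU; [by rewrite setUIDK|exact: measurableI|exact: measurableD|].
  by rewrite setDE setIACA setICr setI0.
rewrite (split_ A B)// (split_ B A)// [B `&` A]setIC.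
rewrite opprD addrACA subrr add0r.
apply: le_trans (ler_normB _ _) _.
by apply: lerD; apply: level_bound; exact: measurableD.
Qed.

(** On atomic sets the increments are at most tau 2^-n times the mass, hence
    summable; other sets are approximated by atomic ones, and the level measures
    are Lipschitz for the measure of the symmetric difference, uniformly in n. *)
Let level_cvg A : measurable A -> exists l : V, level_measure ^~ A @ \oo --> l.
Proof.
move=> mA; apply: cauchy_seq_cvg => eps eps0.
have e4 : 0 < eps / 4 by rewrite divr_gt0.
have [n [U [mU Un AU]]] := approx mA e4.
have [n' hn'] := pow_small e4.
exists (maxn n n') => j hj.
have h1 := level_dist j mA mU; have h2 := level_dist (maxn n n') mA mU.
have h3 := level_tail' mU (atomic_le (leq_maxl n n') Un) hj.
have h4 := hn' _ (leq_maxr n n').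
have h5 : 2 * tau * 2^-1 ^+ maxn n n' * lam U <= 2 * tau * 2^-1 ^+ maxn n n' * lam setT.
  by rewrite ler_wpM2l ?mulr_ge0 ?exprn_ge0 ?(ltW tau0)// lam_le.
rewrite -(subrKA (level_measure j U)) -(subrKA (level_measure (maxn n n') U) (level_measure j U)).
apply: le_trans (ler_normD _ _) _; apply: le_trans (lerD (lexx _) (ler_normD _ _)) _.
by rewrite [X in _ + (_ + X)]distrC; lra.
Qed.

Definition limit_measure (A : set T) : X := lim (level_measure ^~ A @ \oo).

Let limP A : measurable A -> level_measure ^~ A @ \oo --> (limit_measure A : V).
Proof. by move=> /level_cvg[l hl]; rewrite /limit_measure (cvg_lim _ hl). Qed.

Let norm_lim_le (s : nat -> V) (l : V) B : s @ \oo --> l -> (exists n, forall n', (n <= n')%N -> `|s n'| <= B) ->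
  `|l| <= B.
Proof.
move=> sl [n hn]; apply/ler_addgt0Pl => eps eps0.
have /cvgrPdist_le/(_ _ eps0)[n' _ hn'] := sl.
rewrite -(subrK (s (maxn n n')) l); apply: le_trans (ler_normD _ _) _.
by apply: lerD; [apply: hn'; exact: leq_maxr|apply: hn; exact: leq_maxl].
Qed.

Lemma limit_measure_bound A : measurable A -> `|limit_measure A : V| <= lam A.
Proof.
move=> mA; apply: norm_lim_le (limP mA) _; exists 0%N => n _; exact: level_bound.
Qed.

Lemma limit_measureU A B : measurable A -> measurable B -> A `&` B = set0 ->
  limit_measure (A `|` B) = limit_measure A + limit_measure B.
Proof.
move=> mA mB AB; have mAB : measurable (A `|` B) by exact: measurableU.
apply: (@cvg_unique V _ (level_measure ^~ (A `|` B) @ \oo)).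
- exact: norm_hausdorff.
- exact: limP.
- rewrite (_ : (fun n => level_measure n (A `|` B)) =
    (fun n => level_measure n A + level_measure n B)); last first.
    by apply/funext => n; exact: levelU.
  by apply: cvgD; exact: limP.
Qed.

Lemma limit_measure_atomic n A : measurable A -> atomic n A ->
  `|(limit_measure A : V) - level_measure n A| <= 2 * tau * 2^-1 ^+ n * lam A.
Proof.
move=> mA An.
have h : (fun j => level_measure j A - level_measure n A) @ \oo -->
    (limit_measure A : V) - level_measure n A.
  by apply: cvgB; [exact: limP|exact: cvg_cst].
apply: norm_lim_le h _; exists n => n' nn'; exact: level_tail'.
Qed.

Lemma limit_vector_measure : vector_measure limit_measure.
Proof.
move=> F mF tF; apply/cvg_realif/cvgrPdist_le => eps eps0.
pose B n := \big[setU/set0]_(0 <= i < n) F i.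
have mB n : measurable (B n) by apply: bigsetU_measurable.
have mU : measurable (\bigcup_n F n) by exact: bigcupT_measurable.
have BU n : B n `<=` \bigcup_n F n.
  by rewrite /B -bigcup_seq => t [i _ Fi]; exists i.
have lamB n : lam (B n) = \sum_(0 <= i < n) lam (F i).
  by apply: lam_bigsetU => //; [exact: iota_uniq|exact: sub_trivIset tF].
have mB_sum n : limit_measure (B n) = series (limit_measure \o F) n.
  elim: n => [|n ih].
    rewrite /B /series/= !big_geq//; apply/eqP; rewrite -(normr_le0 (limit_measure set0 : V)).
    by apply: le_trans (limit_measure_bound _) _; rewrite // lam0.
  rewrite /series/= big_nat_recr//= -[X in _ = X + _]ih /B big_nat_recr//=.
  apply: limit_measureU => //; first exact: mB.
  rewrite -bigcup_seq setI_bigcupl bigcup0// => i /=; rewrite mem_index_iota => /andP[_ iN].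
  by move/trivIsetP : tF; apply=> //; rewrite ltn_eqF.
have : (fun n => \sum_(0 <= i < n) lam (F i)) @ \oo --> lam (\bigcup_n F n).
  have h : (fun n => \sum_(0 <= i < n) mu (F i))%E @ \oo --> (lam (\bigcup_n F n))%:E.
    by rewrite fineK ?fin_mu//; exact: measure_semi_sigma_additive.
  apply: cvg_trans (fine_cvg h).
  apply: near_eq_cvg; apply: nearW => n /=.
  by rewrite sum_fine// => i _; exact: fin_mu.
move=> /cvgrPdist_le/(_ _ eps0)[n0 _ hn0]; exists n0 => // n /hn0 /= h.
rewrite -[series _ n]mB_sum.
have -> : (limit_measure (\bigcup_n F n) : V) - limit_measure (B n) =
    limit_measure (\bigcup_n F n `\` B n).
  have := limit_measureU (mB n) (measurableD mU (mB n)).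
  rewrite setDIK setDUK// => /(_ erefl) ->.
  by rewrite addrC addKr.
apply: le_trans (limit_measure_bound (measurableD mU (mB n))) _.
have := lam_split mu mU (mB n); rewrite (setIidr (BU n)) lamB => e.
by move: h; rewrite e addrAC subrr add0r ger0_norm// lam_ge0.
Qed.

Lemma limit_abs_continuous : vector_abs_continuous mu limit_measure.
Proof.
move=> A mA A0; apply/eqP; rewrite -(normr_le0 (limit_measure A : V)).
by apply: le_trans (limit_measure_bound mA) _; rewrite A0.
Qed.

Lemma limit_variation : (vector_variation limit_measure < +oo)%E.
Proof.
apply: (@le_lt_trans _ _ (lam setT)%:E); last exact: ltry.
apply: ge_ereal_sup => _ [n [F [[mF tF _] ->]]]; rewrite lee_fin.
apply: (@le_trans _ _ (\sum_(i < n) lam (setT `&` F i))).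
  by apply: ler_sum => i _; rewrite setTI; exact: limit_measure_bound.
apply: lam_sum_le => //; first exact: index_enum_uniq.
exact: sub_trivIset tF.
Qed.

Let lam_diff E U B : measurable E -> measurable U -> measurable B ->
  `|lam (B `&` E) - lam (B `&` U)| <= lam ((E `\` U) `&` B) + lam ((U `\` E) `&` B).
Proof.
move=> mE mU mB.
rewrite (lam_split mu (measurableI _ _ mB mE) mU) (lam_split mu (measurableI _ _ mB mU) mE).
have -> : B `&` E `&` U = B `&` U `&` E by rewrite setIAC.
rewrite [_ `&` B]setIC [X in _ <= _ + fine (mu X)]setIC !setIDA.
have := lam_ge0 mu ((B `&` E) `\` U); have := lam_ge0 mu ((B `&` U) `\` E).
by rewrite ler_norml; lra.
Qed.

Section contradiction.
Variable s0 : T -> X.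
Hypothesis ss0 : simple_function s0.
Hypothesis s0P : forall (J : choiceType) (l : seq J) (A : J -> set T), uniq l ->
  (forall i, measurable (A i)) -> trivIset [set` l] A ->
  \sum_(i <- l) `|(limit_measure (A i) - simple_integral mu (A i) s0 : X) : V| <= tau.

(** The average of s0 over the cell I n i, which has measure 1 / M n. *)
Let q n i : V := (M n)%:R *: (simple_integral mu (I n i) s0 : V).

Let Mpos n : 0 < (M n)%:R :> R. Proof. by rewrite ltr0n. Qed.

Let cells_sum n (c : R) : \sum_(0 <= i < M n) (M n)%:R^-1 * c = c.
Proof.
rewrite -mulr_suml big_const_nat subn0 iter_addr_0 -[X in X * c]mulr_natl.
by rewrite divff ?mul1r// gt_eqF.
Qed.

(** The measure of a cell is v n i / M n up to 2 tau / M n, and its distance to the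
    integral of s0 adds up to tau over all cells. *)
Let density_dist n : \sum_(0 <= i < M n) (M n)%:R^-1 * `|v n i - q n i| <= 3 * tau.
Proof.
have levelE i : (i < M n)%N -> level_measure n (I n i) = (M n)%:R^-1 *: v n i.
  move=> iM; rewrite /level_measure (bigD1_seq i) ?mem_index_iota ?iota_uniq//=.
  rewrite setIid lamI// big1 ?addr0// => j ji.
  rewrite (_ : _ `&` _ = set0) ?lam0 ?scale0r//.
  by move/trivIsetP : (@I_triv n); apply=> //; rewrite eq_sym.
apply: (@le_trans _ _ (\sum_(0 <= i < M n) ((M n)%:R^-1 * (2 * tau) +
    `|(limit_measure (I n i) - simple_integral mu (I n i) s0 : X) : V|))).
  rewrite !big_nat; apply: ler_sum => i /andP[_ iM].
  have -> : (M n)%:R^-1 * `|v n i - q n i| =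
      `|level_measure n (I n i) - (simple_integral mu (I n i) s0 : V)|.
    rewrite levelE// -[X in X * _](@ger0_norm _ (M n)%:R^-1) ?invr_ge0//.
    by rewrite -normrZ scalerBr /q scalerA mulVf ?scale1r// gt_eqF.
  rewrite -(subrKA (limit_measure (I n i) : V)); apply: le_trans (ler_normD _ _) _.
  apply: lerD => //; rewrite distrC.
  apply: le_trans (limit_measure_atomic (mI n i) (@atomic_cell n i)) _.
  rewrite lamI// mulrC ler_pM2l ?invr_gt0// -[leRHS]mulr1 ler_wpM2l ?mulr_ge0 ?(ltW tau0)//.
  by rewrite exprn_ile1 ?invr_ge0// invf_le1// ler1n.
rewrite big_split/= cells_sum.
have := s0P (iota_uniq 0 (M n - 0)) (mI n) (sub_trivIset _ (@I_triv n)).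
rewrite -/(index_iota 0 (M n)) => /(_ (fun _ _ => Logic.I)); lra.
Qed.

Let q_E n i : q n i = \sum_(x <- values s0)
  ((M n)%:R * lam (I n i `&` s0 @^-1` [set x])) *: (x : V).
Proof.
by rewrite /q simple_integralE// scaler_sumr; apply: eq_bigr => x _; rewrite scalerA.
Qed.

(** Replacing the level sets of s0 by sets U x that are atomic at some level n makes
    the average over a cell of level n the same as the averages over its children.
    So q n.+1 and q n are within 2 tau in mean, and both are within 3 tau of v in
    mean: the values of v at a cell and at its children differ in mean by at most
    8 tau, which is less than delta. *)
Lemma no_simple_density : False.
Proof.
pose w := \sum_(x <- values s0) `|x : V|.
have w0 : 0 <= w by apply: sumr_ge0.
have w1 : 0 < w + 1 by rewrite ltr_wpDl.
(* + 1 because w is 0 when s0 is *)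
pose eta := tau / (w + 1).
have eta0 : 0 < eta by rewrite divr_gt0.
pose E x := s0 @^-1` [set x].
have mE x : measurable (E x) by exact: ss0.2.
have /choice[nU nUP] : forall x : X, exists nU : nat * set T, [/\ measurable nU.2,
    atomic nU.1 nU.2 & lam (E x `\` nU.2) + lam (nU.2 `\` E x) <= eta].
  by move=> x; have [n [U h]] := approx (mE x) eta0; exists (n, U).
pose U x := (nU x).2.
have mU x : measurable (U x) by have [] := nUP x.
pose n := \max_(x <- values s0) (nU x).1.
have Un x : x \in values s0 -> atomic n (U x).
  move=> xs; have [_ + _] := nUP x; apply: atomic_le.
  by rewrite /n (big_rem x)//= leq_maxl.
pose D x (B : set T) := lam ((E x `\` U x) `&` B) + lam ((U x `\` E x) `&` B).
have D0 x B : 0 <= D x B by rewrite addr_ge0 ?lam_ge0.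
have sumD x n' : \sum_(0 <= i < M n') D x (I n' i) <= eta.
  rewrite big_split/=; have [_ _] := nUP x; apply: le_trans.
  by apply: lerD; apply: lam_cells_le; exact: measurableD.
have q_dist i r : (i < M n)%N -> (r < N n)%N ->
    (M n.+1)%:R^-1 * `|q n.+1 (i * N n + r)%N - q n i| <=
    \sum_(x <- values s0) `|x : V| * (D x (I n.+1 (i * N n + r)%N) + (N n)%:R^-1 * D x (I n i)).
  move=> iM rN; have N0 : 0 < (N n)%:R :> R by rewrite ltr0n.
  rewrite ler_pdivrMl// mulr_sumr !q_E -sumrB.
  apply: le_trans (ler_norm_sum _ _ _) _; rewrite !big_seq; apply: ler_sum => x xs.
  rewrite -scalerBl normrZ mulrCA mulrC ler_wpM2l//.
  set B' := I n.+1 _; set B := I n i.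
  have eU : (M n.+1)%:R * lam (B' `&` U x) = (M n)%:R * lam (B `&` U x).
    rewrite [B' `&` _]setIC [B `&` _]setIC (lam_atomicS (Un x xs) iM rN) M_S natrM.
    by field; rewrite gt_eqF.
  have h1 := lam_diff (mE x) (mU x) (mI n.+1 (i * N n + r)).
  have h2 := lam_diff (mE x) (mU x) (mI n i).
  have -> : (M n.+1)%:R * lam (B' `&` E x) - (M n)%:R * lam (B `&` E x) =
     (M n.+1)%:R * (lam (B' `&` E x) - lam (B' `&` U x)) -
     (M n)%:R * (lam (B `&` E x) - lam (B `&` U x)).
    by rewrite !mulrBr eU; ring.
  apply: le_trans (ler_normB _ _) _; rewrite !normrM !(ger0_norm (ler0n _ _)).
  have -> : (M n.+1)%:R * (D x B' + (N n)%:R^-1 * D x B) =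
      (M n.+1)%:R * D x B' + (M n)%:R * D x B.
    by rewrite M_S natrM; field; rewrite gt_eqF.
  by apply: lerD; rewrite ler_pM2l ?Mpos.
have Q : \sum_(0 <= i < M n) \sum_(0 <= r < N n)
    (M n.+1)%:R^-1 * `|q n.+1 (i * N n + r)%N - q n i| <= 2 * tau.
  apply: (@le_trans _ _ (\sum_(0 <= i < M n) \sum_(0 <= r < N n)
    \sum_(x <- values s0) `|x : V| *
      (D x (I n.+1 (i * N n + r)%N) + (N n)%:R^-1 * D x (I n i)))).
    rewrite [leLHS]big_nat [leRHS]big_nat; apply: ler_sum => i /andP[_ iM].
    rewrite [leLHS]big_nat [leRHS]big_nat; apply: ler_sum => r /andP[_ rN].
    exact: q_dist.
  under eq_bigr do rewrite exchange_big/=.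
  rewrite exchange_big/=.
  apply: (@le_trans _ _ (\sum_(x <- values s0) `|x : V| * (2 * eta))).
    apply: ler_sum => x _.
    under eq_bigr do rewrite -mulr_sumr.
    rewrite -mulr_sumr ler_wpM2l//.
    under eq_bigr do rewrite big_split/=.
    rewrite big_split/= -(sum_nat_mul _ _ (fun j => D x (I n.+1 j))) -M_S.
    have -> : \sum_(0 <= i < M n) \sum_(0 <= r < N n) (N n)%:R^-1 * D x (I n i) =
        \sum_(0 <= i < M n) D x (I n i).
      apply: eq_bigr => i _; rewrite -mulr_suml big_const_nat subn0 iter_addr_0.
      by rewrite -[X in X * _]mulr_natl divff ?mul1r// gt_eqF// ltr0n.
    by have := sumD x n; have := sumD x n.+1; lra.
  rewrite -mulr_suml -/w /eta.
  have -> : w * (2 * (tau / (w + 1))) = 2 * tau * (w / (w + 1)) by ring.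
  rewrite -[leRHS]mulr1 ler_wpM2l ?mulr_ge0 ?(ltW tau0)//.
  by rewrite ler_pdivrMr// mul1r lerDl.
have : delta <= 3 * tau + 2 * tau + 3 * tau.
  have h1 := density_dist n.+1; have h3 := density_dist n.
  rewrite M_S sum_nat_mul -M_S in h1.
  have h3' : \sum_(0 <= i < M n) \sum_(0 <= r < N n) (M n.+1)%:R^-1 * `|v n i - q n i| <= 3 * tau.
    apply: le_trans h3; rewrite le_eqVlt; apply/orP; left; apply/eqP.
    apply: eq_bigr => i _; rewrite -mulr_suml big_const_nat subn0 iter_addr_0.
    rewrite -[X in X * _]mulr_natl M_S natrM invfM mulrA [(N n)%:R * _]mulrC mulfK//.
    by rewrite gt_eqF// ltr0n.
  apply: le_trans (lerD (lerD h1 Q) h3').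
  rewrite -!big_split/= -{1}(cells_sum n delta).
  rewrite [leLHS]big_nat [leRHS]big_nat; apply: ler_sum => i /andP[_ iM].
  have -> : (M n)%:R^-1 * delta = \sum_(0 <= r < N n) (M n.+1)%:R^-1 * delta.
    rewrite -mulr_suml big_const_nat subn0 iter_addr_0 -[X in _ = X * _]mulr_natl.
    rewrite M_S natrM invfM mulrA [(N n)%:R * _]mulrC mulfK//.
    by rewrite gt_eqF// ltr0n.
  rewrite -!big_split/= [leLHS]big_nat [leRHS]big_nat; apply: ler_sum => r /andP[_ rN].
  rewrite -!mulrDr ler_pM2l ?invr_gt0//.
  apply: le_trans (v_far iM rN) _.
  set v' := v n.+1 _; set q' := q n.+1 _.
  rewrite [`|v n i - q n i|]distrC.
  have -> : v' - v n i = (v' - q') + (q' - q n i) + (q n i - v n i) by rewrite !subrKA.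
  by apply: le_trans (ler_normD _ _) _; rewrite lerD2r ler_normD.
have := delta_tau; have := tau0; lra.
Qed.

End contradiction.

Theorem nested_partitions_not_RNP : ~ radon_nikodym_property X.
Proof.
move=> rnp.
have [f fint fdens] := rnp d T mu limit_measure limit_vector_measure
  limit_abs_continuous limit_variation.
have [s0 ss0 s0P] := bochner_simple_approximation fint fdens tau0.
exact: no_simple_density ss0 s0P.
Qed.

End NestedPartitions.

(** * Measurable sets approximated by unions of cells *)

Section Approximation.
Variables (R : realType) (d : measure_display) (T : measurableType d).
Variable mu : {finite_measure set T -> \bar R}.
Local Notation lam A := (fine (mu A)).
Variables (M : nat -> nat) (I : nat -> nat -> set T).
Local Notation atomic := (atomic M I).
Hypothesis atomic_le : forall n n' A, (n <= n')%N -> atomic n A -> atomic n' A.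

Definition approximable (A : set T) : Prop := measurable A /\
  forall eps, 0 < eps -> exists n U,
    [/\ measurable U, atomic n U & lam (A `\` U) + lam (U `\` A) <= eps].

Let atomic0 n : atomic n set0.
Proof. by move=> i _; right; rewrite set0I. Qed.

Let atomicC n A : atomic n A -> atomic n (~` A).
Proof.
move=> An i iM; have [h|h] := An i iM; [right|left].
  by rewrite -h setIA setICl set0I.
by apply/setIidr => t It At; have : (A `&` I n i) t by []; rewrite h.
Qed.

Let atomicU n A B : atomic n A -> atomic n B -> atomic n (A `|` B).
Proof.
move=> An Bn i iM; have [hA|hA] := An i iM; rewrite setIUl hA.
  by left; rewrite setUidl//; exact: subIsetr.
by rewrite set0U; exact: Bn.
Qed.

Lemma approximableU A B : approximable A -> approximable B -> approximable (A `|` B).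
Proof.
move=> [mA hA] [mB hB]; split; first exact: measurableU.
move=> eps eps0; have e2 : 0 < eps / 2 by rewrite divr_gt0.
have [n [U [mU Un hU]]] := hA _ e2; have [n' [U' [mU' Un' hU']]] := hB _ e2.
exists (maxn n n'), (U `|` U'); split; first exact: measurableU.
  apply: atomicU; first exact: atomic_le (leq_maxl n n') Un.
  exact: atomic_le (leq_maxr n n') Un'.
have h1 : lam ((A `|` B) `\` (U `|` U')) <= lam (A `\` U) + lam (B `\` U').
  apply: lam_subadditive; try by apply: measurableD => //; exact: measurableU.
  by move=> t [[At|Bt] /not_orP[nU nU']]; [left|right].
have h2 : lam ((U `|` U') `\` (A `|` B)) <= lam (U `\` A) + lam (U' `\` B).
  apply: lam_subadditive; try by apply: measurableD => //; exact: measurableU.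
  by move=> t [[At|Bt] /not_orP[nU nU']]; [left|right].
lra.
Qed.

Lemma approximable_sigma_algebra : sigma_algebra setT approximable.
Proof.
split.
- split=> // eps eps0; exists 0%N, set0; split=> //.
  by rewrite !setD0 lam0 addr0 ltW.
- move=> A [mA hA]; rewrite setTD; split; first exact: measurableC.
  move=> eps /hA[n [U [mU Un h]]]; exists n, (~` U); split; first exact: measurableC.
    exact: atomicC.
  by rewrite !setDE !setCK setIC [X in _ + fine (mu X)]setIC -!setDE addrC.
- move=> F hF.
  pose B n := \big[setU/set0]_(0 <= i < n) F i.
  have hB n : approximable (B n).
    elim: n => [|n ih]; last by rewrite /B big_nat_recr//=; exact: approximableU.
    rewrite /B big_geq//; split=> // eps eps0; exists 0%N, set0; split=> //.
    by rewrite !setD0 lam0 addr0 ltW.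
  have mB n : measurable (B n) by have [] := hB n.
  have mU : measurable (\bigcup_n F n).
    by apply: bigcupT_measurable => n; have [] := hF n.
  have BU n : B n `<=` \bigcup_n F n.
    by rewrite /B -bigcup_seq => t [i _ Fi]; exists i.
  split=> // eps eps0; have e2 : 0 < eps / 2 by rewrite divr_gt0.
  have [n hn] : exists n, lam (\bigcup_n F n `\` B n) <= eps / 2.
    have h : (mu \o B) @ \oo --> (lam (\bigcup_n F n))%:E.
      rewrite fineK ?fin_mu// (_ : \bigcup_n F n = \bigcup_n B n).
        apply: nondecreasing_cvg_mu => //; first exact: bigcupT_measurable.
        move=> n m nm; apply/subsetPset; rewrite /B -!bigcup_seq => t [i + Fi].
        rewrite /= !mem_index_iota => /andP[_ iN]; exists i => //=.
        by rewrite mem_index_iota (leq_trans iN).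
      apply/seteqP; split=> t [i _ ti].
        by exists i.+1 => //; rewrite /B big_nat_recr//=; right.
      exact: BU ti.
    have h' : (fine \o (mu \o B)) @ \oo --> lam (\bigcup_n F n) by exact: fine_cvg.
    have /cvgrPdist_le/(_ _ e2)[n _ /(_ _ (leqnn n)) /= hn] := h'.
    exists n; move: hn; rewrite (lam_split mu mU (mB n)) (setIidr (BU n)).
    by rewrite addrAC subrr add0r ger0_norm// lam_ge0.
  have [n' [U [mU' Un hU]]] := (hB n).2 _ e2.
  exists n', U; split=> //.
  have mUn' := mU'; have h1 : lam (\bigcup_n F n `\` U) <=
      lam (\bigcup_n F n `\` B n) + lam (B n `\` U).
    apply: lam_subadditive; try exact: measurableD.
    by move=> t [Ft nUt]; have [Bt|nBt] := pselect (B n t); [right|left].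
  have h2 : lam (U `\` \bigcup_n F n) <= lam (U `\` B n).
    apply: lam_le; try exact: measurableD.
    by move=> t [Ut nF]; split=> // /BU.
  lra.
Qed.

End Approximation.

(** * Equal partitions of the unit interval *)

Section UnitInterval.
Variable R : realType.
Local Notation line := (measurableTypeR R).

Lemma unit_interval_finite :
  (@lebesgue_measure R (`[0%R, 1%R[%classic : set R) < +oo)%E.
Proof. by rewrite lebesgue_measure_itv/= lte01 oppr0 adde0 ltry. Qed.

(** A measure on the whole line, for which the cells with index at least M n, all
    outside the unit interval, are null sets. *)
Definition unit_lebesgue : {finite_measure set line -> \bar R} :=
  @mfrestr _ line _ _ (@lebesgue_measure R : {measure set line -> \bar R})
    (measurable_itv `[0%R, 1%R[) unit_interval_finite.

Variables M N : nat -> nat.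
Hypothesis M_gt0 : forall n, (0 < M n)%N.
Hypothesis M_S : forall n, M n.+1 = (M n * N n)%N.
Hypothesis N_gt1 : forall n, (1 < N n)%N.

Definition cell n i : set line := `[i%:R / (M n)%:R, i.+1%:R / (M n)%:R[%classic.

Let Mpos n : 0 < (M n)%:R :> R. Proof. by rewrite ltr0n. Qed.

Lemma in_cell n i x : cell n i x <-> i%:R <= x * (M n)%:R < i.+1%:R.
Proof. by rewrite /cell /= in_itv/= ler_pdivrMr// ltr_pdivlMr. Qed.

Lemma cell_measurable n i : measurable (cell n i).
Proof. exact: measurable_itv. Qed.

Lemma unit_lebesgue_cell n i : (i < M n)%N ->
  fine (unit_lebesgue (cell n i)) = (M n)%:R^-1.
Proof.
move=> iM; rewrite /unit_lebesgue /= /mfrestr /mrestr (setIidl _); last first.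
  move=> x /in_cell /andP[x0 x1]; rewrite /= in_itv/=; apply/andP; split.
    by rewrite -(pmulr_lge0 _ (Mpos n)); apply: le_trans x0.
  rewrite -(ltr_pM2r (Mpos n)) mul1r; apply: lt_le_trans x1 _.
  by rewrite ler_nat.
rewrite lebesgue_measure_itv/= lte_fin ltr_pM2r ?invr_gt0// ltr_nat ltnSn.
by rewrite -EFinD/= -mulrBl -natr1 addrAC subrr add0r mul1r.
Qed.

Lemma unit_lebesgue_cell_le n i : fine (unit_lebesgue (cell n i)) <= (M n)%:R^-1.
Proof.
have [iM|iM] := ltnP i (M n); first by rewrite unit_lebesgue_cell.
rewrite (_ : unit_lebesgue _ = 0%E) ?invr_ge0//.
rewrite /unit_lebesgue /= /mfrestr /mrestr (_ : _ `&` _ = set0) ?measure0//.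
apply/seteqP; split=> // x [/in_cell /andP[x0 _]] /=; rewrite in_itv/= => /andP[_ x1].
have : (M n)%:R <= x * (M n)%:R by apply: le_trans x0; rewrite ler_nat.
by rewrite -[leLHS]mul1r ler_pM2r// leNgt x1.
Qed.

Lemma cell_split n i r : (i < M n)%N -> (r < N n)%N ->
  cell n.+1 (i * N n + r) `<=` cell n i.
Proof.
move=> iM rN x /in_cell /andP[]; rewrite M_S natrM mulrA => x0 x1; apply/in_cell.
have Npos : 0 < (N n)%:R :> R by rewrite ltr0n ltnW.
apply/andP; split.
  rewrite -(ler_pM2r Npos); apply: le_trans x0.
  by rewrite -natrM ler_nat leq_addr.
rewrite -(ltr_pM2r Npos); apply: lt_le_trans x1 _.
by rewrite -natrM ler_nat mulSn addnC ltn_add2r.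
Qed.

Lemma cell_trivIset n : trivIset setT (cell n).
Proof.
move=> i j _ _ [x [/in_cell /andP[i0 i1] /in_cell /andP[j0 j1]]].
have := le_lt_trans i0 j1; have := le_lt_trans j0 i1.
by rewrite !ltr_nat !ltnS => h1 h2; apply/eqP; rewrite eqn_leq h1 h2.
Qed.

Lemma mesh_small eps : 0 < eps -> exists n, (M n)%:R^-1 <= eps :> R.
Proof.
move=> eps0; have M_exp n : (2 ^ n <= M n)%N.
  elim: n => [|n ih]; first exact: M_gt0.
  by rewrite M_S expnSr leq_mul.
have [n hn] := halving_small 1 eps0; exists n; have := hn n (leqnn n).
rewrite mul1r exprVn; apply: le_trans; rewrite lef_pV2 ?posrE ?exprn_gt0//.
by rewrite -natrX ler_nat.
Qed.

(** Borel sets are generated by the closed rays to the right of a point x, and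
    rounding x to the left end of its cell costs at most the mesh. *)
Lemma unit_lebesgue_approx (A : set line) : measurable A ->
  approximable unit_lebesgue M cell A.
Proof.
have N0 n : (0 < N n)%N by apply: ltnW.
have at_le n n' B : (n <= n')%N -> atomic M cell n B -> atomic M cell n' B.
  exact: (atomic_le M_gt0 M_S (@cell_split)).
rewrite RGenCInfty.measurableE; move: A; apply: smallest_sub.
  exact: approximable_sigma_algebra.
move=> _ [x ->]; split; first exact: measurable_itv.
move=> eps eps0; have [n hn] := mesh_small eps0.
have [x0|x0] := lerP 0 x; last first.
  exists 0%N, `[x, +oo[%classic; split; first exact: measurable_itv.
    move=> i _; left; apply/setIidr => y /in_cell /andP[y0 _].
    rewrite /= in_itv/= andbT; apply: ltW; apply: lt_le_trans x0 _.
    by rewrite -(pmulr_lge0 _ (Mpos 0%N)); apply: le_trans y0.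
  by rewrite !setDv lam0 addr0 ltW.
pose c := Num.truncn (x * (M n)%:R).
have /andP[c0 c1] : c%:R <= x * (M n)%:R < c.+1%:R.
  by apply: truncn_itv; rewrite mulr_ge0.
pose U : set line := `[c%:R / (M n)%:R, +oo[%classic.
have inU y : U y <-> c%:R <= y * (M n)%:R.
  by rewrite /U /= in_itv/= andbT ler_pdivrMr.
have AU : `[x, +oo[%classic `<=` U.
  move=> y /=; rewrite in_itv/= andbT => xy; apply/inU.
  by apply: le_trans c0 _; rewrite ler_pM2r.
exists n, U; split; first exact: measurable_itv.
  move=> i _; have [ci|ic] := leqP c i; [left|right].
    apply/setIidr => y /in_cell /andP[y0 _]; apply/inU.
    by apply: le_trans y0; rewrite ler_nat.
  apply/seteqP; split=> // y [/inU y0 /in_cell /andP[_ y1]].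
  by have := le_lt_trans y0 y1; rewrite ltr_nat ltnS leqNgt ic.
rewrite (_ : _ `\` U = set0); last by rewrite setD_eq0.
rewrite lam0 add0r; apply: le_trans hn.
apply: le_trans (unit_lebesgue_cell_le n c).
apply: lam_le; [by apply: measurableD; exact: measurable_itv|exact: cell_measurable|].
move=> y [/inU y0 nxy]; apply/in_cell; rewrite y0/=.
apply: lt_trans c1; rewrite ltr_pM2r// ltNge; apply/negP => xy.
by apply: nxy; rewrite /= in_itv/= xy.
Qed.

End UnitInterval.

(** * Bushes in the unit ball *)

Section Bush.
Variables (R : realType) (V : normedModType R) (delta : R).
Hypothesis slices : large_slices V delta.

(** Otherwise some u of norm at most 1 satisfies u >= u c + eps on all points of the
    ball far from c; but the slice - u > - u c - eps contains c, hence a point far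
    from c. *)
Lemma average_of_far_points (c : V) eps : `|c| <= 1 -> 0 < eps ->
  exists2 l : seq V, l != [::] &
    (forall y, y \in l -> `|y| <= 1 /\ delta <= `|y - c|) /\ `|average l - c| < eps.
Proof.
move=> c1 eps0; apply: contrapT => h.
pose C : set V := [set y | `|y| <= 1 /\ delta <= `|y - c|].
have [||u [lu u1] uC] := @separation R V C c eps.
- exact: ltW.
- move=> l l0 lC; rewrite leNgt; apply/negP => lc; apply: h; exists l => //.
have bu : bounded_form (fun y => - u y).
  split; first by move=> r x y; rewrite lu; ring.
  by exists 1 => y; rewrite mul1r -(linear_formN lu) -normrN.
have [|w [w1 uw] wc] := slices (a := - u c - eps) bu _ c1.
  by exists c; split=> //; lra.
by have := uC w (conj w1 wc); lra.
Qed.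

Lemma sum_nat_modn (W : nmodType) q s (F : nat -> W) : (0 < s)%N ->
  \sum_(0 <= r < q * s) F (r %% s)%N = (\sum_(0 <= r < s) F r) *+ q.
Proof.
move=> s0; rewrite sum_nat_mul -[RHS]iter_addr_0 -[q in RHS]subn0 -big_const_nat.
apply: eq_bigr => i _; apply: eq_big_nat => r /andP[_ rs].
by rewrite modnMDl modn_small.
Qed.

(** All cells must have the same number N of children, although the averages come
    from lists of different lengths: N is a common multiple of the lengths, and each
    list is repeated. *)
Lemma refine_level (M : nat) (v : nat -> V) eps : (forall i, `|v i| <= 1) -> 0 < eps ->
  exists Nv : nat * (nat -> V), [/\ (1 < Nv.1)%N, forall j, `|Nv.2 j| <= 1,
   forall i, (i < M)%N ->
    `|Nv.1%:R^-1 *: \sum_(0 <= r < Nv.1) Nv.2 (i * Nv.1 + r)%N - v i| <= eps &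
   forall i r, (i < M)%N -> (r < Nv.1)%N -> delta <= `|Nv.2 (i * Nv.1 + r)%N - v i|].
Proof.
move=> v1 eps0.
have /choice[l lP] : forall i, exists l : seq V, l != [::] /\
    ((forall y, y \in l -> `|y| <= 1 /\ delta <= `|y - v i|) /\ `|average l - v i| < eps).
  by move=> i; have [l] := average_of_far_points (v1 i) eps0; exists l.
have sz i : (0 < size (l i))%N by have [] := lP i; case: (l i).
(* the factor 2 makes N > 1, so that the mesh tends to 0 *)
pose N := (2 * \prod_(i < M) size (l i))%N.
have N1 : (1 < N)%N by apply: (@leq_trans (2 * 1)%N) => //; rewrite leq_pmul2l// prodn_gt0.
have sN i : (i < M)%N -> (size (l i) %| N)%N.
  by move=> iM; apply: dvdn_mull; rewrite (bigD1 (Ordinal iM))//= dvdn_mulr.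
pose v' j := nth 0 (l (j %/ N)%N) ((j %% N) %% size (l (j %/ N)))%N.
have v'_in j : v' j \in l (j %/ N)%N by apply: mem_nth; rewrite ltn_pmod.
have v'E i r : (r < N)%N -> v' (i * N + r)%N = nth 0 (l i) (r %% size (l i))%N.
  move=> rN; rewrite /v' divnMDl ?(ltnW N1)// divn_small// addn0.
  by rewrite modnMDl (modn_small rN).
exists (N, v'); split=> //=.
- by move=> j; have [_ [h _]] := lP (j %/ N)%N; have [] := h _ (v'_in j).
- move=> i iM; have [_ [_ h]] := lP i; apply/ltW; apply: le_lt_trans h.
  rewrite (_ : _ *: _ = average (l i))//.
  have /dvdnP[q Nq] := sN i iM.
  rewrite (eq_big_nat _ _ (F2 := fun r => nth 0 (l i) (r %% size (l i))%N)); last first.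
    by move=> r /andP[_ rN]; exact: v'E.
  rewrite {2}Nq sum_nat_modn// /average [in RHS](big_nth 0) -[X in _ *: X = _]scaler_nat scalerA.
  congr (_ *: _); rewrite Nq natrM.
  have q0 : q%:R != 0 :> R.
    by rewrite pnatr_eq0; apply/eqP => q0; move: N1; rewrite Nq q0 mul0n.
  have s0 : (size (l i))%:R != 0 :> R by rewrite pnatr_eq0 -lt0n.
  by field; rewrite q0 s0.
- move=> i r iM rN; rewrite v'E//; have [_ [h _]] := lP i.
  by have [] := h _ (mem_nth 0 (ltn_pmod r (sz i))).
Qed.

Lemma ex_bush (tau : R) : 0 < tau -> exists (M N : nat -> nat) (v : nat -> nat -> V),
  [/\ forall n, (0 < M n)%N, forall n, M n.+1 = (M n * N n)%N, forall n, (1 < N n)%N &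
   [/\ forall n i, `|v n i| <= 1,
    forall n i, (i < M n)%N ->
      `|(N n)%:R^-1 *: \sum_(0 <= r < N n) v n.+1 (i * N n + r)%N - v n i|
        <= tau * 2^-1 ^+ n &
    forall n i r, (i < M n)%N -> (r < N n)%N ->
      delta <= `|v n.+1 (i * N n + r)%N - v n i|]].
Proof.
move=> tau0.
pose state := {s : nat * (nat -> V) | forall i, `|s.2 i| <= 1}.
have /choice[next nextP] : forall ns : nat * state, exists Nv : nat * (nat -> V),
    [/\ (1 < Nv.1)%N, forall j, `|Nv.2 j| <= 1,
   forall i, (i < (sval ns.2).1)%N ->
    `|Nv.1%:R^-1 *: \sum_(0 <= r < Nv.1) Nv.2 (i * Nv.1 + r)%N - (sval ns.2).2 i|
      <= tau * 2^-1 ^+ ns.1 &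
   forall i r, (i < (sval ns.2).1)%N -> (r < Nv.1)%N ->
    delta <= `|Nv.2 (i * Nv.1 + r)%N - (sval ns.2).2 i|].
  move=> [n [[M v] /= v1]]; apply: refine_level => //.
  by rewrite mulr_gt0// exprn_gt0.
have next1 ns : forall i, `|(next ns).2 i| <= 1 by have [] := nextP ns.
have v01 : forall i : nat, `|(1%N, fun _ : nat => 0 : V).2 i| <= 1 :> R.
  by move=> i; rewrite /= normr0.
pose S := fix S n : state := if n is m.+1 then
    exist _ ((sval (S m)).1 * (next (m, S m)).1, (next (m, S m)).2)%N (next1 (m, S m))
  else exist _ (1%N, fun _ => 0) v01.
exists (fun n => (sval (S n)).1), (fun n => (next (n, S n)).1), (fun n => (sval (S n)).2).
split=> //.
- elim=> // n ih; rewrite /= muln_gt0 ih /=.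
  by have [h _ _ _] := nextP (n, S n); exact: ltnW.
- by move=> n; have [] := nextP (n, S n).
- split.
  + by move=> n; exact: (svalP (S n)).
  + by move=> n i iM; have [_ _ + _] := nextP (n, S n); apply.
  + by move=> n i r iM rN; have [_ _ _] := nextP (n, S n); apply.
Qed.

End Bush.

(** * Consequences of the G-Daugavet property *)

Theorem large_slices_not_RNP (R : realType) (k : scalar_kind)
    (X : completeNormedModType (scalars R k)) (delta : R) :
  0 < delta -> large_slices (realif X) delta -> ~ radon_nikodym_property X.
Proof.
move=> delta0 slices.
have tau0 : 0 < delta / 16 by rewrite divr_gt0.
have [M [N [v [M0 MS N1 [v1 vavg vfar]]]]] := ex_bush slices tau0.
have approx (A : set (measurableTypeR R)) eps : measurable A -> 0 < eps -> exists n U,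
    [/\ measurable U, atomic M (@cell R M) n U &
      fine (unit_lebesgue R (A `\` U)) + fine (unit_lebesgue R (U `\` A)) <= eps].
  by move=> mA eps0; have [_ h] := unit_lebesgue_approx M0 MS N1 mA; exact: h.
have tau_le : 16 * (delta / 16) <= delta by rewrite mulrC divfK.
exact: (nested_partitions_not_RNP M0 MS (@cell_measurable R M) (@unit_lebesgue_cell R M M0)
  (@cell_split R M N M0 MS N1) (@cell_trivIset R M M0) approx tau0 tau_le v1 vavg vfar).
Qed.

Theorem theorem5p2 (R : realType) (k : scalar_kind) (G : groupType)
    (X : completeNormedModType (scalars R k)) (a : isometric_action G X)
    (X_nontrivial : exists x : X, x != 0)
    (a_Daugavet : G_Daugavet a) (a_alpha : (alpha_G a < 2%:E)%E) :
  (~ radon_nikodym_property X /\ ~ reflexive_space X) /\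
  ((exists e : nat -> X, unconditional_basis e) -> contains_c0 X).
Proof.
have [delta delta0 slices] := Daugavet_large_slices X_nontrivial a_Daugavet a_alpha.
split; first split.
- exact: large_slices_not_RNP delta0 slices.
- exact: large_slices_not_reflexive delta0 slices.
move=> [e [basis unc]].
have /choice[coef coefP] : forall x : X, exists c : nat -> scalars R k,
    unique (fun c => series (fun n => c n *: e n) @ \oo --> x) c.
  by move=> x; have [c cP] := basis x; exists c.
have coef_cvg (x : X) : series (fun n => coef x n *: e n) @ \oo --> x by have [] := coefP x.
have coef_unique (x : X) (c : nat -> scalars R k) :
    series (fun n => c n *: e n) @ \oo --> x -> c = coef x.
  by move=> cx; have [_ h] := coefP x; rewrite (h c).
have pointwise (x : realif X) : exists C, forall P N, `|basis_section e coef P N x : realif X| <= C.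
  apply: (unconditional_bounded_sums (f := fun n => coef x n *: e n : realif X)) => p bp.
  have /cvg_ex[l hl] := unc _ _ (coef_cvg x) p bp.
  by apply/cvg_ex; exists l; apply/cvg_realif.
have [C C1 CP] := section_bound coef_cvg coef_unique pointwise.
exact: (@basis_contains_c0 R k X e coef coef_cvg coef_unique C C1 CP delta delta0 slices).
Qed.
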